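(* Let $m\ge1$ be an odd integer, $\lambda\in\mathcal{F}$ a strict partition, and $\mu$ a partition all of whose parts are odd and none of whose parts is divisible by $m$, with $|\lambda|=|\mu|+m$. Then $$\tilde\psi_\lambda(\mu\cup(m))=\tilde\psi_{-\frac12\Phi(\lambda)}(\mu).$$ Here $\mu\cup(m)$ is $\mu$ with a part $m$ appended, $\tilde\psi_\kappa(\nu)$ is extended linearly in $\kappa$ to $\mathcal{F}$, and $\Phi:\mathcal{F}\to\mathcal{F}$ is the $\mathbb{C}$-linear map defined by $\Phi(\lambda)=\sum_\alpha\epsilon_\alpha\cdot(\alpha,\lambda)$ for strict partitions $\lambda$, where the sum is over all integer sequences $\alpha=(\alpha_1,\ldots,\alpha_{2s+1})$ of odd length (any $s\geq 0$) such that $\alpha_{2i-1}>\alpha_{2i}$ and $\{\alpha_{2i-1},\alpha_{2i}\}\equiv\{2c_i,-2c_i\}\pmod m$ for $1\le i\le s$, for some integers $\frac{m-1}{2}\ge c_1>\cdots>c_s>0$, and $\alpha_{2s+1}\equiv0\pmod m$, and $\sum_i\alpha_i=-m$. For such a sequence $\epsilon_\alpha=(-1)^{n(\alpha)}$, where $n(\alpha)$ is the number of $i$ with $1\leq i\leq s$ such that $\alpha_{2i}\equiv-2c_i\pmod m$, and $(\alpha,\lambda)$ is the concatenation of $\alpha$ and $\lambda$.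
   Context: **The space $\mathcal{F}$.** A partition $(\lambda_1,\ldots,\lambda_l)$ is strict if $\lambda_1>\cdots>\lambda_l>0$. $\mathcal{F}$ is the $\mathbb{C}$-vector space generated by all integer sequences of finite length subject to the following relations, so that strict partitions (including the empty one) form a basis. For a sequence $\alpha$: (1) if for some $i\ge1$ the subsequence of $\alpha$ consisting of all occurrences of $\pm i$ is not of the form $i,-i,i,\ldots,-i,i$ or $-i,i,\ldots,-i,i$ (the empty subsequence being allowed), then $\alpha=0$; (2) otherwise there is a permutation of $\alpha$ of the form $\lambda,-a_1,a_1,\ldots,-a_r,a_r,0,\ldots,0$ with $\lambda$ a strict partition and $a_1,\ldots,a_r$ positive integers (not necessarily distinct), and then $\alpha=(-1)^{a_1+\cdots+a_r}2^r\epsilon\,\lambda$ in $\mathcal{F}$, where $\epsilon$ is the sign of any permutation taking $\alpha$ to that form while, for each $i\ge0$, keeping the relative order of the terms $\pm i$. In the definition of $\Phi(\lambda)$ only finitely many terms are nonzero in $\mathcal F$. **The characters.** $\tilde S_n$ is the group with generators $s_1,\ldots,s_{n-1},z$ and relations: $z$ central, $z^2=1$, $s_i^2=z$, $s_is_j=zs_js_i$ for $|i-j|\ge2$, $(s_is_{i+1})^3=z$. Let $\theta:\tilde S_n\to S_n$ be the surjection with $\theta(z)=1$, $\theta(s_i)=(i\ \,i+1)$. An irreducible representation of $\tilde S_n$ is negative if $z$ acts by $-1$; these are indexed (up to tensoring with $\mathrm{sgn}\circ\theta$) by strict partitions $\lambda$ of $n$ in the standard way, and $\psi_\lambda$ is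 the corresponding irreducible character. For a partition $\mu$ of $n$ with all parts odd, $\theta^{-1}$ of the class of cycle type $\mu$ splits into two classes; $\psi_\lambda(\mu)$ is the value of $\psi_\lambda$ at an element $g_\mu$ of this preimage chosen so that the character of the basic representation of $\tilde S_n$ (the one indexed by $(n)$) is positive at $g_\mu$. Set $\tilde\psi_\lambda(\mu)=2^{\lceil(\ell(\lambda)-\ell(\mu))/2\rceil}\psi_\lambda(\mu)$, where $\ell$ denotes the number of parts. **Known formula fixing the labelling.** Let $q_n=\sum_i h_{n-i}e_i$ (with $h_r,e_r$ complete and elementary symmetric functions), $\Gamma=\mathbb{Z}[q_1,q_2,\ldots]$, with basis the Schur $Q$-functions $Q_\lambda$ ($\lambda$ strict), inner product $\langle Q_\lambda,Q_\mu\rangle=\delta_{\lambda\mu}2^{\ell(\lambda)}$, and $f^\perp$ the adjoint of multiplication by $f$ (over $\mathbb{Q}$). Then for $\lambda$ strict and $\mu$ with all parts odd, $|\lambda|=|\mu|$, one has $\tilde\psi_\lambda(\mu)=p_{\mu_1}^\perp\cdots p_{\mu_l}^\perp Q_\lambda$, where $p_r$ is the $r$-th power sum. Also $Q_\lambda=\mathcal{B}_{\lambda_1}\cdots\mathcal{B}_{\lambda_l}(1)$ with $\mathcal{B}_n=\sum_{i\ge0}(-1)^iq_{n+i}q_i^\perp$. *)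

(* Defs.v *)
From HB Require Import structures.
From mathcomp Require Import all_boot all_order all_algebra all_fingroup.
From mathcomp Require Import mxrepresentation.
From mathcomp Require Import finmap.
From mathcomp Require Import classical_sets fsbigop reals.
From mathcomp Require Import complex.
From mathcomp Require Import monalg.

Set Implicit Arguments.
Unset Strict Implicit.
Unset Printing Implicit Defensive.

Import Order.TTheory GRing.Theory Num.Theory.
Local Open Scope ring_scope.

(* Partitions are non-increasing lists of positive integers. *)

Definition is_part (mu : seq nat) : bool := sorted geq mu && (0%N \notin mu).

Definition is_strict (l : seq nat) : bool := sorted gtn l && (0%N \notin l).

Record spart := SPart { spart_seq :> seq nat; _ : is_strict spart_seq }.
HB.instance Definition _ := [isSub for spart_seq].
HB.instance Definition _ := [Choice of spart by <:].

Definition spart0 : spart := @SPart [::] isT.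

Definition to_spart (l : seq nat) : spart := insubd spart0 l.

(* The strict partition (n), which is the empty one when n = 0. *)
Definition row_part (n : nat) : spart := to_spart [:: n].

(* The space F, realised as the free vector space on its basis of strict
   partitions; [word a] below is the class in F of the integer sequence a. *)

Notation Fspace R := {malg R[i][spart]}.

(* For i >= 1 the terms +-i of a alternate in sign, the last one being i. *)
Definition alternating (a : seq int) (i : nat) : bool :=
  let v := [seq x <- a | `|x|%N == i] in
  sorted (fun x y : int => y == - x) v && (last (i%:Z) v == i%:Z).

Definition vanishing (a : seq int) : bool :=
  has (fun x : int => (x != 0) && ~~ alternating a `|x|%N) a.

(* If b = lambda, -a_1, a_1, .., -a_r, a_r, 0, .., 0 then lambda is the longest
   positive prefix of b and the a_i are the remaining positive terms. *)
Definition nf_len (b : seq int) : nat := find (fun x : int => x <= 0) b.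
Definition nf_part (b : seq int) : seq nat :=
  [seq `|x|%N | x : int <- take (nf_len b) b].
Definition nf_pairs (b : seq int) : seq nat :=
  [seq `|x|%N | x : int <- drop (nf_len b) b & 0 < x].
Definition is_nf (b : seq int) : bool :=
  is_strict (nf_part b) &&
  (b == [seq a%:Z | a <- nf_part b]
        ++ flatten [seq [:: - (a%:Z); a%:Z] | a <- nf_pairs b]
        ++ nseq (count_mem 0 b) 0).

Definition permuted (a : seq int) (s : {perm 'I_(size a)}) : seq int :=
  [seq a`_(s i) | i <- enum 'I_(size a)].

Definition keeps_order (a : seq int) (s : {perm 'I_(size a)}) : bool :=
  [forall i : 'I_(size a), forall j : 'I_(size a),
     ((i < j)%N && (absz a`_(s i) == absz a`_(s j))) ==> (s i < s j)%N].

Definition word (R : realType) (a : seq int) : Fspace R :=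
  if vanishing a then 0 else
  if [pick s : {perm 'I_(size a)} | is_nf (permuted s) && keeps_order s] is Some s
  then
    let b := permuted s in
    << (-1) ^+ (sumn (nf_pairs b)) * 2 ^+ (size (nf_pairs b)) * (-1) ^+ s
       *g to_spart (nf_part b) >>
  else 0.

(* The operator Phi.  Sequences are indexed from 0 here, so the i-th pair
   (0 <= i < s) of a is (a`_(2i), a`_(2i+1)), and its last term is a`_(2s). *)

Definition pair_cong (m : nat) (x y : int) (c : nat) : bool :=
     ((x == 2 * c%:Z %[mod m])%Z && (y == - (2 * c%:Z) %[mod m])%Z)
  || ((x == - (2 * c%:Z) %[mod m])%Z && (y == 2 * c%:Z %[mod m])%Z).

Definition admissible (m : nat) (a : seq int) (c : seq nat) : bool :=
  let s := size c in
  [&& size a == s.*2.+1,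
      sorted gtn c,
      all (fun k => (0 < k <= m.-1./2)%N) c,
      all (fun i => (a`_(i.*2.+1) < a`_(i.*2))
                    && pair_cong m a`_(i.*2) a`_(i.*2.+1) (nth 0%N c i))
          (iota 0 s),
      (m %| a`_(s.*2))%Z
    & \sum_(x <- a) x == - (m%:Z)].

(* As m is odd, c_i is determined by the i-th pair among 1, .., (m-1)/2, so
   the c searched for here is the c_i of [admissible]. *)
Definition n_alpha (m : nat) (a : seq int) : nat :=
  count (fun i =>
           has (fun c => pair_cong m a`_(i.*2) a`_(i.*2.+1) c
                         && (a`_(i.*2.+1) == - (2 * c%:Z) %[mod m])%Z)
               (iota 1 m.-1./2))
        (iota 0 (size a)./2).

(* The sum is the finitely supported one, over the terms that are nonzero
   in F. *)
Definition Phi_basis (R : realType) (m : nat) (l : spart) : Fspace R :=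
  \sum_(a \in [set a : seq int | exists c, admissible m a c]%classic)
     (-1) ^+ n_alpha m a *: word R (a ++ [seq k%:Z | k <- spart_seq l]).

Definition Phi (R : realType) (m : nat) (v : Fspace R) : Fspace R :=
  \sum_(l <- msupp v) v@_l *: Phi_basis R m l.

(* The group tilde S_n.  The generator s_i of the text is [sgen i'] with
   i' = i - 1, and points of {1, .., n} are likewise shifted. *)

Definition spin_relations (H : groupType) (n : nat) (t : 'I_n.-1 -> H) (y : H)
    : Prop :=
  [/\ (forall i, y * t i = t i * y)%g /\ (y ^+ 2 = 1)%g,
      (forall i, (t i ^+ 2 = y)%g),
      (forall i j : 'I_n.-1, (i.+1 < j \/ j.+1 < i)%N ->
          (t i * t j = y * t j * t i)%g)
    & (forall i j : 'I_n.-1, j = i.+1 :> nat -> ((t i * t j) ^+ 3 = y)%g)].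

Record tildeS (n : nat) := TildeS {
  ts_group :> finGroupType;
  sgen : 'I_n.-1 -> ts_group;
  zgen : ts_group;
  theta : {morphism [set: ts_group] >-> {perm 'I_n}};
  ts_relations : spin_relations sgen zgen;
  ts_generated : <<zgen |: [set sgen i | i : 'I_n.-1]>>%g = [set: ts_group];
  ts_universal : forall (H : groupType) (t : 'I_n.-1 -> H) (y : H),
    spin_relations t y ->
    exists f : ts_group -> H,
      [/\ (forall u v, f (u * v) = f u * f v)%g,
          (forall i, f (sgen i) = t i)
        & f zgen = y];
  theta_z : theta zgen = 1%g;
  theta_s : forall (i : 'I_n.-1) (a b : 'I_n),
    a = i :> nat -> b = i.+1 :> nat -> theta (sgen i) = tperm a b
}.

Definition cycle_type (n : nat) (w : {perm 'I_n}) (mu : seq nat) : Prop :=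
  perm_eq [seq #|c| | c : {set 'I_n} <- enum (porbits w)] mu.

Definition negative_irr_char (R : realType) (n : nat) (G : tildeS n)
    (chi : G -> R[i]) : Prop :=
  exists (d : nat) (rho : mx_representation R[i] [set: G]%G d),
    [/\ mx_irreducible rho,
        rho (zgen G) = (-1)%:M
      & forall x, chi x = \tr (rho x)].

Definition twist (R : realType) (n : nat) (G : tildeS n) (chi : G -> R[i])
    : G -> R[i] :=
  fun x => (-1) ^+ (theta G x : {perm 'I_n}) * chi x.

(* Symmetric functions with rational coefficients, as the polynomial ring in
   the power sums p_1, p_2, ..; the variable of index r stands for p_(r+1). *)

Notation Lam := {malg rat[{cmonom nat}]}.

Definition psum (r : nat) : Lam := << ucm r.-1 >>.

(* Newton's identities: r h_r = sum_(1 <= i <= r) p_i h_(r-i) and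
   r e_r = sum_(1 <= i <= r) (-1)^(i-1) p_i e_(r-i). *)
Fixpoint newton (c : nat -> rat) (n : nat) : seq Lam :=
  if n is n'.+1 then
    let s := newton c n' in
    rcons s ((n%:R)^-1 *: \sum_(i < n) c i *: (psum i.+1 * s`_(n' - i)))
  else [:: 1].

Definition comp_sym (n : nat) : Lam := (newton (fun=> 1) n)`_n.
Definition elem_sym (n : nat) : Lam := (newton (fun i => (-1) ^+ i) n)`_n.

Definition qsym (n : nat) : Lam := \sum_(i < n.+1) comp_sym (n - i) * elem_sym i.

(* The rational span of Gamma = Z[q_1, q_2, ..]. *)
Inductive inGamma : Lam -> Prop :=
| Gamma_q n : inGamma (qsym n)
| Gamma_add f g : inGamma f -> inGamma g -> inGamma (f + g)
| Gamma_mul f g : inGamma f -> inGamma g -> inGamma (f * g)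
| Gamma_scale (c : rat) f : inGamma f -> inGamma (c *: f).

Definition homogeneous (d : nat) (f : Lam) : Prop :=
  forall k, k \in msupp f -> (\sum_(i <- finsupp k) k i * i.+1)%N = d.

(* B_n = sum_(i >= 0) (-1)^i q_(n+i) q_i^perp. *)
Definition vertexB (perp : Lam -> Lam -> Lam) (n : nat) (f : Lam) : Lam :=
  \sum_(i \in [set: nat]%classic) (-1) ^+ i *: (qsym (n + i) * perp (qsym i) f).

(* The Schur Q-functions with their inner product, [perp f] being the adjoint
   of multiplication by f.  By induction on the degree, these properties
   determine all three on (rational) Gamma: Q_lambda only involves the inner
   product in degrees smaller than |lambda|. *)
Record schurQ := SchurQ {
  Qf : spart -> Lam;
  ip : Lam -> Lam -> rat;
  perp : Lam -> Lam -> Lam;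
  Q_homogeneous : forall l : spart, homogeneous (sumn l) (Qf l);
  Q_Gamma : forall l : spart, inGamma (Qf l);
  Q_basis : forall f, inGamma f ->
    exists! c : {malg rat[spart]}, f = \sum_(l <- msupp c) c@_l *: Qf l;
  ip_sym : forall f g, inGamma f -> inGamma g -> ip f g = ip g f;
  ip_linear : forall (c : rat) f f' g, inGamma f -> inGamma f' -> inGamma g ->
    ip (c *: f + f') g = c * ip f g + ip f' g;
  ip_Q : forall l l' : spart, ip (Qf l) (Qf l') = (l == l')%:R * 2 ^+ size l;
  perp_Gamma : forall f g, inGamma f -> inGamma g -> inGamma (perp f g);
  perp_adjoint : forall f g h, inGamma f -> inGamma g -> inGamma h ->
    ip (perp f g) h = ip g (f * h);
  Q_vertex : forall l : spart, Qf l = foldr (vertexB perp) 1 (spart_seq l)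
}.

(* tilde psi_lambda(mu), for |lambda| = |mu|; the exponent is
   ceil(d / 2) = floor((d + 1) / 2) with d = l(lambda) - l(mu). *)
Definition tpsi_of (R : realType) (S : forall n, tildeS n)
    (psi : forall n, spart -> S n -> R[i]) (g : forall n, seq nat -> S n)
    (l : spart) (mu : seq nat) : R[i] :=
  2 ^ (((size l)%:Z - (size mu)%:Z + 1) %/ 2)%Z
    * psi (sumn mu) l (g (sumn mu) mu).

(* A choice of characters psi_lambda and of elements g_mu: the psi_lambda with
   |lambda| = n are the negative irreducible characters of tilde S_n up to
   tensoring with the sign, labelled as prescribed by the Schur Q-functions.
   [psi n l] is meaningful for |l| = n, and [g n mu] for partitions mu of n
   with odd parts. *)
Record spin_characters (R : realType) (S : forall n, tildeS n) (X : schurQ) :=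
  SpinCharacters {
  psi : forall n, spart -> S n -> R[i];
  gelt : forall n, seq nat -> S n;
  psi_irr : forall n (l : spart), sumn l = n -> negative_irr_char (psi (n := n) l);
  psi_complete : forall n (chi : S n -> R[i]), negative_irr_char chi ->
    exists2 l : spart, sumn l = n
      & chi =1 psi (n := n) l \/ chi =1 twist (psi (n := n) l);
  psi_distinct : forall n (l l' : spart), sumn l = n -> sumn l' = n ->
    psi (n := n) l =1 psi (n := n) l' \/ psi (n := n) l =1 twist (psi (n := n) l') ->
    l = l';
  gelt_class : forall n mu, is_part mu -> all odd mu -> sumn mu = n ->
    cycle_type (theta (S n) (gelt n mu)) mu;
  gelt_basic : forall n mu, is_part mu -> all odd mu -> sumn mu = n ->
    0 < psi (row_part n) (gelt n mu);
  psi_label : forall (l : spart) mu,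
    is_part mu -> all odd mu -> sumn l = sumn mu ->
    exists2 c : rat,
      foldr (fun r f => perp X (psum r) f) (Qf X l) mu = c *: 1
      & tpsi_of psi gelt l mu = ratr c
}.

(* tilde psi_kappa(nu) extended linearly in kappa; basis vectors rho with
   |rho| <> |nu|, where psi_rho(nu) makes no sense, contribute nothing. *)
Definition tpsi (R : realType) (S : forall n, tildeS n) (X : schurQ)
    (P : spin_characters R S X) (v : Fspace R) (nu : seq nat) : R[i] :=
  \sum_(l <- msupp v | sumn (spart_seq l) == sumn nu)
     v@_l * tpsi_of (psi P) (gelt P) l nu.

(* Main.v *)
Require Import Defs.
From HB Require Import structures.
From mathcomp Require Import all_boot all_order all_algebra all_fingroup.
From mathcomp Require Import finmap.
From mathcomp Require Import classical_sets fsbigop reals complex monalg.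
From mathcomp Require Import zify ring lra.

(** The proof translates the statement into one about the vertex operators
    B_a, a an integer, acting on symmetric functions, of which the
    [vertexB] with a >= 0 are instances.  They satisfy the Clifford relations
    B_a B_b + B_b B_a = 2 (-1)^a delta_(a + b, 0) ([vop_anticomm]), they kill 1 for
    a < 0 and fix it for a = 0, and for odd k the adjoint p_k^perp of the
    multiplication by p_k satisfies p_k^perp B_a = B_a p_k^perp + B_(a - k)
    ([pad_vop]).  These rules reduce a word B_(a_1) .. B_(a_l) 1 to a multiple
    of some Q_l exactly as the relations of the space F reduce the integer
    sequence a to a multiple of a strict partition ([word_vword]), and the
    character value is the constant term of p_mu^perp Q_l ([schurQ_pieri]).
    Prefixing the sequences of Phi, with their signs, is thus the action of an
    operator W, and the statement becomes: the constant term of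
    p_mu^perp W Q_lambda is -2 times that of p_mu^perp p_m^perp Q_lambda.

    W is an infinite sum, but for a given lambda the sequences with a large
    letter contribute nothing ([adm_bound]), so the letters may be confined to
    a window -N .. N with N large.  There W factors as the product, over the
    classes c in decreasing order, of the operators 1 + X_c, times C_0
    ([Wop_alphas]).  Here C_q is the sum of the B_a with a = q mod m, and X_c
    is, up to a scalar, - C_(2c) C_(-2c).  Two facts give the result.

    (1) p_k^perp commutes with W, for k odd and not divisible by m, up to
    vectors all of whose components have degree at least N - D, where D does
    not depend on N ([sp1_padl_Wop]); so p_mu^perp can be moved across W.  Indeed the
    anticommutator of W with B_a only depends, up to a sign, on a mod m
    ([anti_shift]).  Hence the commutator Z of p_k^perp and W satisfies
    Z B_a f = - B_a Z f + eps B_a' Z f, where eps is a sign and a' = a mod m is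
    so negative that B_a' f = 0.  This reduces the claim to f = 1.  On the
    vacuum only letters a >= 0 act, they anticommute except for
    B_0 B_0 = 1, and p_k^perp lowers one of them by k.  The terms obtained from
    the residues r and k - r cancel ([pad_Wop_vac]); their signs agree because
    of an identity between partial sums of 1 - 1 + 1 - .. along a residue class
    ([altsum_neq0], [altsum_eq0]), and this is where the order of the factors
    1 + X_c and the signs in Phi matter.

    (2) On vectors of degree m the constant term of W f is -2 times that of
    p_m^perp f ([sp1_W]).  By the Clifford relations f may be taken to be Q_l
    with l strict of size m.  For l = (m) both sides are -2, for two parts
    (a, b) both are -4 (-1)^b, and both vanish for three or more parts: W
    preserves, for each class of residues, the difference between the numbers
    of letters congruent to 2c and to -2c. *)

Set Implicit Arguments.
Unset Strict Implicit.
Unset Printing Implicit Defensive.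

Import Order.TTheory GRing.Theory Num.Theory.
Local Open Scope ring_scope.

(** * Symmetric functions and adjoint operators *)

Section NewtonProduct.
Variables (A : comAlgType rat) (p h e : nat -> A) (c d : nat -> rat).
Hypothesis h_rec : forall n, n.+1%:R *: h n.+1 =
  \sum_(i < n.+1) c i *: (p i.+1 * h (n - i)%N).
Hypothesis e_rec : forall n, n.+1%:R *: e n.+1 =
  \sum_(i < n.+1) d i *: (p i.+1 * e (n - i)%N).

(** Newton's identities say that the logarithmic derivatives of the two
    generating series are those with coefficients [c i *: p i.+1] and
    [d i *: p i.+1]; that of the product of the series is their sum. *)
Lemma newton_product n :
  n.+1%:R *: (\sum_(i < n.+2) h (n.+1 - i)%N * e i) =
  \sum_(i < n.+1) (c i + d i) *:
    (p i.+1 * \sum_(j < (n - i).+1) h (n - i - j)%N * e j).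
Proof.
pose H : {poly A} := \poly_(i < n.+2) h i.
pose E : {poly A} := \poly_(i < n.+2) e i.
pose C : {poly A} := \poly_(i < n.+2) (c i *: p i.+1).
pose D : {poly A} := \poly_(i < n.+2) (d i *: p i.+1).
have logder (f : nat -> A) (b : nat -> rat) :
    (forall n, n.+1%:R *: f n.+1 = \sum_(i < n.+1) b i *: (p i.+1 * f (n - i)%N)) ->
    let F : {poly A} := \poly_(i < n.+2) f i in
    forall k, (k <= n)%N ->
    F^`()`_k = ((\poly_(i < n.+2) (b i *: p i.+1)) * F)`_k.
  move=> f_rec F k le_kn; rewrite coef_deriv coefM coef_poly ltnS ltnS le_kn.
  rewrite -scaler_nat f_rec; apply: eq_bigr => i _.
  by rewrite !coef_poly !ifT ?scalerAl //; have := ltn_ord i; lia.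
have conv k : (k <= n.+1)%N ->
    \sum_(j < k.+1) h (k - j)%N * e j = (H * E)`_k.
  move=> le_kn; rewrite coefMr; apply: eq_bigr => i _.
  by rewrite !coef_poly !ifT //; have := ltn_ord i; lia.
rewrite conv // scaler_nat -coef_deriv derivM coefD.
have -> : (H^`() * E)`_n = ((C * H) * E)`_n.
  rewrite !coefM; apply: eq_bigr => i _; congr (_ * _).
  by apply: logder => //; rewrite -ltnS.
have -> : (H * E^`())`_n = (H * (D * E))`_n.
  rewrite !coefM; apply: eq_bigr => i _; congr (_ * _).
  by apply: logder => //; rewrite leq_subr.
rewrite mulrCA -coefD -mulrA -mulrDl coefM; apply: eq_bigr => i _.
rewrite coefD !coef_poly !ifT; try by have := ltn_ord i; lia.
by rewrite -scalerDl -conv ?scalerAl //; have := ltn_ord i; lia.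
Qed.

End NewtonProduct.

(** The polynomial ring in the power sums [pw j.+1], given by the identities
    used below.  For the form [sp] the operators [pad k] and [qad n] are the
    adjoints of multiplication by [pw k] and by [qn n], and [sp 1] takes the
    constant term.  The bound [qad_deg f] makes the sum over all [qad n f]
    finite. *)
Record fock := Fock {
  fock_alg :> comAlgType rat;
  pw : nat -> fock_alg;
  qn : nat -> fock_alg;
  pad : nat -> fock_alg -> fock_alg;
  qad : nat -> fock_alg -> fock_alg;
  qad_deg : fock_alg -> nat;
  sp : fock_alg -> fock_alg -> rat;
  fock_ind : forall Pr : fock_alg -> Prop,
    Pr 1 -> (forall f g, Pr f -> Pr g -> Pr (f + g)) ->
    (forall c f, Pr f -> Pr (c *: f)) ->
    (forall j f, Pr f -> Pr (pw j.+1 * f)) -> forall f, Pr f;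
  qn0 : qn 0 = 1;
  qn_rec : forall n, n.+1%:R *: qn n.+1 =
    \sum_(i < n.+1 | ~~ odd i) 2 *: (pw i.+1 * qn (n - i)%N);
  pad_linear : forall k, linear (pad k);
  pad1 : forall k, pad k 1 = 0;
  pad_pwM : forall k j f, (0 < k)%N -> pad k (pw j.+1 * f) =
    ((k == j.+1)%:R * (k%:R / 2)) *: f + pw j.+1 * pad k f;
  qad_linear : forall n, linear (qad n);
  qad1 : forall n, qad n 1 = (n == 0%N)%:R;
  qad_pwM : forall n j f, qad n (pw j.+1 * f) = pw j.+1 * qad n f +
    (if odd j.+1 && (j < n)%N then qad (n - j.+1) f else 0);
  qadM : forall n f g,
    qad n (f * g) = \sum_(i < n.+1) qad i f * qad (n - i) g;
  qad_nil : forall n f, (qad_deg f <= n)%N -> qad n f = 0;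
  sp_linear : forall h c f g, sp h (c *: f + g) = c * sp h f + sp h g;
  spC : forall f g, sp f g = sp g f;
  sp_def : forall f, sp f f = 0 -> f = 0;
  sp11 : sp 1 1 = 1;
  sp_pwM : forall j f g, sp (pw j.+1 * f) g = sp f (pad j.+1 g) }.

HB.instance Definition _ (X : fock) k :=
  GRing.isLinear.Build rat X X _ (@pad X k) (@pad_linear X k).
HB.instance Definition _ (X : fock) n :=
  GRing.isLinear.Build rat X X _ (@qad X n) (@qad_linear X n).

Section Fock.
Variable X : fock.
Implicit Types (f g h : X) (c : rat).

Lemma padD k f g : pad k (f + g) = pad k f + pad k g.
Proof. exact: raddfD. Qed.
Lemma padB k f g : pad k (f - g) = pad k f - pad k g.
Proof. exact: raddfB. Qed.
Lemma padZ k c f : pad k (c *: f) = c *: pad k f.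
Proof. exact: linearZ. Qed.
Lemma pad0 k : pad k (0 : X) = 0.
Proof. exact: raddf0. Qed.
Lemma pad_sum k (I : Type) (r : seq I) (Pr : pred I) (F : I -> X) :
  pad k (\sum_(i <- r | Pr i) F i) = \sum_(i <- r | Pr i) pad k (F i).
Proof. exact: raddf_sum. Qed.

Lemma qadD n f g : qad n (f + g) = qad n f + qad n g.
Proof. exact: raddfD. Qed.
Lemma qadZ n c f : qad n (c *: f) = c *: qad n f.
Proof. exact: linearZ. Qed.
Lemma qad0 n : qad n (0 : X) = 0.
Proof. exact: raddf0. Qed.
Lemma qad_sum n (I : Type) (r : seq I) (Pr : pred I) (F : I -> X) :
  qad n (\sum_(i <- r | Pr i) F i) = \sum_(i <- r | Pr i) qad n (F i).
Proof. exact: raddf_sum. Qed.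

Lemma sp0r h : sp h (0 : X) = 0.
Proof.
by have := sp_linear h (- 1) 0 0; rewrite scaler0 addr0 mulN1r addNr.
Qed.
Lemma spDr h f g : sp h (f + g) = sp h f + sp h g.
Proof. by rewrite -[f]scale1r sp_linear mul1r scale1r. Qed.
Lemma spZr h c f : sp h (c *: f) = c * sp h f.
Proof. by rewrite -[c *: f]addr0 sp_linear sp0r addr0. Qed.
Lemma spBr h f g : sp h (f - g) = sp h f - sp h g.
Proof. by rewrite -scaleN1r addrC sp_linear mulN1r addrC. Qed.
Lemma sp0l h : sp (0 : X) h = 0.
Proof. by rewrite spC sp0r. Qed.
Lemma spDl h f g : sp (f + g) h = sp f h + sp g h.
Proof. by rewrite !(spC _ h) spDr. Qed.
Lemma spZl h c f : sp (c *: f) h = c * sp f h.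
Proof. by rewrite !(spC _ h) spZr. Qed.
Lemma sp_sumr h (I : Type) (r : seq I) (Pr : pred I) (F : I -> X) :
  sp h (\sum_(i <- r | Pr i) F i) = \sum_(i <- r | Pr i) sp h (F i).
Proof. exact: (big_morph _ (spDr h) (sp0r h)). Qed.
Lemma sp_suml h (I : Type) (r : seq I) (Pr : pred I) (F : I -> X) :
  sp (\sum_(i <- r | Pr i) F i) h = \sum_(i <- r | Pr i) sp (F i) h.
Proof. by rewrite spC sp_sumr; under eq_bigr do rewrite spC. Qed.

Lemma sp_ext g h : (forall f, sp f g = sp f h) -> g = h.
Proof.
move=> gh; apply/eqP; rewrite -subr_eq0; apply/eqP/sp_def.
by rewrite spBr gh subrr.
Qed.

Lemma sp_pwMr j f g : sp (pad j.+1 f) g = sp f (pw X j.+1 * g).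
Proof. by rewrite spC -sp_pwM spC. Qed.

Lemma padM k f g : (0 < k)%N ->
  pad k (f * g) = pad k f * g + f * pad k g.
Proof.
move=> k_gt0; elim/fock_ind: f => [|f f' IHf IHf'|c f IHf|j f IHf].
- by rewrite pad1 mul0r add0r !mul1r.
- by rewrite mulrDl !padD IHf IHf' !mulrDl addrACA.
- by rewrite -scalerAl !padZ IHf scalerDr !scalerAl.
- rewrite -mulrA !pad_pwM // IHf !mulrDl mulrDr -scalerAl !mulrA.
  by rewrite -!addrA.
Qed.

(** ** The polynomials q_n *)

(** Extended by zero to negative indices, so that the summation ranges below
    need no side conditions. *)
Definition qz (z : int) : X := if z is Posz n then qn X n else 0.

Lemma qz_neg z : z < 0 -> qz z = 0.
Proof. by case: z. Qed.

Lemma qz0 : qz 0 = 1.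
Proof. exact: qn0. Qed.

(** The number [N] of summands is free: the recursions for [z] and for
    [z - n] can then be compared term by term. *)
Lemma qz_rec z N : z <= N%:Z ->
  z%:~R *: qz z = \sum_(i < N | ~~ odd i) 2 *: (pw X i.+1 * qz (z - i.+1%:Z)).
Proof.
move=> le_zN; case: (ltP 0 z) => [z_gt0|z_le0]; last first.
  rewrite big1 => [|i _]; last first.
    by rewrite [qz (_ - _)]qz_neg ?mulr0 ?scaler0 //; lia.
  have [->|/eqP z0] := eqVneq z 0; first by rewrite scale0r.
  by rewrite qz_neg ?scaler0 //; lia.
case: z z_gt0 le_zN => // -[//|n] _ le_nN.
rewrite -[_%:~R]/(n.+1%:R) /= qn_rec.
have le_nN' : (n.+1 <= N)%N by lia.
rewrite (big_ord_widen_cond N (fun i => ~~ odd i)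
  (fun i => 2 *: (pw X i.+1 * qn X (n - i))) le_nN').
rewrite big_mkcondr /=; apply: eq_bigr => i _.
case: ltnP => [lt_in|le_ni].
  by congr (_ *: (_ * _)); rewrite -[qn X _]/(qz (n - i)%N%:Z); congr qz; lia.
by rewrite qz_neg ?mulr0 ?scaler0 //; lia.
Qed.

Lemma qz_ind (Pr : int -> Prop) :
  (forall z, z < 0 -> Pr z) -> Pr 0 ->
  (forall z, 0 < z -> (forall y, y < z -> Pr y) -> Pr z) -> forall z, Pr z.
Proof.
move=> Pneg P0 Ppos z; have [n] := ubnP `|z|%N.
elim: n z => [//|n IHn] z lt_zn.
case: (ltgtP z 0) => [/Pneg//|z_gt0|-> //].
apply: Ppos => // y lt_yz; case: (ltP y 0) => [/Pneg//|y_ge0].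
by apply: IHn; lia.
Qed.

Lemma intr_neq0 (z : int) : 0 < z -> z%:~R != 0 :> rat.
Proof. by move=> z_gt0; rewrite intr_eq0 gt_eqF. Qed.

(** The generating series of the [qn] is exp (2 (p_1 t + p_3 t^3 / 3 + ..)),
    and [pad j] is (j / 2) d/dp_j. *)
Lemma pad_qz j z : (0 < j)%N ->
  pad j (qz z) = if odd j then qz (z - j%:Z) else 0.
Proof.
move=> j_gt0; elim/qz_ind: z => [z z_lt0||z z_gt0 IHz].
- by rewrite !qz_neg ?pad0 //; [case: ifP | lia].
- by rewrite qz0 pad1; case: ifP => // _; rewrite qz_neg //; lia.
apply: (scalerI (intr_neq0 z_gt0)).
pose N := (`|z| + j)%N.
rewrite -padZ (qz_rec (N := N)) ?pad_sum; last by rewrite /N; lia.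
have E (i : nat) : pad j (2 *: (pw X i.+1 * qz (z - i.+1%:Z))) =
    ((j == i.+1)%:R * j%:R) *: qz (z - i.+1%:Z) +
    (if odd j then 2 *: (pw X i.+1 * qz (z - j%:Z - i.+1%:Z)) else 0).
  rewrite padZ pad_pwM // IHz; last by lia.
  rewrite scalerDr scalerA mulrCA [2 * _]mulrC divfK //; congr (_ + _).
  case: (odd j); last by rewrite mulr0 scaler0.
  by congr (_ *: (_ * qz _)); lia.
under eq_bigr do rewrite E.
rewrite big_split /=.
have lt_jN : (j.-1 < N)%N by rewrite /N; lia.
rewrite (bigID (fun i : 'I_N => i == Ordinal lt_jN)) /=.
rewrite [X in _ + X + _]big1 ?addr0; last first.
  move=> i /andP[_ ij]; rewrite [j == _](negPf _) ?mul0r ?scale0r //.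
  by apply: contraNneq ij => jE; apply/eqP/val_inj => /=; lia.
have oddj : ~~ odd j.-1 = odd j by rewrite -{2}(prednK j_gt0).
case: (boolP (odd j)) => odd_j; last first.
  rewrite [X in _ + X]big1 // addr0 scaler0 big1 //.
  by move=> i /andP[H /eqP ij]; move: H; rewrite ij /= oddj (negPf odd_j).
rewrite (big_pred1 (Ordinal lt_jN)) => [|i]; last first.
  by apply/andP/eqP => [[_ /eqP]//|->]; rewrite /= oddj odd_j.
rewrite -qz_rec; last by rewrite /N; lia.
rewrite /= prednK // eqxx mul1r -scalerDl -[j%:R]/(j%:~R) -rmorphD /=.
by congr (_%:~R *: _); lia.
Qed.

(** The two sides obey the same recursion: [qad n] commutes with
    multiplication by a power sum up to the terms by which [pad] acts on
    [qn n]. *)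
Lemma sp_qnM n f g : sp (qn X n * f) g = sp f (qad n g).
Proof.
rewrite -[qn X n]/(qz n).
elim/fock_ind: g n f => [|g g' IHg IHg'|c g IHg|j g IHg] n f.
- rewrite qad1; case: n => [|n]; first by rewrite qz0 mul1r.
  apply/eqP; rewrite sp0r -(mulrI_eq0 _ (mulfI (intr_neq0 (z := n.+1) isT))).
  rewrite -spZl scalerAl (qz_rec (N := n.+1)) // mulr_suml sp_suml big1 //.
  by move=> i _; rewrite -scalerAl -mulrA spZl sp_pwM pad1 sp0r mulr0.
- by rewrite qadD !spDr IHg IHg'.
- by rewrite qadZ !spZr IHg.
- rewrite -sp_pwMr padM // pad_qz // spDl IHg sp_pwMr qad_pwM spDr addrC.
  congr (_ + _); case: (odd j.+1) => /=; last by rewrite mul0r sp0l sp0r.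
  case: ltnP => [lt_jn|le_nj].
    by rewrite subzn // IHg.
  by rewrite qz_neg ?mul0r ?sp0l ?sp0r //; lia.
Qed.

Lemma sp_qadl n f g : sp (qad n f) g = sp f (qn X n * g).
Proof. by rewrite spC -sp_qnM spC. Qed.

Lemma qad_id f : qad 0 f = f.
Proof. by apply: sp_ext => g; rewrite -sp_qnM qn0 mul1r. Qed.

Lemma qadC i j f : qad i (qad j f) = qad j (qad i f).
Proof. by apply: sp_ext => g; rewrite -!sp_qnM mulrCA. Qed.

Lemma pad_qad k n f : (0 < k)%N -> pad k (qad n f) = qad n (pad k f).
Proof.
by case: k => // k _; apply: sp_ext => g; rewrite -sp_pwM -!sp_qnM -sp_pwM mulrCA.
Qed.

Lemma padC k l f : (0 < k)%N -> (0 < l)%N ->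
  pad k (pad l f) = pad l (pad k f).
Proof.
case: k l => // k [//|l] _ _.
by apply: sp_ext => g; rewrite -!sp_pwM mulrCA.
Qed.

(** The generating series of the [q_n] is inverse to its image under the
    sign change of the variable, all the power sums in it being odd. *)
Lemma qn_alt n :
  \sum_(j < n.+1) (-1) ^+ j *: (qn X (n - j)%N * qn X j) = (n == 0%N)%:R.
Proof.
case: n => [|n]; first by rewrite big_ord1 expr0 scale1r qn0 mul1r.
have R0 := newton_product (p := pw X) (h := qn X)
  (e := fun i => (-1) ^+ i *: qn X i) (c := fun i => (~~ odd i)%:R * 2)
  (d := fun i => - ((~~ odd i)%:R * 2)) _ _ n.
apply: (scalerI (a := n.+1%:R)); first by rewrite pnatr_eq0.
rewrite scaler0; under eq_bigr do rewrite scalerAr.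
rewrite {}R0 => [|k|k].
- by rewrite big1 // => i _; rewrite subrr scale0r.
- rewrite qn_rec big_mkcond /=; apply: eq_bigr => i _.
  by case: odd; rewrite ?mul0r ?scale0r ?mul1r.
- rewrite scalerA mulrC -scalerA qn_rec scaler_sumr big_mkcond /=.
  apply: eq_bigr => i _; case: (boolP (odd i)) => odd_i /=.
    by rewrite mul0r oppr0 scale0r.
  rewrite mul1r -scalerAr !scalerA; congr (_ *: _).
  have le_ik : (i <= k)%N by rewrite -ltnS.
  rewrite -signr_odd -[in RHS]signr_odd oddB // (negPf odd_i) addbF /=.
  by rewrite signrN mulNr mulrC mulNr.
Qed.

Lemma qz_alt z N : (`|z| < N)%N ->
  \sum_(i < N) (-1) ^+ i *: (qz (z - i%:Z) * qz i%:Z) = (z == 0)%:R.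
Proof.
case: z => [n|n] lt_zN; last first.
  by rewrite big1 // => i _; rewrite qz_neg ?mul0r ?scaler0 //; lia.
rewrite -[RHS](qn_alt n) (big_ord_widen N (fun j => (-1) ^+ j *: (qn X (n - j) * qn X j))) //.
rewrite [RHS]big_mkcond /=; apply: eq_bigr => i _; rewrite ltnS.
case: leqP => [le_in|lt_ni]; first by rewrite subzn.
by rewrite qz_neg ?mul0r ?scaler0 //; lia.
Qed.

Lemma qad_alt n f :
  \sum_(j < n.+1) (-1) ^+ j *: qad (n - j)%N (qad j f) = (n == 0%N)%:R *: f.
Proof.
apply: sp_ext => g; rewrite sp_sumr.
under eq_bigr do rewrite spZr -!sp_qnM -spZl mulrA [qn _ _ * qn _ _]mulrC scalerAl.
rewrite -sp_suml -mulr_suml qn_alt.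
by case: (n == _); rewrite ?mul1r ?scale1r // mul0r scale0r sp0l sp0r.
Qed.

(** The coefficients of (1 + t) / (1 - t), the factor by which the series of
    the [qad n] acts on the series of the [qn]. *)
Definition qcoef (n : nat) : rat := if n is 0 then 1 else 2.

Lemma qcoef_rec n N : (n <= N)%N ->
  \sum_(i < N | ~~ odd i && (i < n)%N) 2 * qcoef (n - i.+1) = n%:R * qcoef n.
Proof.
move=> le_nN; rewrite -(big_ord_widen_cond N (fun i => ~~ odd i)
  (fun i => 2 * qcoef (n - i.+1)) le_nN) /=.
elim/ltn_ind: n {N le_nN} => -[_|[_|n IHn]].
- by rewrite big_ord0 mul0r.
- by rewrite big_mkcond big_ord_recl big_ord0 /= addr0 mulr1.
rewrite big_mkcond big_ord_recl big_ord_recl /=.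
rewrite /bump /= add0r.
have -> : \sum_(i < n) (if ~~ odd (1 + (1 + i)) then 2 * qcoef (n.+2 - (1 + (1 + i)).+1) else 0)
   = n%:R * qcoef n.
  rewrite -IHn // [RHS]big_mkcond; apply: eq_bigr => i _.
  by rewrite /= negbK !add1n !subSS.
case: n {IHn} => [|n] /=; rewrite ?mul0r ?addr0 -?natr1; ring.
Qed.

Lemma qad_qz n z : qad n (qz z) = qcoef n *: qz (z - n%:Z).
Proof.
elim/qz_ind: z n => [z z_lt0||z z_gt0 IHz] n.
- by rewrite !qz_neg ?qad0 ?scaler0 //; lia.
- rewrite qz0 qad1; case: n => [|n]; first by rewrite qz0 scale1r.
  by rewrite qz_neg ?scaler0 //; lia.
apply: (scalerI (intr_neq0 z_gt0)).
pose N := (`|z| + n)%N.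
rewrite -qadZ (qz_rec (N := N)) ?qad_sum; last by rewrite /N; lia.
under eq_bigr => i _.
  rewrite qadZ qad_pwM IHz; last by lia.
  rewrite scalerDr -scalerAr scalerA mulrC -scalerA.
  over.
rewrite big_split /= -scaler_sumr.
have -> : \sum_(i < N | ~~ odd i)
    2 *: (pw X i.+1 * qz (z - i.+1%:Z - n%:Z)) =
  (z - n%:Z)%:~R *: qz (z - n%:Z).
  rewrite (qz_rec (N := N)); last by rewrite /N; lia.
  by apply: eq_bigr => i _; rewrite addrAC.
have -> : \sum_(i < N | ~~ odd i) 2 *: (if ~~ odd i && (i < n)%N
    then qad (n - i.+1) (qz (z - i.+1%:Z)) else 0) =
  (n%:R * qcoef n) *: qz (z - n%:Z).
  rewrite -(qcoef_rec (N := N)); last by rewrite /N; lia.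
  rewrite scaler_suml [RHS]big_mkcondr; apply: eq_bigr => i odd_i.
  rewrite odd_i /=; case: ltnP => lt_in; last by rewrite scaler0.
  rewrite IHz; last by lia.
  by rewrite scalerA; congr (_ *: qz _); lia.
rewrite !scalerA -scalerDl -[n%:R]/(n%:~R); congr (_ *: _).
by rewrite mulrC -mulrDl -rmorphD /=; congr (_%:~R * _); lia.
Qed.

End Fock.

(** * Vertex operators *)

Definition isg (a : int) : rat := (-1) ^+ odd `|a|%N.

Lemma isgD a b : isg (a + b) = isg a * isg b.
Proof. by rewrite /isg -signr_addb; congr (_ ^+ _); lia. Qed.

Lemma isg0 : isg 0 = 1. Proof. by []. Qed.

Lemma isgN a : isg (- a) = isg a.
Proof. by rewrite /isg abszN. Qed.

Lemma isg_nat (n : nat) : isg n%:Z = (-1) ^+ n.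
Proof. by rewrite /isg signr_odd. Qed.

Lemma isgK a : isg a * isg a = 1.
Proof. by rewrite /isg -expr2 sqrr_sign. Qed.

Lemma isgB a b : isg (a - b) = isg a * isg b.
Proof. by rewrite isgD isgN. Qed.

Section Sums.
Variable V : nmodType.

Lemma sum_shift (g : int -> V) (N A M : nat) :
  (forall z, ~~ (0 <= z < N%:Z) -> g z = 0) -> (A + N <= M)%N ->
  \sum_(u < M) g (u%:Z - A%:Z) = \sum_(u < N) g u%:Z.
Proof.
move=> g0 le_M; have -> : M = (A + (N + (M - A - N)))%N by lia.
rewrite !big_split_ord /= [X in X + _]big1 ?add0r; last first.
  by move=> i _; rewrite g0 //; have := ltn_ord i; lia.
rewrite [X in _ + X]big1 ?addr0; last first.
  by move=> i _; rewrite g0 //; have := ltn_ord i; lia.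
by apply: eq_bigr => i _; congr g; lia.
Qed.

Lemma sum_cut (F : nat -> V) (K M : nat) :
  (forall i, (K <= i)%N -> F i = 0) -> (K <= M)%N ->
  \sum_(i < M) F i = \sum_(i < K) F i.
Proof.
move=> F0 le_KM; rewrite -(subnKC le_KM) big_split_ord /=.
by rewrite [X in _ + X]big1 ?addr0 // => i _; rewrite F0 ?leq_addr.
Qed.

Lemma sum_triangle (F : nat -> nat -> V) (K L M : nat) :
  (forall l i, (L <= l)%N || (K <= i)%N -> F l i = 0) -> (K + L <= M)%N ->
  \sum_(n < M) \sum_(l < n.+1) F l (n - l)%N = \sum_(i < K) \sum_(l < L) F l i.
Proof.
move=> F0 le_M.
pose G n l := if (l <= n)%N then F l (n - l)%N else 0.
have E (n : 'I_M) : \sum_(l < n.+1) F l (n - l)%N = \sum_(l < L) G n l.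
  have -> : \sum_(l < n.+1) F l (n - l)%N = \sum_(l < n.+1) G n l.
    by apply: eq_bigr => l _; rewrite /G -ltnS ltn_ord.
  rewrite -(@sum_cut _ n.+1 (n.+1 + L)) ?leq_addr //.
    rewrite -(@sum_cut _ L (n.+1 + L)) ?leq_addl // => l le_Ll.
    by rewrite /G; case: ifP => // _; rewrite F0 ?le_Ll.
  by move=> l lt_nl; rewrite /G leqNgt lt_nl.
under eq_bigr do rewrite E; rewrite exchange_big [RHS]exchange_big /=.
apply: eq_bigr => l _; have lt_lL := ltn_ord l.
have -> : M = (l + (M - l))%N by lia.
rewrite big_split_ord /= [X in X + _]big1 ?add0r; last first.
  by move=> i _; rewrite /G leqNgt ltn_ord.
rewrite (sum_cut (K := K) (F := fun i => G (l + i)%N l)).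
- by apply: eq_bigr => i _; rewrite /G leq_addr addKn.
- by move=> i le_Ki; rewrite /G; case: ifP => // _; rewrite addKn F0 // le_Ki orbT.
- by lia.
Qed.

End Sums.

(** The operator B_a, for every integer [a]. *)
HB.lock Definition vop (X : fock) (a : int) (f : X) : X :=
  \sum_(i < qad_deg f) (-1) ^+ i *: (qz X (a + i%:Z) * qad i f).

Section VertexOperators.
Variable X : fock.
Implicit Types (f g h : X) (c : rat).

Lemma vopEw K a f : (qad_deg f <= K)%N ->
  vop a f = \sum_(i < K) (-1) ^+ i *: (qz X (a + i%:Z) * qad i f).
Proof.
move=> le_K; rewrite vop.unlock.
rewrite [RHS](sum_cut (K := qad_deg f)
  (F := fun i => (-1) ^+ i *: (qz X (a + i%:Z) * qad i f))) // => i le_i.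
by rewrite qad_nil // mulr0 scaler0.
Qed.

Fact vop_is_linear a : linear (@vop X a).
Proof.
move=> c f g; pose K := maxn (qad_deg (c *: f + g)) (maxn (qad_deg f) (qad_deg g)).
rewrite !(vopEw (K := K)) ?leq_max ?leqnn ?orbT //.
rewrite scaler_sumr -big_split /=; apply: eq_bigr => i _.
by rewrite qadD qadZ mulrDr scalerDr -scalerAr !scalerA [c * _]mulrC.
Qed.

HB.instance Definition _ a :=
  GRing.isLinear.Build rat X X _ (@vop X a) (vop_is_linear a).

Lemma vopD a f g : vop a (f + g) = vop a f + vop a g.
Proof. exact: raddfD. Qed.
Lemma vopN a f : vop a (- f) = - vop a f.
Proof. exact: raddfN. Qed.
Lemma vopB a f g : vop a (f - g) = vop a f - vop a g.
Proof. exact: raddfB. Qed.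
Lemma vopZ a c f : vop a (c *: f) = c *: vop a f.
Proof. exact: linearZ. Qed.
Lemma vop0 a : vop a (0 : X) = 0.
Proof. exact: raddf0. Qed.
Lemma vop_sum a (I : Type) (r : seq I) (Pr : pred I) (F : I -> X) :
  vop a (\sum_(i <- r | Pr i) F i) = \sum_(i <- r | Pr i) vop a (F i).
Proof. exact: raddf_sum. Qed.

Lemma pad_vop k a f : odd k ->
  pad k (vop a f) = vop a (pad k f) + vop (a - k%:Z) f.
Proof.
move=> odd_k; have k_gt0 : (0 < k)%N by case: k odd_k.
pose K := maxn (qad_deg f) (qad_deg (pad k f)).
rewrite !(vopEw (K := K)) ?leq_max ?leqnn ?orbT //.
rewrite pad_sum -big_split /=; apply: eq_bigr => i _.
rewrite padZ padM // pad_qz // odd_k pad_qad // scalerDr addrC.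
by congr (_ *: (qz X _ * _) + _); lia.
Qed.

Lemma vop_vac_neg a : a < 0 -> vop a (1 : X) = 0.
Proof.
move=> a_lt0; rewrite vop.unlock big1 // => i _; rewrite qad1.
case: eqP => [->|_]; last by rewrite mulr0 scaler0.
by rewrite qz_neg ?mul0r ?scaler0 //; lia.
Qed.

Lemma vop_vac0 : vop 0 (1 : X) = 1.
Proof.
rewrite (vopEw (K := (qad_deg (1 : X)).+1)) // big_ord_recl big1 => [|i _].
  by rewrite addr0 expr0 scale1r addr0 qz0 qad1 mulr1.
by rewrite qad1 mulr0 scaler0.
Qed.

Lemma sp1_qnM n f : sp 1 (qn X n * f) = (n == 0%N)%:R * sp 1 f.
Proof.
rewrite -sp_qadl qad1; case: (n == 0%N); first by rewrite mul1r.
by rewrite sp0l mul0r.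
Qed.

Lemma sp1_vop_pos a f : 0 < a -> sp 1 (vop a f) = 0.
Proof.
move=> a_gt0; rewrite vop.unlock sp_sumr big1 // => i _; rewrite spZr.
case: a a_gt0 => // -[//|n] _; rewrite -[qz X _]/(qn X (n.+1 + i)).
by rewrite sp1_qnM mul0r mulr0.
Qed.

Lemma sp1_vop0 f : sp 1 (vop 0 f) = sp 1 f.
Proof.
rewrite (vopEw (K := (qad_deg f).+1)) // sp_sumr big_ord_recl big1 => [|i _].
  by rewrite addr0 spZr expr0 mul1r sp1_qnM qad_id mul1r.
by rewrite spZr -[qz X _]/(qn X i.+1) sp1_qnM mul0r mulr0.
Qed.

(** The summands of the two sides correspond to one another, because [qn] and
    [qad] are adjoint. *)
Lemma sp_vop a f g : sp (vop a f) g = isg a * sp f (vop (- a) g).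
Proof.
wlog: a f g / 0 <= a => [IH|].
  case: (leP 0 a) => [|a_lt0]; first exact: IH.
  rewrite [in RHS]spC [in RHS]IH ?opprK ?oppr_ge0 ?(ltW a_lt0) //.
  by rewrite isgN mulrA isgK mul1r spC.
case: a => // n _; pose K := maxn (qad_deg f) (qad_deg g).
rewrite (vopEw (K := K)) ?leq_maxl // sp_suml.
rewrite (vopEw (K := n + K)); last by rewrite /K; lia.
rewrite sp_sumr mulr_sumr big_split_ord /= [X in _ = X + _]big1 ?add0r.
  apply: eq_bigr => i _.
  have -> : - n%:Z + (n + i)%N%:Z = i%:Z by lia.
  rewrite spZl spZr mulrA isg_nat exprD mulrA -expr2 sqrr_sign mul1r.
  by rewrite -[qz X i]/(qn X i) -sp_qadl -[LHS]/(_ * sp (qn X _ * _) _) sp_qnM.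
move=> i _; rewrite qz_neg ?mul0r ?scaler0 ?sp0r ?mulr0 //.
by have := ltn_ord i; lia.
Qed.

(** The coefficient of t^x u^y in the product of the generating series of the
    [qn] in t, of the one in u, and of (1 - u / t) / (1 + u / t), the last
    being expanded up to order [L]. *)
Definition vpair (L : nat) (x y : int) : X :=
  \sum_(l < L) ((-1) ^+ l * qcoef l) *: (qz X (x + l%:Z) * qz X (y - l%:Z)).

(** Moving the [qad n] to the right of [qz y] multiplies the generating series
    by (1 - u / t) / (1 + u / t). *)
Lemma vop_qzM K L a y g :
    (forall i, (K <= i)%N -> qad i g = 0) -> y < L%:Z ->
  vop a (qz X y * g) = \sum_(i < K) (-1) ^+ i *: (vpair L (a + i%:Z) y * qad i g).
Proof.
move=> g0 lt_yL; pose M := maxn (qad_deg (qz X y * g)) (K + L).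
rewrite (vopEw (K := M)) ?leq_maxl //.
pose F l i := ((-1) ^+ i * ((-1) ^+ l * qcoef l)) *:
  (qz X (a + i%:Z + l%:Z) * qz X (y - l%:Z) * qad i g).
rewrite (eq_bigr (fun n : 'I_M => \sum_(l < n.+1) F l (n - l)%N)); last first.
  move=> n _; rewrite qadM mulr_sumr scaler_sumr; apply: eq_bigr => l _.
  have le_ln : (l <= n)%N by rewrite -ltnS.
  rewrite qad_qz -scalerAl -!scalerAr scalerA mulrA /F mulrA -exprD subnK //.
  by congr (_ *: (qz X _ * _ * _)); lia.
rewrite (sum_triangle (K := K) (L := L)) ?leq_maxr //.
  apply: eq_bigr => i _; rewrite mulr_suml scaler_sumr; apply: eq_bigr => l _.
  by rewrite -scalerAl scalerA.
move=> l i; rewrite /F => /orP[le_Ll|/g0 ->]; last by rewrite mulr0 scaler0.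
by rewrite [qz X (y - _)]qz_neg ?mulr0 ?mul0r ?scaler0 //; lia.
Qed.

(** The expansion of (1 - u / t) / (1 + u / t) in u / t and that of
    (1 - t / u) / (1 + t / u) in t / u add up to a delta series, which reduces
    the product of the two generating series to the alternating sum
    [qz_alt]. *)
Lemma vpairC L x y : (2 * (`|x| + `|y|) < L)%N ->
  vpair L x y + vpair L y x = (2 * isg x * (x + y == 0)%:R)%:A.
Proof.
case: L => // L lt_L.
pose G (l : int) : X := isg l *: (qz X (x + l) * qz X (y - l)).
have E1 : vpair L.+1 x y = G 0 + \sum_(l < L) 2 *: G l.+1%:Z.
  rewrite /vpair big_ord_recl; congr (_ + _).
  by apply: eq_bigr => i _; rewrite /G scalerA isg_nat mulrC.
have E2 : vpair L.+1 y x = G 0 + \sum_(l < L) 2 *: G (- l.+1%:Z).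
  rewrite /vpair big_ord_recl; congr (_ + _).
    by rewrite /G isg0 /= mulr1 expr0 ?subr0 ?addr0 mulrC.
  apply: eq_bigr => i _; rewrite /G scalerA isgN isg_nat mulrC opprK.
  by rewrite [qz X _ * _]mulrC.
rewrite {}E1 {}E2 addrACA -!scaler_sumr.
have dbl (u v w : X) : u + u + (2 *: v + 2 *: w) = 2 *: (u + (v + w)).
  by rewrite !scalerDr [2 *: u]scaler_nat mulr2n.
rewrite dbl.
have -> : G 0 + (\sum_(i < L) G i.+1%:Z + \sum_(i < L) G (- i.+1%:Z)) =
          \sum_(u < L + L.+1) G (u%:Z - L%:Z).
  rewrite big_split_ord addrA addrC; congr (_ + _).
    rewrite (reindex_inj rev_ord_inj) /=; apply: eq_bigr => i _.
    by congr G; have := ltn_ord i; lia.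
  rewrite big_ord_recl; congr (G _ + _); first by rewrite /=; lia.
  by apply: eq_bigr => i _; congr G; rewrite /= /bump; lia.
pose g z : X := isg (z - x) *: (qz X (x + y - z) * qz X z).
rewrite (eq_bigr (fun u : 'I_(L + L.+1) => g (u%:Z - (L%:Z - x)))); last first.
  move=> u _; rewrite /G /g [qz X _ * _]mulrC.
  by congr (isg _ *: (qz X _ * qz X _)); lia.
pose N := `|x + y|.+1.
have [A AE] : exists A : nat, L%:Z - x = A%:Z.
  by exists `|L%:Z - x|%N; lia.
rewrite AE (sum_shift (N := N)); last 2 first.
- move=> z; rewrite negb_and => /orP[z_lt0|z_gt].
    by rewrite /g [qz X z]qz_neg ?mulr0 ?scaler0 // ltNge.
  rewrite /g [qz X (_ - z)]qz_neg ?mul0r ?scaler0 //.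
  by move: z_gt; rewrite /N; lia.
- by rewrite /N; lia.
rewrite /g; under eq_bigr do rewrite isgB isg_nat mulrC -scalerA.
rewrite -scaler_sumr qz_alt ?ltnS // !scalerA.
by case: (_ == 0); rewrite ?mulr1 ?mulr0 ?scale0r ?scaler0.
Qed.

(** The Clifford relations.  By [vpairC] the symmetrised products of the
    series of the [qn] are scalars; there remain the sums
    [qad_alt], of which only the first is nonzero. *)
Lemma vop_anticomm a b f :
  vop a (vop b f) + vop b (vop a f) = (2 * isg a * (a + b == 0)%:R) *: f.
Proof.
pose K := qad_deg f; pose L := (2 * (`|a| + `|b| + 2 * K)).+1.
have H x y : (`|x| + `|y| <= `|a| + `|b|)%N ->
    vop x (vop y f) = \sum_(i < K) \sum_(j < K)
      ((-1) ^+ i * (-1) ^+ j) *: (vpair L (x + i%:Z) (y + j%:Z) * qad i (qad j f)).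
  move=> le_xy; rewrite (vopEw (K := K) y) // vop_sum exchange_big.
  apply: eq_bigr => j _; rewrite vopZ (vop_qzM (K := K) (L := L)); last 2 first.
  - by move=> i le_Ki; rewrite qadC [qad i f]qad_nil ?qad0.
  - by rewrite /L; have := ltn_ord j; lia.
  rewrite scaler_sumr; apply: eq_bigr => i _.
  by rewrite scalerA [_ * (-1) ^+ j]mulrC.
rewrite !H // 1?addnC // [X in _ + X]exchange_big -big_split /=.
pose F l i : X :=
  ((-1) ^+ l * (a + b + (l + i)%N%:Z == 0)%:R) *: qad i (qad l f).
transitivity ((2 * isg a) *: \sum_(i < K) \sum_(l < K) F l i).
  rewrite scaler_sumr; apply: eq_bigr => i _.
  rewrite -big_split scaler_sumr; apply: eq_bigr => j _ /=.
  rewrite [qad j (qad i f)]qadC [_ ^+ j * _]mulrC -scalerDr -mulrDl vpairC.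
    rewrite -scalerAl mul1r /F !scalerA; congr (_ *: _).
    have -> : a + i%:Z + (b + j%:Z) = a + b + (j + i)%N%:Z by lia.
    by rewrite isgD isg_nat -[(-1) ^+ i]signr_odd; case: (odd i); rewrite ?expr1 ?expr0; ring.
  by rewrite /L; have := ltn_ord i; have := ltn_ord j; lia.
rewrite -(sum_triangle (M := (K + K).+1)) ?leqnSn //; last first.
  by move=> l i /orP[le_K|le_K]; rewrite /F; [|rewrite qadC]; rewrite [qad _ f]qad_nil ?qad0 ?scaler0.
rewrite -[RHS]scalerA; congr (_ *: _).
transitivity (\sum_(n < (K + K).+1)
    ((a + b + n%:Z == 0)%:R * (n == 0 :> nat)%:R) *: f).
  apply: eq_bigr => n _; rewrite -scalerA -qad_alt scaler_sumr.
  apply: eq_bigr => l _; rewrite /F scalerA mulrC subnKC //.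
  by rewrite -ltnS.
rewrite big_ord_recl big1 => [|i _]; last by rewrite mulr0 scale0r.
by rewrite addr0 mulr1 addr0.
Qed.

End VertexOperators.

(** * Words in the vertex operators *)

Section Words.
Variable X : fock.
Implicit Types (f g h : X) (c : rat) (a b : int) (s t : seq int).

Definition vops s f : X := foldr (@vop X) f s.
Definition vword s : X := vops s 1.

Lemma vops_cat s t f : vops (s ++ t) f = vops s (vops t f).
Proof. exact: foldr_cat. Qed.

Lemma vword_cons a s : vword (a :: s) = vop a (vword s).
Proof. by []. Qed.

Lemma vword_cat s t : vword (s ++ t) = vops s (vword t).
Proof. exact: vops_cat. Qed.

Fact vops_is_linear s : linear (vops s).
Proof. by move=> c f g; elim: s => //= a s ->; rewrite vopD vopZ. Qed.

HB.instance Definition _ s :=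
  GRing.isLinear.Build rat X X _ (vops s) (vops_is_linear s).

Lemma vopsD s f g : vops s (f + g) = vops s f + vops s g.
Proof. exact: raddfD. Qed.
Lemma vopsN s f : vops s (- f) = - vops s f.
Proof. exact: raddfN. Qed.
Lemma vopsZ s c f : vops s (c *: f) = c *: vops s f.
Proof. exact: linearZ. Qed.
Lemma vops0 s : vops s (0 : X) = 0.
Proof. exact: raddf0. Qed.

Lemma vop_swap a b f : a + b != 0 -> vop a (vop b f) = - vop b (vop a f).
Proof.
move=> /negPf ab; apply/eqP; rewrite -addr_eq0 vop_anticomm ab.
by rewrite mulr0 scale0r.
Qed.

Lemma vop_square a f : a != 0 -> vop a (vop a f) = 0.
Proof.
move=> a0; have := vop_anticomm a a f.
have /negPf -> : a + a != 0 by lia.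
by rewrite mulr0 scale0r -mulr2n -scaler_nat => /eqP; rewrite scaler_eq0 => /eqP.
Qed.

(** A negative letter can be cancelled only by its opposite, and otherwise
    moves to the right until it meets the vacuum. *)
Lemma vop_vword_neg a s : a < 0 -> - a \notin s -> vop a (vword s) = 0.
Proof.
move=> a_lt0; elim: s => [|b s IHs] /=; first by rewrite vop_vac_neg.
rewrite in_cons negb_or => /andP[ab s_a].
by rewrite vop_swap ?IHs ?vop0 ?oppr0 //; apply: contraNneq ab => /eqP; lia.
Qed.

(** Only words whose letters cancel in opposite pairs have a constant term, so
    an odd function of the letters must sum to zero along them. *)
Lemma sp1_vword_charge (ch : int -> int) s : (forall a, ch (- a) = - ch a) ->
  \sum_(a <- s) ch a != 0 -> sp 1 (vword s) = 0.
Proof.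
move=> chN; have ch0 : ch 0 = 0 by have := chN 0; rewrite oppr0; move: (ch 0) => x; clear; lia.
have [n] := ubnP (size s); elim: n s => [|n IHn] // s le_sn s0.
case: s => [|a s] in le_sn s0 *; first by rewrite big_nil in s0.
case: (ltgtP a 0) => [a_lt0|a_gt0|a0]; first 1 last.
- by rewrite /= sp1_vop_pos.
- rewrite vword_cons a0 sp1_vop0; apply: IHn => //.
  by move: s0; rewrite big_cons a0 ch0 add0r.
have : (size ([::] ++ s) < n)%N && (\sum_(b <- [::] ++ s) ch b != - ch a).
  apply/andP; split; first exact: le_sn.
  by apply: contraNneq s0; rewrite big_cons => ->; rewrite subrr.
rewrite -[a :: s]/([::] ++ a :: s); elim: s [::] {le_sn s0} => [|b s IHs] t /andP[lt_n neq].
  by rewrite vword_cat [vword [:: a]]vop_vac_neg // vops0 sp0r.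
rewrite vword_cat !vword_cons.
have -> : vop a (vop b (vword s)) =
    (2 * isg a * (a + b == 0)%:R) *: vword s - vword (b :: a :: s).
  by rewrite -vop_anticomm addrK.
rewrite vopsD vopsN vopsZ -!vword_cat spBr spZr -cat_rcons.
rewrite IHs ?subr0 ?cat_rcons ?lt_n //.
have [ab0|_] := eqVneq (a + b) 0; last by rewrite mulr0 mul0r.
rewrite IHn ?mulr0 //; first by move: lt_n; rewrite !size_cat /=; clear; lia.
apply: contraNneq neq; have -> : b = - a by move: ab0; clear; lia.
rewrite !big_cat big_cons chN /=.
move: (\sum_(_ <- t) _) (\sum_(_ <- s) _) (ch a) => u v w; clear; lia.
Qed.

Lemma sp1_vword s : \sum_(a <- s) a != 0 -> sp 1 (vword s) = 0.
Proof. exact: (sp1_vword_charge (ch := id)). Qed.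

(** The terms of the Leibniz rule for [pad k] on a word. *)
Fixpoint lower (k : nat) s : seq (seq int) :=
  if s is a :: s' then ((a - k%:Z) :: s') :: [seq a :: t | t <- lower k s']
  else [::].

Lemma pad_vword k s : odd k ->
  pad k (vword s) = \sum_(t <- lower k s) vword t.
Proof.
move=> odd_k; elim: s => [|a s IHs]; first by rewrite big_nil [LHS]pad1.
rewrite big_cons big_map vword_cons pad_vop // IHs.
by rewrite vop_sum addrC.
Qed.

Lemma sum_lower k s t : t \in lower k s ->
  \sum_(a <- t) a = \sum_(a <- s) a - k%:Z.
Proof.
elim: s t => [|a s IHs] t //=; rewrite in_cons => /predU1P[->|/mapP[u us ->]].
  by rewrite !big_cons addrAC.
by rewrite !big_cons IHs // addrA.
Qed.

Definition padl (mu : seq nat) f : X := foldr (@pad X) f mu.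

Fixpoint lowers (mu : seq nat) s : seq (seq int) :=
  if mu is k :: mu' then flatten [seq lower k t | t <- lowers mu' s]
  else [:: s].

Lemma padl_vword mu s : all odd mu ->
  padl mu (vword s) = \sum_(t <- lowers mu s) vword t.
Proof.
elim: mu => [|k mu IHmu] /=; first by rewrite big_seq1.
move=> /andP[odd_k odd_mu]; rewrite IHmu // pad_sum big_flatten big_map.
by apply: eq_bigr => t _; rewrite pad_vword.
Qed.

Lemma sum_lowers mu s t : t \in lowers mu s ->
  \sum_(a <- t) a = \sum_(a <- s) a - (sumn mu)%:Z.
Proof.
elim: mu t => [|k mu IHmu] t /=; first by rewrite inE subr0 => /eqP ->.
case/flattenP=> _ /mapP[u /IHmu us ->] /sum_lower ->; rewrite us.
by rewrite PoszD opprD addrA [RHS]addrAC.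
Qed.

Lemma sp1_padl_vword mu s : all odd mu ->
  \sum_(a <- s) a != (sumn mu)%:Z -> sp 1 (padl mu (vword s)) = 0.
Proof.
move=> odd_mu neq; rewrite padl_vword // sp_sumr big1_seq // => t /= ts.
by rewrite sp1_vword // (sum_lowers ts) subr_eq0.
Qed.

(** ** Orthogonality *)

Lemma gtn_trans : transitive gtn.
Proof. by move=> x y z /= xy yz; apply: ltn_trans xy. Qed.

Lemma strict_tl (a : nat) (l : seq nat) :
  sorted gtn (a :: l) -> all (fun b : nat => (b < a)%N) l /\ sorted gtn l.
Proof.
rewrite /= path_sortedE; last exact: gtn_trans.
by case/andP.
Qed.

(** The larger of the two leading letters is moved to the other side, where its
    opposite finds no letter to cancel with. *)
Lemma sp_vword_strict (l l' : seq nat) : sorted gtn l -> 0%N \notin l ->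
  sorted gtn l' -> 0%N \notin l' ->
  sp (vword (map Posz l)) (vword (map Posz l')) = (l == l')%:R * 2 ^+ size l.
Proof.
elim: l l' => [|a l IHl] [|b l'].
- by rewrite sp11 mul1r.
- move=> _ _ _; rewrite in_cons negb_or => /andP[b0 _].
  by rewrite /= sp1_vop_pos ?mul0r //; lia.
- move=> _; rewrite in_cons negb_or => /andP[a0 _] _ _.
  by rewrite spC /= sp1_vop_pos ?mul0r //; lia.
move=> /strict_tl[al sl]; rewrite in_cons negb_or => /andP[a0 l0].
move=> /strict_tl[bl' sl']; rewrite in_cons negb_or => /andP[b0 l0'].
have notin (c : nat) (u : seq nat) : (0 < c)%N -> all (fun b : nat => (b < c)%N) u ->
    vop (- c%:Z) (vword (map Posz u)) = 0.
  move=> c_gt0 /allP cu; apply: vop_vword_neg; first by lia.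
  rewrite opprK; apply/negP => /mapP[d /cu lt_dc [cE]].
  by rewrite cE ltnn in lt_dc.
case: (ltngtP a b) => [lt_ab|lt_ba|eq_ab].
- rewrite spC /= sp_vop (notin b (a :: l)) ?sp0r ?mulr0; last 2 first.
  + by rewrite lt0n eq_sym.
  + by rewrite /= lt_ab; apply: sub_all al => c /= lt_ca; apply: ltn_trans lt_ab.
  by case: eqP => [[ab]|]; rewrite ?mul0r //; rewrite ab ltnn in lt_ab.
- rewrite /= sp_vop (notin a (b :: l')) ?sp0r ?mulr0; last 2 first.
  + by rewrite lt0n eq_sym.
  + by rewrite /= lt_ba; apply: sub_all bl' => c /= lt_cb; apply: ltn_trans lt_ba.
  by case: eqP => [[ab]|]; rewrite ?mul0r //; rewrite ab ltnn in lt_ba.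
rewrite -eq_ab in bl' *; rewrite eqseq_cons eqxx /= sp_vop.
have -> : vop (- a%:Z) (vop a%:Z (vword (map Posz l'))) =
    (2 * isg a%:Z) *: vword (map Posz l').
  have := vop_anticomm (- a%:Z) a%:Z (vword (map Posz l')).
  rewrite (notin a l') ?lt0n 1?eq_sym // vop0 addr0 addNr eqxx mulr1 isgN.
  by [].
rewrite spZr IHl // exprS mulrA [isg _ * (_ * _)]mulrCA isgK mulr1.
by rewrite mulrCA.
Qed.

End Words.

(** * Residues modulo an odd integer *)

Section Residues.
Variable m : nat.
Hypothesis odd_m : odd m.

Let m_gt0 : (0 < m)%N. Proof. by case: m odd_m. Qed.
Let m_neq0 : m%:Z != 0. Proof. by rewrite eqz_nat -lt0n. Qed.

Definition cg (a b : int) : bool := (m%:Z %| a - b)%Z.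

Lemma cg_refl a : cg a a. Proof. by rewrite /cg subrr dvdz0. Qed.
Lemma cg_sym a b : cg a b = cg b a.
Proof. by rewrite /cg -opprB rpredN. Qed.
Lemma cg_trans b a c : cg a b -> cg b c -> cg a c.
Proof. by move=> ab bc; rewrite /cg -(subrK b a) -addrA rpredD. Qed.
Lemma cgN a b : cg (- a) (- b) = cg a b.
Proof. by rewrite /cg -opprD rpredN. Qed.
Lemma cg_eql a b c : cg a b -> cg a c = cg b c.
Proof.
by move=> ab; apply/idP/idP; apply: cg_trans => //; rewrite cg_sym.
Qed.
Lemma cg_eqr a b c : cg a b -> cg c a = cg c b.
Proof. by move=> ab; rewrite !(cg_sym c); apply: cg_eql. Qed.
Lemma cgD a b c d : cg a b -> cg c d -> cg (a + c) (b + d).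
Proof. by move=> ab cd; rewrite /cg opprD addrACA rpredD. Qed.
Lemma cgB a b c d : cg a b -> cg c d -> cg (a - c) (b - d).
Proof. by move=> ab cd; rewrite cgD // cgN. Qed.
Lemma cg0 a : cg a 0 = (m%:Z %| a)%Z. Proof. by rewrite /cg subr0. Qed.
Lemma cgDm a b : cg (a + m%:Z) b = cg a b.
Proof. by apply: cg_eql; rewrite /cg addrAC subrr add0r dvdzz. Qed.
Lemma cg_subl a b c : cg (a - b) c = cg a (c + b).
Proof. by rewrite /cg opprD addrA addrAC. Qed.
Lemma cg_small a b : (`|a - b| < m)%N -> cg a b -> a = b.
Proof.
rewrite /cg dvdzE /= => lt_m d; apply/eqP; rewrite -subr_eq0 -absz_eq0.
by case: posnP => // gt0; have := dvdn_leq gt0 d; rewrite leqNgt lt_m.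
Qed.

Lemma cg_double a : cg (a + a) 0 = cg a 0.
Proof.
rewrite !cg0 -mulr2n -mulr_natl Gauss_dvdzr //.
by rewrite coprimezE coprimen2.
Qed.

Lemma cg_opp a : cg a (- a) = cg a 0.
Proof. by rewrite -cg_double /cg subr0 opprK. Qed.

(** The sign (-1)^r, for [r] the representative of the residue in 1, .., m.
    With [0] represented by [m], the function changes sign at each step
    except from [0] to [1]. *)
Definition rsg (z : int) : rat := isg (((z - 1) %% m%:Z)%Z + 1).

Lemma rsg_cg a b : cg a b -> rsg a = rsg b.
Proof.
move=> ab; rewrite /rsg; congr (isg (_ + 1)); apply/eqP.
by rewrite eqz_mod_dvd; have -> : a - 1 - (b - 1) = a - b by lia.
Qed.

Lemma rsgK z : rsg z * rsg z = 1. Proof. exact: isgK. Qed.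

Lemma isg_m : isg m%:Z = - 1.
Proof. by rewrite /isg /= odd_m expr1. Qed.

Lemma rsg0 z : cg z 0 -> rsg z = - 1.
Proof.
move/rsg_cg ->; rewrite /rsg sub0r.
have -> : ((- 1) %% m%:Z)%Z = m%:Z - 1.
  have {1}-> : - 1 = (- 1) * m%:Z + (m%:Z - 1) by lia.
  by rewrite modzMDl modz_small //; lia.
by rewrite subrK isg_m.
Qed.

Lemma rsg_mod z : ~~ cg z 0 -> rsg z = isg (z %% m%:Z)%Z.
Proof.
rewrite cg0 => /dvdz_mod0P z0; rewrite /rsg; congr isg.
have lt := ltz_pmod z (d := m%:Z); have ge := modz_ge0 z m_neq0.
have -> : z - 1 = (z %/ m%:Z)%Z * m%:Z + ((z %% m%:Z)%Z - 1).
  by rewrite addrA -divz_eq.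
by rewrite modzMDl modz_small ?subrK //; lia.
Qed.

Lemma rsgS z : rsg (z + 1) = if cg z 0 then rsg z else - rsg z.
Proof.
case: ifP => z0.
  rewrite (rsg0 z0) (rsg_cg (b := 1)) ?/rsg ?subrr ?mod0z //.
  by rewrite -[1]add0r cgD // cg_refl.
rewrite (rsg_mod (negbT z0)) /rsg addrK isgD.
by rewrite mulrC mulN1r.
Qed.

Lemma rsgN z : ~~ cg z 0 -> rsg (- z) = - rsg z.
Proof.
move=> z0; rewrite !rsg_mod //; last by rewrite -[0]oppr0 cgN.
have -> : ((- z) %% m%:Z)%Z = m%:Z - (z %% m%:Z)%Z.
  have lt := ltz_pmod z (d := m%:Z); have ge := modz_ge0 z m_neq0.
  have {1}-> : - z = (- (z %/ m%:Z)%Z - 1) * m%:Z + (m%:Z - (z %% m%:Z)%Z).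
    by rewrite {1}(divz_eq z m%:Z); ring.
  rewrite modzMDl modz_small //; by move: z0; rewrite cg0 => /dvdz_mod0P; lia.
by rewrite isgB isg_m mulN1r.
Qed.

(** Twice this is the contraction of the sum of all letters of one class with
    the letters that a lowering by [k] makes negative. *)
Definition altsum (k : nat) (q : int) : rat :=
  \sum_(b <- iota 1 k | cg b%:Z q) isg b%:Z.

Lemma altsumS k q :
  altsum k.+1 q = altsum k q + (if cg k.+1%:Z q then isg k.+1%:Z else 0).
Proof.
have -> : altsum k.+1 q = \sum_(b <- iota 1 k ++ [:: k.+1] | cg b%:Z q) isg b%:Z.
  by rewrite /altsum -[k.+1]addn1 iotaD /= add1n addn1.
rewrite big_cat big_cons big_nil /=.
by case: ifP => _; rewrite ?addr0.
Qed.

(** Since [m] is odd, the terms of [altsum] alternate in sign, and the sum only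
    depends on the first term and on the parity of their number. *)
Lemma altsum_rec k q :
  2 * altsum k q + isg k%:Z * rsg (k.+1%:Z - q) = rsg (1 - q).
Proof.
elim: k => [|k IHk]; first by rewrite /altsum big_nil mulr0 add0r isg0 mul1r.
rewrite -{}IHk altsumS mulrDr.
have -> : k.+2%:Z - q = k.+1%:Z - q + 1 by lia.
have -> : isg k.+1%:Z = - isg k%:Z by rewrite -addn1 PoszD isgD mulrN1.
rewrite rsgS cg_subl add0r; case: ifP => kq; last by ring.
by rewrite rsg0 ?cg_subl ?add0r //; ring.
Qed.

(** A contraction turns the coefficient 1 of a term into a sign, with which the
    terms of the residues [q] and [k - q] cancel. *)
Lemma altsum_neq0 k q : odd k -> ~~ cg q 0 -> ~~ cg k%:Z q ->
  1 - rsg q * (2 * altsum k q) = rsg q * rsg (k%:Z - q).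
Proof.
move=> odd_k q0 kq; have := altsum_rec k q.
have -> : k.+1%:Z - q = k%:Z - q + 1 by lia.
have -> : 1 - q = - q + 1 by rewrite addrC.
rewrite !rsgS cg_subl add0r (negPf kq) -[0]oppr0 cgN (negPf q0) rsgN // opprK.
rewrite /isg /= odd_k expr1 => E.
have -> : 2 * altsum k q = rsg q - rsg (k%:Z - q) by rewrite -E; ring.
by rewrite mulrBr rsgK; ring.
Qed.

Lemma altsum_eq0 k : odd k -> ~~ cg k%:Z 0 ->
  rsg k%:Z * (1 + 2 * altsum k 0) = - 1.
Proof.
move=> odd_k k0; have := altsum_rec k 0; rewrite !subr0.
have -> : k.+1%:Z = k%:Z + 1 by lia.
rewrite rsgS (negPf k0) /isg /= odd_k expr1 => E.
have -> : 2 * altsum k 0 = rsg 1 - rsg k%:Z by rewrite -E; ring.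
have -> : rsg 1 = - 1 by rewrite /rsg subrr mod0z.
by rewrite addrA subrr add0r mulrN rsgK.
Qed.

(** ** The classes of residues up to sign *)

Definition mhalf := m.-1./2.

Lemma mhalfE : m = mhalf.*2.+1.
Proof. by rewrite /mhalf; move: odd_m; case: m => //= n; lia. Qed.

(** The number c from 0 to (m - 1) / 2 such that [z] is congruent to 2c or
    to -2c: the even representatives 2c of half of the residues are the
    opposites of the odd representatives of the other half. *)
Definition cl (z : int) : nat :=
  let r := `|(z %% m%:Z)%Z|%N in if odd r then (m - r)./2 else r./2.

Lemma cl_cg a b : cg a b -> cl a = cl b.
Proof.
by move=> ab; rewrite /cl; have /eqP -> : (a == b %[mod m%:Z])%Z by rewrite eqz_mod_dvd.
Qed.

Lemma clP z : cg z (2 * (cl z)%:Z) || cg z (- (2 * (cl z)%:Z)).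
Proof.
rewrite /cl; have lt := ltz_pmod z (d := m%:Z); have ge := modz_ge0 z m_neq0.
set r := `|_|%N; have rE : (z %% m%:Z)%Z = r%:Z by rewrite /r; lia.
have zr : cg z r%:Z by rewrite /cg -rE {1}(divz_eq z m%:Z) addrK dvdz_mull.
rewrite rE in lt ge; rewrite !(cg_eql _ zr); case: ifP => odd_r.
  apply/orP; right; have -> : - (2 * (m - r)./2%:Z) = r%:Z - m%:Z.
    by have := odd_m; move: lt; rewrite ltz_nat //; lia.
  by rewrite /cg opprB addrC subrK.
apply/orP; left; have -> : 2 * r./2%:Z = r%:Z by lia.
exact: cg_refl.
Qed.

Lemma cl_le z : (cl z <= mhalf)%N.
Proof.
rewrite /cl; have lt := ltz_pmod z (d := m%:Z); have ge := modz_ge0 z m_neq0.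
have := mhalfE; set r := `|_|%N; have rE : (r < m)%N by rewrite /r; lia.
by case: ifP => odd_r; lia.
Qed.

Lemma cg2_inj (c d : nat) : (c <= mhalf)%N -> (d <= mhalf)%N ->
  cg (2 * c%:Z) (2 * d%:Z) || cg (2 * c%:Z) (- (2 * d%:Z)) -> c = d.
Proof.
move=> le_c le_d; have mE := mhalfE; case/orP => H.
  suff : 2 * c%:Z = 2 * d%:Z by lia.
  by apply: cg_small H; lia.
suff : c%:Z = - d%:Z by lia.
apply: cg_small; first by lia.
have : cg ((c%:Z + d%:Z) + (c%:Z + d%:Z)) 0.
  by move: H; rewrite /cg; congr (_ %| _)%Z; lia.
by rewrite cg_double /cg opprK subr0.
Qed.

Lemma cl2 c : (c <= mhalf)%N -> cl (2 * c%:Z) = c.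
Proof. by move=> le_c; apply/esym/cg2_inj => //; [exact: cl_le | exact: clP]. Qed.

Lemma cl_unique z (c : nat) : (c <= mhalf)%N ->
  cg z (2 * c%:Z) || cg z (- (2 * c%:Z)) -> cl z = c.
Proof.
move=> le_c H; apply: cg2_inj => //; first exact: cl_le.
case/orP: (clP z) => H1; case/orP: H => H2; rewrite cg_sym in H1.
- by rewrite (cg_trans H1 H2).
- by rewrite (cg_trans H1 H2) orbT.
- by apply/orP; right; rewrite -cgN opprK; apply: cg_trans H1 H2.
- by apply/orP; left; rewrite -cgN; apply: cg_trans H1 H2.
Qed.

Lemma clN z : cl (- z) = cl z.
Proof.
apply: cl_unique (cl_le z) _; have := clP z.
by rewrite -[cg z _]cgN -[cg z (- _)]cgN opprK orbC.
Qed.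

Lemma cl_eq0 z : (cl z == 0%N) = cg z 0.
Proof.
apply/eqP/idP => [z0|z0]; first by have := clP z; rewrite z0 mulr0 oppr0 orbb.
by apply: cl_unique => //; rewrite mulr0 z0.
Qed.

Lemma cl_eq a b : (cl a == cl b) = cg a b || cg a (- b).
Proof.
apply/eqP/idP => [ab|/orP[/cl_cg //|/cl_cg ->]]; last by rewrite clN.
have := clP a; have := clP b; rewrite ab !(cg_sym b).
case/orP=> Hb /orP[Ha|Ha].
- by apply/orP; left; apply: cg_trans Ha Hb.
- by apply/orP; right; apply: cg_trans Ha _; rewrite cgN.
- by apply/orP; right; apply: cg_trans Ha _; rewrite -cgN opprK.
- by apply/orP; left; apply: cg_trans Ha Hb.
Qed.

Lemma cl_pos z : ~~ cg z 0 -> (0 < cl z)%N.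
Proof. by rewrite -cl_eq0 lt0n. Qed.

Lemma rsg2 (c : nat) : (0 < c <= mhalf)%N -> rsg (2 * c%:Z) = 1.
Proof.
move=> /andP[c_gt0 le_c]; have mE := mhalfE.
rewrite /rsg modz_small; last by lia.
by rewrite subrK /isg (_ : odd _ = false) //; lia.
Qed.

Lemma cg2_neq0 (c : nat) : (0 < c <= mhalf)%N -> ~~ cg (2 * c%:Z) 0.
Proof.
move=> /andP[c_gt0 le_c]; rewrite -cl_eq0 cl2 //; lia.
Qed.

End Residues.

(** * The operators on a window *)

HB.lock Definition win (N : nat) : seq int := [seq i%:Z - N%:Z | i <- iota 0 (2 * N).+1].

Lemma win_uniq N : uniq (win N).
Proof. by rewrite win.unlock map_inj_uniq ?iota_uniq // => i j; lia. Qed.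

Lemma mem_win N (a : int) : (a \in win N) = (`|a| <= N)%N.
Proof.
rewrite win.unlock; apply/mapP/idP => [[u]|le_aN]; first by rewrite mem_iota => /andP[_ lt_i] ->; lia.
by exists `|(a + N%:Z)%R|%N; [rewrite mem_iota; lia | lia].
Qed.

Lemma winN N (a : int) : (- a \in win N) = (a \in win N).
Proof. by rewrite !mem_win abszN. Qed.

Section Window.
Variables (X : fock) (m : nat).
Hypothesis odd_m : odd m.
Implicit Types (f g h : X) (c : rat) (a b j p q : int) (s : seq int) (cs : seq nat).

Notation cg := (cg m).

Definition csum s q f : X := \sum_(a <- s | cg a q) vop a f.

Fact csum_is_linear s q : linear (csum s q).
Proof.
move=> c f g; rewrite /csum scaler_sumr -big_split /=; apply: eq_bigr => a _.
by rewrite vopD vopZ.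
Qed.

HB.instance Definition _ s q :=
  GRing.isLinear.Build rat X X _ (csum s q) (csum_is_linear s q).

Lemma csumD s q f g : csum s q (f + g) = csum s q f + csum s q g.
Proof. exact: raddfD. Qed.
Lemma csumB s q f g : csum s q (f - g) = csum s q f - csum s q g.
Proof. exact: raddfB. Qed.
Lemma csumN s q f : csum s q (- f) = - csum s q f.
Proof. exact: raddfN. Qed.
Lemma csumZ s q c f : csum s q (c *: f) = c *: csum s q f.
Proof. exact: linearZ. Qed.
Lemma csum0 s q : csum s q (0 : X) = 0.
Proof. exact: raddf0. Qed.

Lemma csum_sum s q (I : Type) (r : seq I) (P : pred I) (F : I -> X) :
  csum s q (\sum_(i <- r | P i) F i) = \sum_(i <- r | P i) csum s q (F i).
Proof. exact: raddf_sum. Qed.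

Lemma csum_cg s q q' f : cg q q' -> csum s q f = csum s q' f.
Proof. by move=> qq'; apply: eq_bigl => a; apply: cg_eqr. Qed.

Definition contr s q b : rat :=
  if (- b \in s) && cg (- b) q then 2 * isg b else 0.

Lemma csum_vop s q b f : uniq s ->
  csum s q (vop b f) = contr s q b *: f - vop b (csum s q f).
Proof.
move=> us; rewrite /csum vop_sum -sumrN.
rewrite (eq_bigr (fun a => (2 * isg a * (a + b == 0)%:R) *: f + - vop b (vop a f))).
  rewrite big_split /= -scaler_suml; congr (_ *: _ + _).
  rewrite /contr; case: ifP => [/andP[bs bq]|bsq].
    rewrite -big_filter (bigD1_seq (- b)) ?mem_filter ?bs ?bq ?filter_uniq //=.
    rewrite addNr eqxx mulr1 isgN big1 ?addr0 // => a ab.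
    by rewrite addr_eq0 (negPf ab) mulr0.
  rewrite big1_seq // => a /andP[aq sa]; rewrite addr_eq0.
  case: eqP => [ab|_]; last by rewrite mulr0.
  by rewrite -ab aq sa in bsq.
by move=> a _; rewrite -vop_anticomm addrK.
Qed.

(** The pairs of letters that can begin a sequence of Phi with c_1 = c are
    those met here for [p = 2 * c], each with its sign. *)
Definition xop s p f : X :=
  \sum_(a <- s | cg a p) \sum_(b <- s | cg b (- p))
    if b < a then - vop a (vop b f) else vop b (vop a f).

Definition theta s p : rat :=
  \sum_(a <- s | cg a p) \sum_(b <- s | cg b (- p))
    if b < a then 0 else 2 * isg b * (b + a == 0)%:R.

(** Restoring the same order in all products costs a scalar, by the Clifford
    relations. *)
Lemma xopE s p f :
  xop s p f = theta s p *: f - csum s p (csum s (- p) f).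
Proof.
rewrite /xop /theta [csum s p _]/csum scaler_suml -sumrB; apply: eq_bigr => a _.
rewrite scaler_suml /csum vop_sum -sumrB; apply: eq_bigr => b _.
case: ifP => _; first by rewrite scale0r sub0r.
by rewrite -vop_anticomm addrK.
Qed.

Fact xop_is_linear s p : linear (xop s p).
Proof.
move=> c f g; rewrite !xopE !csumD !csumZ scalerDr opprD addrACA !scalerA.
by rewrite scalerBr !scalerA [c * _]mulrC.
Qed.

HB.instance Definition _ s p :=
  GRing.isLinear.Build rat X X _ (xop s p) (xop_is_linear s p).

Lemma xopD s p f g : xop s p (f + g) = xop s p f + xop s p g.
Proof. exact: raddfD. Qed.
Lemma xopB s p f g : xop s p (f - g) = xop s p f - xop s p g.
Proof. exact: raddfB. Qed.
Lemma xopN s p f : xop s p (- f) = - xop s p f.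
Proof. exact: raddfN. Qed.
Lemma xopZ s p c f : xop s p (c *: f) = c *: xop s p f.
Proof. exact: linearZ. Qed.
Lemma xop_vop s p j f : uniq s ->
  xop s p (vop j f) = vop j (xop s p f)
    + (contr s p j *: csum s (- p) f - contr s (- p) j *: csum s p f).
Proof.
move=> us; rewrite !xopE csum_vop // csumB csumZ csum_vop //.
rewrite vopB vopZ opprB -!addrA; congr (_ + _).
by rewrite [RHS]addrCA; congr (_ + _); rewrite addrC opprB addrC.
Qed.

Definition Uop s (cs : seq nat) f : X :=
  foldr (fun (c : nat) g => g + xop s (2 * c%:Z) g) f cs.

(** For [cs] the decreasing list of all the classes, this is the operator of Phi
    restricted to the letters in [s]. *)
Definition Wop s cs f : X := Uop s cs (csum s 0 f).

Fact Uop_is_linear s cs : linear (Uop s cs).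
Proof.
move=> c f g; elim: cs => //= d cs ->.
by rewrite xopD xopZ scalerDr addrACA.
Qed.

HB.instance Definition _ s cs :=
  GRing.isLinear.Build rat X X _ (Uop s cs) (Uop_is_linear s cs).

Lemma UopD s cs f g : Uop s cs (f + g) = Uop s cs f + Uop s cs g.
Proof. exact: raddfD. Qed.
Lemma UopN s cs f : Uop s cs (- f) = - Uop s cs f.
Proof. exact: raddfN. Qed.
Lemma UopB s cs f g : Uop s cs (f - g) = Uop s cs f - Uop s cs g.
Proof. exact: raddfB. Qed.
Lemma UopZ s cs c f : Uop s cs (c *: f) = c *: Uop s cs f.
Proof. exact: linearZ. Qed.
Lemma Uop0 s cs : Uop s cs (0 : X) = 0.
Proof. exact: raddf0. Qed.
Lemma WopD s cs f g : Wop s cs (f + g) = Wop s cs f + Wop s cs g.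
Proof. by rewrite /Wop csumD UopD. Qed.
Lemma WopZ s cs c f : Wop s cs (c *: f) = c *: Wop s cs f.
Proof. by rewrite /Wop csumZ UopZ. Qed.
Lemma Wop0 s cs : Wop s cs (0 : X) = 0.
Proof. by rewrite /Wop csum0 Uop0. Qed.
Lemma Wop_sum s cs (I : Type) (r : seq I) (F : I -> X) :
  Wop s cs (\sum_(i <- r) F i) = \sum_(i <- r) Wop s cs (F i).
Proof. exact: (big_morph _ (WopD s cs) (Wop0 s cs)). Qed.

Lemma Uop_cat s cs cs' f : Uop s (cs ++ cs') f = Uop s cs (Uop s cs' f).
Proof. exact: foldr_cat. Qed.

(** Letters are contracted only with their opposites, and two
    anticommutations make a commutation. *)
Lemma Uop_vop s cs j f : uniq s ->
  all (fun c : nat => (contr s (2 * c%:Z) j == 0) && (contr s (- (2 * c%:Z)) j == 0)) cs ->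
  Uop s cs (vop j f) = vop j (Uop s cs f).
Proof.
move=> us; elim: cs => //= c cs IHcs /andP[/andP[/eqP c1 /eqP c2] /IHcs ->].
by rewrite xop_vop // c1 c2 !scale0r subrr addr0 vopD.
Qed.

Lemma contr_shift N q j : j \in win N -> j + m%:Z \in win N ->
  contr (win N) q (j + m%:Z) = - contr (win N) q j.
Proof.
move=> le_j le_jm; rewrite /contr !winN le_j le_jm /=.
have -> : cg (- (j + m%:Z)) q = cg (- j) q.
  by apply: cg_eql; rewrite cgN cgDm cg_refl.
by case: ifP => _; rewrite ?oppr0 // isgD isg_m // mulrN1 mulrN.
Qed.

Definition anti N cs j f : X :=
  Wop (win N) cs (vop j f) + vop j (Wop (win N) cs f).

(** The contraction of a letter with a class sum only sees the residue of the
    letter, up to a sign that is reversed by the odd shift [m].  This passes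
    to the anticommutator with the whole operator. *)
Lemma anti_shift N cs j f : j \in win N -> j + m%:Z \in win N ->
  anti N cs (j + m%:Z) f = - anti N cs j f.
Proof.
move=> le_j le_jm; have us := win_uniq N; rewrite /anti /Wop.
elim: cs => [|c cs IHcs] /=.
  by rewrite !csum_vop // !subrK contr_shift // scaleNr.
set p := 2 * _; set V := Uop _ _ (csum _ _ f) in IHcs *.
move: IHcs; set V1 := Uop _ _ _; set V2 := Uop _ _ _ => IHcs.
have E : V1 = - (V2 + vop j V) - vop (j + m%:Z) V by rewrite -IHcs addrK.
have xE : xop (win N) p V1 + vop (j + m%:Z) (xop (win N) p V) =
    - (xop (win N) p V2 + vop j (xop (win N) p V)).
  rewrite E xopB xopN xopD !xop_vop // !contr_shift // !scaleNr opprK.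
  set u := xop _ _ _; set v := vop j _; set w := vop (j + _) _.
  set y := _ *: _; set z := _ *: _.
  by ring.
rewrite !vopD addrACA IHcs xE -opprD addrACA.
by [].
Qed.

End Window.

(** * Action on the vacuum *)

Section Residue_sums.
Variables (V : zmodType) (m : nat).
Hypothesis odd_m : odd m.
Variable F : int -> V.
Hypothesis Fcg : forall a b, cg m a b -> F a = F b.

(** The residues of [2 * c] are the even ones, and those of [- (2 * c)] the odd
    ones, among 1, .., m - 1. *)
Lemma sum_residues_sym :
  \sum_(1 <= c < (mhalf m).+1) (F (2 * c%:Z) + F (- (2 * c%:Z))) =
  \sum_(1 <= i < m) F i%:Z.
Proof.
have E h : \sum_(1 <= i < h.*2.+1) F i%:Z =
    \sum_(1 <= c < h.+1) (F (2 * c%:Z) + F (2 * c%:Z - 1)).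
  elim: h => [|h IHh]; first by rewrite !big_nil.
  rewrite [RHS]big_nat_recr //= -IHh doubleS !(@big_nat_recr _ _ _ _.+1) //= -addrA.
  by congr (_ + _); rewrite addrC; congr (F _ + F _); lia.
rewrite [in RHS](mhalfE odd_m) E !big_split /=; congr (_ + _).
rewrite [RHS]big_nat_rev /=; apply: eq_big_nat => c lt_c; apply: Fcg.
have mE := mhalfE odd_m; rewrite /cg.
have -> : - (2 * c%:Z) - (2 * (1 + (mhalf m).+1 - c.+1)%N%:Z - 1) = (- 1) * m%:Z.
  by lia.
exact: dvdz_mull.
Qed.

Lemma sum_residues_refl (k : int) :
  \sum_(0 <= i < m) F (k - i%:Z) = \sum_(0 <= i < m) F i%:Z.
Proof.
have m_gt0 : (0 < m)%N by case: (m) odd_m.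
have m0 : m%:Z != 0 by rewrite eqz_nat -lt0n.
have ltm i : (`|((k - i%:Z) %% m%:Z)%Z| < m)%N.
  by have := ltz_pmod (k - i%:Z) (d := m%:Z); have := modz_ge0 (k - i%:Z) m0; lia.
pose r (i : 'I_m) := Ordinal (ltm i).
have rcg i : cg m (r i)%:Z (k - i%:Z).
  rewrite /cg /= gez0_abs ?modz_ge0 // {2}(divz_eq (k - i%:Z) m%:Z).
  by rewrite opprD addrCA subrr addr0 -mulNr dvdz_mull.
have r_inj : injective r.
  move=> i j ij; apply/val_inj.
  have : cg m (k - i%:Z) (k - j%:Z) by apply: cg_trans (rcg j); rewrite cg_sym -ij.
  rewrite /cg opprD addrACA subrr add0r opprK addrC => H.
  suff : i%:Z = j%:Z by case.
  by apply/esym; apply: cg_small H; have := ltn_ord i; have := ltn_ord j; lia.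
rewrite !big_mkord [RHS](reindex_inj r_inj) /=; apply: eq_bigr => i _.
by apply/esym/Fcg/rcg.
Qed.

End Residue_sums.

HB.lock Definition pos (N : nat) : seq int := [seq i%:Z | i <- iota 0 N.+1].

Lemma pos_uniq N : uniq (pos N).
Proof. by rewrite pos.unlock map_inj_uniq ?iota_uniq // => i j []. Qed.

Lemma mem_pos N (a : int) : (a \in pos N) = (0 <= a <= N%:Z).
Proof.
rewrite pos.unlock; apply/mapP/idP => [[u]|]; first by rewrite mem_iota => /andP[_ lt_i] ->; lia.
by case: a => // a le_a; exists a => //; rewrite mem_iota; lia.
Qed.

Lemma big_win_pos N (V : nmodType) (P : pred int) (F : int -> V) :
  (forall a, P a -> a < 0 -> F a = 0) ->
  \sum_(a <- win N | P a) F a = \sum_(a <- pos N | P a) F a.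
Proof.
move=> F0; have pw : perm_eq (win N) ([seq a <- win N | a < 0] ++ pos N).
  apply: uniq_perm; first exact: win_uniq.
    rewrite cat_uniq filter_uniq ?win_uniq // pos_uniq andbT.
    by apply/hasPn => a; rewrite mem_pos mem_filter => /andP[a0 _]; rewrite ltNge a0.
  by move=> a; rewrite mem_cat mem_filter !mem_win mem_pos; lia.
rewrite (perm_big _ pw) big_cat -[LHS]/(_ + _) big1_seq ?add0r // => a.
by rewrite mem_filter => /and3P[Pa a_lt0 _]; apply: F0.
Qed.

Section Vacuum.
Variables (X : fock) (m : nat).
Hypothesis odd_m : odd m.
Variable N : nat.
Implicit Types (f g h : X) (c : rat) (a b j p q r : int) (s : seq int)
  (cs : seq nat).

Notation cg := (cg m).
Notation cl := (cl m).
Notation rsg := (rsg m).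

Notation pos := (pos N).
Notation c_ := (csum m pos).

Lemma contr_pos q b : 0 <= b -> ~~ (cg b 0 && cg q 0) -> contr m pos q b = 0.
Proof.
move=> b_ge0; rewrite /contr mem_pos; case: ifP => // /andP[b_le0 bq].
have b0 : b = 0 by lia.
by rewrite b0 oppr0 in bq *; rewrite cg_refl [cg q 0]cg_sym bq.
Qed.

Lemma csum_csum q q' f : c_ q (c_ q' f) =
  (\sum_(b <- pos | cg b q') contr m pos q b) *: f - c_ q' (c_ q f).
Proof.
transitivity (\sum_(b <- pos | cg b q') c_ q (vop b f)); first exact: csum_sum.
rewrite [c_ q' (c_ q f)]/csum scaler_suml -sumrB; apply: eq_bigr => b _.
by rewrite csum_vop ?pos_uniq.
Qed.

(** Nonnegative letters are contracted only if both are [0]. *)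
Lemma csum_anti q q' f : ~~ (cg q 0 && cg q' 0) ->
  c_ q (c_ q' f) = - c_ q' (c_ q f).
Proof.
move=> qq'; rewrite csum_csum big1_seq ?scale0r ?sub0r // => b /andP[bq'].
rewrite mem_pos => /andP[b_ge0 _].
by rewrite contr_pos // (cg_eql _ bq') andbC.
Qed.

Lemma csum_sq q f : ~~ cg q 0 -> c_ q (c_ q f) = 0.
Proof.
move=> q0; have := csum_anti (q := q) (q' := q) f.
rewrite (negPf q0) => /(_ isT)/eqP; rewrite -addr_eq0 -mulr2n -scaler_nat.
by rewrite scaler_eq0 => /eqP.
Qed.

(** The only contraction is that of the letter [0] with itself. *)
Lemma csum0_sq f : c_ 0 (c_ 0 f) = f.
Proof.
have /eqP := csum_csum 0 0 f; rewrite -subr_eq opprK -mulr2n -scaler_nat.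
have -> : \sum_(b <- pos | cg b 0) contr m pos 0 b = 2.
  rewrite -big_filter (bigD1_seq 0) ?filter_uniq ?pos_uniq //=; last first.
    by rewrite mem_filter mem_pos cg_refl.
  rewrite big1_seq ?addr0 => [|b]; first by rewrite /contr oppr0 mem_pos cg_refl.
  rewrite mem_filter mem_pos => /andP[b0 /andP[_ bp]].
  by rewrite /contr mem_pos; case: ifP => // /andP[b_le0 _]; lia.
by move/eqP/(scalerI (a := 2)); apply.
Qed.

(** The operator [1 + xp p] is the part of [1 + xop (win N) p] with
    nonnegative letters. *)
Definition xp p f : X := - c_ p (c_ (- p) f).

Lemma xpE p f : xp p f = - c_ p (c_ (- p) f).
Proof. by []. Qed.

Fact xp_is_linear p : linear (xp p).
Proof.
move=> c f g; rewrite /xp !csumD !csumZ opprD.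
by rewrite -scalerN.
Qed.

HB.instance Definition _ p :=
  GRing.isLinear.Build rat X X _ (xp p) (xp_is_linear p).

Lemma xpD p f g : xp p (f + g) = xp p f + xp p g.
Proof. exact: raddfD. Qed.
Lemma xpZ p c f : xp p (c *: f) = c *: xp p f.
Proof. exact: linearZ. Qed.
Lemma xp0 p : xp p (0 : X) = 0.
Proof. exact: raddf0. Qed.

Definition Ev cs f : X := foldr (fun (c : nat) g => g + xp (2 * c%:Z) g) f cs.

Fact Ev_is_linear cs : linear (Ev cs).
Proof.
by move=> c f g; elim: cs => //= d cs ->; rewrite xpD xpZ scalerDr addrACA.
Qed.

HB.instance Definition _ cs :=
  GRing.isLinear.Build rat X X _ (Ev cs) (Ev_is_linear cs).

Lemma EvD cs f g : Ev cs (f + g) = Ev cs f + Ev cs g.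
Proof. exact: raddfD. Qed.
Lemma EvN cs f : Ev cs (- f) = - Ev cs f.
Proof. exact: raddfN. Qed.
Lemma EvZ cs c f : Ev cs (c *: f) = c *: Ev cs f.
Proof. exact: linearZ. Qed.
Lemma Ev_cat cs cs' f : Ev (cs ++ cs') f = Ev cs (Ev cs' f).
Proof. exact: foldr_cat. Qed.

Definition in_range cs := all (fun c : nat => 0 < c <= mhalf m)%N cs.

Lemma xp_rsg q f : ~~ cg q 0 -> xp (2 * (cl q)%:Z) f = - (rsg q *: c_ q (c_ (- q) f)).
Proof.
move=> q0; have clq : (0 < cl q <= mhalf m)%N by rewrite (cl_pos odd_m) ?cl_le.
case/orP: (clP odd_m q) => H.
  rewrite (rsg_cg odd_m H) rsg2 // scale1r /xp.
  by rewrite (csum_cg _ _ H) (csum_cg _ _ (q := - q) (q' := - (2 * (cl q)%:Z))) ?cgN.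
rewrite (rsg_cg odd_m H) (rsgN odd_m) ?cg2_neq0 // rsg2 // scaleN1r opprK /xp.
rewrite csum_anti; last by rewrite (negPf (cg2_neq0 odd_m clq)).
rewrite opprK (csum_cg _ _ H) (csum_cg _ _ (q := - q) (q' := 2 * (cl q)%:Z)) //.
by rewrite -cgN opprK.
Qed.

Lemma xp_csum (c : nat) a f : ~~ cg a 0 -> (0 < c <= mhalf m)%N ->
  xp (2 * c%:Z) (c_ a f) = if cl a == c then 0 else c_ a (xp (2 * c%:Z) f).
Proof.
move=> a0 c_range; have p0 := cg2_neq0 odd_m c_range.
case: eqP => [<-|/eqP ac].
  rewrite xp_rsg // (csum_anti (q := - a)); last by rewrite (negPf a0) andbF.
  by rewrite csumN csum_sq // oppr0 scaler0 oppr0.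
rewrite /xp (csum_anti (q := - _) (q' := a)) ?(negPf a0) ?andbF // csumN.
by rewrite (csum_anti (q := 2 * _) (q' := a)) ?(negPf a0) ?andbF // opprK csumN.
Qed.

Lemma xp_csum0 (c : nat) f : (0 < c <= mhalf m)%N ->
  xp (2 * c%:Z) (c_ 0 f) = c_ 0 (xp (2 * c%:Z) f).
Proof.
move=> c_range; have p0 := cg2_neq0 odd_m c_range.
rewrite /xp (csum_anti (q := - _) (q' := 0)); last by rewrite -[0]oppr0 cgN (negPf p0).
by rewrite !csumN (csum_anti (q := 2 * _) (q' := 0)) ?(negPf p0) // opprK.
Qed.

(** A factor [1 + xp] of the class of [a] is absorbed by [c_ a], whose square
    is zero. *)
Lemma Ev_csum cs a f : in_range cs -> ~~ cg a 0 ->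
  Ev cs (c_ a f) = c_ a (Ev [seq c <- cs | c != cl a] f).
Proof.
move=> + a0; elim: cs => //= c cs IHcs /andP[c_range /IHcs ->].
rewrite xp_csum // [c == _]eq_sym; case: eqP => [_|_] /=; first by rewrite addr0.
by rewrite csumD.
Qed.

Lemma csum_Ev cs a f : in_range cs -> ~~ cg a 0 ->
  c_ a (Ev cs f) = c_ a (Ev [seq c <- cs | c != cl a] f).
Proof.
move=> + a0; elim: cs => //= c cs IHcs /andP[c_range /IHcs E].
case: (eqVneq c (cl a)) => [clc|ca] /=; rewrite csumD.
  by rewrite E clc xp_rsg // csumN csumZ csum_sq // scaler0 oppr0 addr0.
have H g : xp (2 * c%:Z) (c_ a g) = c_ a (xp (2 * c%:Z) g).
  by rewrite xp_csum // eq_sym (negPf ca).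
by rewrite -H E H csumD.
Qed.

Lemma csum0_Ev cs f : in_range cs -> c_ 0 (Ev cs f) = Ev cs (c_ 0 f).
Proof.
elim: cs => //= c cs IHcs /andP[c_range /IHcs <-].
by rewrite csumD xp_csum0.
Qed.

(** ** The operator on the vacuum *)

(** The negative letters of one class anticommute with the nonnegative letters
    of the other classes, and thus reach the vacuum.  This uses that each class
    occurs in a single factor. *)
Lemma Wop_vac cs : uniq cs -> in_range cs -> Wop m (win N) cs (1 : X) = Ev cs (c_ 0 1).
Proof.
rewrite /Wop => ucs rcs.
have -> : csum m (win N) 0 1 = c_ 0 (1 : X).
  by apply: big_win_pos => a _ a_lt0; apply: vop_vac_neg.
elim: cs ucs rcs => //= c cs IHcs /andP[c_cs ucs] /andP[c_range rcs].
rewrite IHcs //; congr (_ + _).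
set p := 2 * _; set g := Ev cs _.
have p0 : ~~ cg p 0 by apply: cg2_neq0.
have kill b : b < 0 -> cl b = c -> vop b g = 0.
  move=> b_lt0 clb; rewrite /g; elim: (cs) c_cs rcs {IHcs ucs g} => [|d ds IHd].
    move=> _ _ /=; have := @csum_vop X m pos 0 b 1 (pos_uniq N).
    rewrite vop_vac_neg // csum0 => /esym/eqP; rewrite subr_eq add0r => /eqP <-.
    rewrite /contr; case: ifP => [/andP[_]|]; last by rewrite scale0r.
    by rewrite -[0]oppr0 cgN -(cl_eq0 odd_m) clb; case: (c) c_range.
  rewrite inE negb_or => /andP[cd c_ds] /= /andP[d_range rds].
  have c0 e : cl e = d -> contr m pos e b = 0.
    move=> cle; rewrite /contr; case: ifP => // /andP[_ /(cl_cg) be].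
    by move: cd; rewrite -cle -be (clN odd_m) clb eqxx.
  have anti e f : cl e = d -> vop b (c_ e f) = - c_ e (vop b f).
    by move=> /c0 e0; rewrite csum_vop ?pos_uniq // e0 scale0r sub0r opprK.
  have cld : cl (2 * d%:Z) = d by apply: cl2 => //; case/andP: d_range.
  by rewrite vopD IHd // add0r /xp vopN anti // anti ?(clN odd_m) // IHd // !(csum0, oppr0).
have clp : cl p = c by apply: cl2 => //; case/andP: c_range.
have cla a : cg a p -> cl a = c by move/cl_cg ->.
have clb b : cg b (- p) -> cl b = c by move/cl_cg ->; rewrite clN.
have ne0 a : cl a = c -> ~~ cg a 0.
  by rewrite -(cl_eq0 odd_m) => ->; case: (c) c_range.
rewrite /xop big_win_pos => [|a ap a_lt0]; last first.
  apply: big1 => b bp; rewrite [vop a g]kill ?cla // vop0.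
  case: ifP => // b_lt_a; rewrite [vop b g]kill ?vop0 ?oppr0 //; first by lia.
  exact: clb.
rewrite /xp /csum -sumrN big_seq_cond [RHS]big_seq_cond.
apply: eq_bigr => a /andP[+ ap]; rewrite mem_pos => /andP[a_ge0 _].
have a_gt0 : 0 < a.
  by rewrite lt_neqAle a_ge0 andbT eq_sym; apply: contraNneq (ne0 a (cla a ap)) => ->; rewrite cg_refl.
rewrite big_win_pos => [|b bp b_lt0]; last first.
  rewrite [vop b g]kill ?clb // vop0 oppr0.
  by rewrite ltNge; case: (leP a b) => //=; lia.
rewrite -vopN -sumrN vop_sum big_seq_cond [RHS]big_seq_cond.
apply: eq_bigr => b /andP[+ bp]; rewrite mem_pos => /andP[b_ge0 _].
rewrite vopN; case: ifP => // _; rewrite vop_swap //; lia.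
Qed.

End Vacuum.

(** * Vectors of high degree *)

Section High.
Variable X : fock.
Implicit Types (f g : X) (c : rat) (a b j : int) (s t : seq int).

(** A functional form of the statement that all the components of [f] have
    degree at least [d]; it only mentions constant terms, and no grading. *)
Definition high (d : int) f := forall (mu : seq nat) s, all odd mu ->
  (sumn mu)%:Z - \sum_(a <- s) a < d -> sp 1 (padl mu (vops s f)) = 0.

Lemma padlD mu f g : padl mu (f + g) = padl mu f + padl mu g.
Proof. by elim: mu => //= k mu ->; rewrite padD. Qed.
Lemma padlZ mu c f : padl mu (c *: f) = c *: padl mu f.
Proof. by elim: mu => //= k mu ->; rewrite padZ. Qed.
Lemma padl0 mu : padl mu (0 : X) = 0.
Proof. by elim: mu => //= k mu ->; rewrite pad0. Qed.
Lemma padl_sum mu (I : Type) (r : seq I) (P : pred I) (F : I -> X) :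
  padl mu (\sum_(i <- r | P i) F i) = \sum_(i <- r | P i) padl mu (F i).
Proof. exact: (big_morph _ (padlD mu) (padl0 mu)). Qed.

Lemma high_le d d' f : d' <= d -> high d f -> high d' f.
Proof. by move=> le_d hf mu s odd_mu lt_d; apply: hf => //; apply: lt_le_trans le_d. Qed.

Lemma high0 d : high d 0.
Proof. by move=> mu s _ _; rewrite vops0 padl0 sp0r. Qed.

Lemma highD d f g : high d f -> high d g -> high d (f + g).
Proof.
by move=> hf hg mu s odd_mu lt_d; rewrite vopsD padlD spDr hf ?hg ?addr0.
Qed.

Lemma highZ d c f : high d f -> high d (c *: f).
Proof. by move=> hf mu s odd_mu lt_d; rewrite vopsZ padlZ spZr hf ?mulr0. Qed.

Lemma highN d f : high d f -> high d (- f).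
Proof. by rewrite -scaleN1r; apply: highZ. Qed.

Lemma highB d f g : high d f -> high d g -> high d (f - g).
Proof. by move=> hf hg; apply: highD => //; apply: highN. Qed.

Lemma high_sum d (I : Type) (r : seq I) (P : pred I) (F : I -> X) :
  (forall i, P i -> high d (F i)) -> high d (\sum_(i <- r | P i) F i).
Proof. by apply: big_ind; [exact: high0|exact: highD]. Qed.

Lemma high_vword t : high (\sum_(a <- t) a) (vword X t).
Proof.
move=> mu s odd_mu lt_d; rewrite /vword -vops_cat -/(vword X _).
rewrite sp1_padl_vword // big_cat /=; move: lt_d.
by move: (\sum_(a <- s) a) (\sum_(a <- t) a) => u v; lia.
Qed.

Lemma high1 : high 0 (1 : X).
Proof. by have := @high_vword [::]; rewrite big_nil. Qed.

(** Appending [j] to the test word shifts the degree. *)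
Lemma high_vop d j f : high d f -> high (d + j) (vop j f).
Proof.
move=> hf mu s odd_mu lt_d; rewrite -[vop j f]/(vops [:: j] f) -vops_cat.
apply: hf => //; rewrite big_cat big_seq1 /=; move: lt_d.
by move: (\sum_(a <- s) a) => u; lia.
Qed.

Lemma high_vop_ge0 d j f : 0 <= j -> high d f -> high d (vop j f).
Proof. by move=> j0 /(@high_vop _ j); apply: high_le; lia. Qed.

End High.

Section VacuumPad.
Variables (X : fock) (m : nat).
Hypothesis odd_m : odd m.
Variables (N k : nat).
Hypothesis odd_k : odd k.
Hypothesis k_neq0 : ~~ cg m k%:Z 0.
Hypothesis le_kN : (k <= N)%N.
Implicit Types (f g h : X) (c : rat) (a b j p q r : int) (s : seq int)
  (cs : seq nat).

Notation cg := (cg m).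
Notation cl := (cl m).
Notation rsg := (rsg m).
Notation pos := (pos N).
Notation c_ := (csum m pos).
Notation Ev := (Ev m N).
Notation xp := (xp m N).
Notation in_range := (in_range m).

Lemma high_csum d q f : high d f -> high d (c_ q f).
Proof.
move=> hf; rewrite /csum big_seq_cond; apply: high_sum => b /andP[+ _].
by rewrite mem_pos => /andP[b_ge0 _]; apply: high_vop_ge0.
Qed.

Lemma high_xp d p f : high d f -> high d (xp p f).
Proof. by move=> hf; apply/highN/high_csum/high_csum. Qed.

Lemma high_Ev d cs f : high d f -> high d (Ev cs f).
Proof.
by move=> hf; elim: cs => //= c cs IHcs; apply: highD => //; apply: high_xp.
Qed.

(** The letters of [csum pos q], lowered by [k]: those that stay nonnegative
    are, up to the top of the window, those of [csum pos (q - k)]. *)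
Definition dsum q f : X := \sum_(a <- pos | cg a q) vop (a - k%:Z) f.
Definition low q f : X := \sum_(i <- iota 0 k | cg i%:Z q) vop (i%:Z - k%:Z) f.
(** The letters that have no letter of the window above them at distance
    [k]. *)
Definition top q f : X := \sum_(i <- iota (N.+1 - k) k | cg i%:Z q) vop i%:Z f.

Lemma dsumE q f : dsum q f = c_ (q - k%:Z) f + low q f - top (q - k%:Z) f.
Proof.
have F_sum (P : pred int) (F : int -> X) n1 n2 : (n1 <= N.+1)%N ->
    n2 = (N.+1 - n1)%N ->
    \sum_(a <- pos | P a) F a =
      \sum_(i <- iota 0 n1 | P i%:Z) F i%:Z + \sum_(i <- iota n1 n2 | P i%:Z) F i%:Z.
  move=> le_n1 ->; rewrite pos.unlock big_map.
  by rewrite -{1}(subnKC le_n1) iotaD big_cat.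
rewrite /dsum (F_sum _ _ k _ (leqW le_kN) erefl) -/(low q f) addrC [RHS]addrAC.
congr (_ + _).
rewrite /csum (F_sum _ _ (N.+1 - k)%N k) ?leq_subr ?subKn ?leqW //.
rewrite -/(top (q - k%:Z) f) addrK (_ : iota k _ = [seq (k + i)%N | i <- iota 0 (N.+1 - k)]) ?big_map; last first.
  by rewrite -iotaDl addn0.
apply: eq_big => i.
  rewrite PoszD; apply/idP/idP => H.
    by rewrite -(addKr k%:Z i%:Z) addrC cgB // cg_refl.
  by rewrite -[q](subrK k%:Z) addrC cgD // cg_refl.
by move=> _; congr vop; lia.
Qed.

Lemma high_top q f : high 0 f -> high (N.+1 - k)%N%:Z (top q f).
Proof.
move=> hf; rewrite /top big_seq_cond; apply: high_sum => i /andP[].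
rewrite mem_iota => /andP[le_i _] _.
by have := high_vop (j := i%:Z) hf; apply: high_le; lia.
Qed.

Lemma altsum_rev r :
  \sum_(i <- iota 0 k | cg i%:Z r) 2 * isg (i%:Z - k%:Z) = 2 * altsum m k (k%:Z - r).
Proof.
rewrite /altsum -mulr_sumr; congr (_ * _).
have -> : iota 0 k = index_iota 0 k by rewrite /index_iota subn0.
have -> : iota 1 k = index_iota 1 k.+1 by rewrite /index_iota subn1.
rewrite big_add1 /= big_nat_rev add0n [LHS]big_nat_cond [RHS]big_nat_cond.
apply: eq_big => i.
  case: ltnP => //= lt_ik; apply/idP/idP => H.
    have -> : i.+1%:Z = k%:Z - (k - i.+1)%N%:Z by lia.
    by rewrite cgB // cg_refl.
  have -> : (k - i.+1)%N%:Z = k%:Z - i.+1%:Z by lia.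
  by rewrite -[r](subKr k%:Z) cgB // cg_refl.
by case/andP=> /andP[_ lt_ik] _; rewrite -isgN; congr isg; lia.
Qed.

(** The letters of [low r] are negative, and meet their opposites in the class
    of [k - r] only. *)
Lemma low_csum r q f : low r (c_ q f) =
  (if cg q (k%:Z - r) then 2 * altsum m k (k%:Z - r) else 0) *: f - c_ q (low r f).
Proof.
rewrite -altsum_rev [c_ q (low r f)]csum_sum.
transitivity ((\sum_(i <- iota 0 k | cg i%:Z r) contr m pos q (i%:Z - k%:Z)) *: f -
    \sum_(i <- iota 0 k | cg i%:Z r) c_ q (vop (i%:Z - k%:Z) f)).
  rewrite scaler_suml -sumrB; apply: eq_bigr => i _.
  by rewrite csum_vop ?pos_uniq // opprB addrCA subrr addr0.
congr (_ *: _ - _).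
transitivity (\sum_(i <- iota 0 k | cg i%:Z r)
    (if cg q (k%:Z - r) then 2 * isg (i%:Z - k%:Z) else 0)); last first.
  by case: ifP => // _; rewrite big1.
rewrite big_seq_cond [RHS]big_seq_cond; apply: eq_bigr => i /andP[].
rewrite mem_iota => /andP[_ lt_ik] ir; rewrite /contr mem_pos.
have -> : 0 <= - (i%:Z - k%:Z) <= N%:Z by move: le_kN lt_ik; lia.
rewrite opprB /= [cg q _]cg_sym; congr (if _ then _ else _).
by apply: cg_eql; rewrite cgB // cg_refl.
Qed.

Lemma low_vac r : low r 1 = 0.
Proof.
rewrite /low big_seq_cond big1 // => i /andP[].
by rewrite mem_iota => /andP[_ lt_ik] _; rewrite vop_vac_neg //; clear -lt_ik; lia.
Qed.

(** If the pair of the factor contains the residue [k - r], then one letter of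
    the pair is contracted and the other one remains. *)
Lemma low_xp r (c : nat) f : (0 < c <= mhalf m)%N ->
  low r (xp (2 * c%:Z) f) = xp (2 * c%:Z) (low r f)
    - (if cl (k%:Z - r) == c
       then (rsg (k%:Z - r) * (2 * altsum m k (k%:Z - r))) *: c_ (r - k%:Z) f else 0).
Proof.
move=> c_range; have p0 := cg2_neq0 odd_m c_range.
have lowN q u : low q (- u) = - low q u by rewrite -sumrN; apply: eq_bigr => i _; rewrite vopN.
have lowZ q (a : rat) u : low q (a *: u) = a *: low q u.
  by rewrite scaler_sumr; apply: eq_bigr => i _; rewrite vopZ.
case: eqP => [clc|/eqP ncl].
  set q := k%:Z - r in clc *.
  have q0 : ~~ cg q 0 by rewrite -(cl_eq0 odd_m) clc; case: (c) c_range.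
  rewrite -clc !xp_rsg // lowN lowZ !low_csum cg_refl.
  have -> : cg (- q) q = false.
    by apply: negbTE; rewrite cg_sym (cg_opp odd_m).
  rewrite scale0r sub0r csumN opprK scalerDr opprD scalerA addrC.
  by congr (- _ - _ *: csum _ _ _ _); rewrite opprB.
have no p : cl p = c -> cg p (k%:Z - r) = false.
  by move=> clp; apply: contraNF ncl => /cl_cg <-; rewrite clp.
have cl2c : cl (2 * c%:Z) = c by apply: cl2 => //; case/andP: c_range.
rewrite subr0 /xp lowN low_csum no // low_csum no ?clN //.
by rewrite !scale0r !sub0r opprK csumN.
Qed.

(** ** Cancellation on the vacuum *)

Lemma clB a b : cl (a - b) = cl (b - a).
Proof. by rewrite -(clN odd_m) opprB. Qed.

Lemma altsum_cg q q' : cg q q' -> altsum m k q = altsum m k q'.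
Proof. by move=> qq'; apply: eq_bigl => b; apply: cg_eqr. Qed.

(** At most one factor contains the residue [k - r]; the others commute with
    [low r]. *)
Lemma low_Ev r cs f : uniq cs -> in_range cs -> low r f = 0 ->
  low r (Ev cs f) = if cl (k%:Z - r) \in cs
    then - ((rsg (k%:Z - r) * (2 * altsum m k (k%:Z - r))) *:
            c_ (r - k%:Z) (Ev [seq c : nat <- cs | c != cl (k%:Z - r)] f))
    else 0.
Proof.
move=> + + f0; set q := k%:Z - r; elim: cs => //= c cs IHcs /andP[c_cs ucs] /andP[c_range rcs].
have lowD u v : low r (u + v) = low r u + low r v.
  by rewrite -big_split /=; apply: eq_bigr => i _; rewrite vopD.
rewrite lowD low_xp // IHcs // in_cons; case: (eqVneq (cl q) c) => [qc|qc] /=.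
  rewrite -qc in c_cs *; rewrite (negPf c_cs) xp0 add0r sub0r.
  congr (- (_ *: c_ _ (Ev _ _))); apply/esym/all_filterP/allP => d dcs.
  by apply: contraNneq c_cs => <-.
rewrite subr0; case: ifP => qcs; last by rewrite xp0 addr0.
have -> u : xp (2 * c%:Z) (- (u : X)) = - xp (2 * c%:Z) u by exact: raddfN.
rewrite xpZ xp_csum //; last first.
  rewrite -(cl_eq0 odd_m) clB -/q.
  by apply: contraTneq qcs => ->; apply/negP => /(allP rcs).
rewrite clB -/q (negPf qc) csumD scalerDr opprD.
by [].
Qed.

Lemma low_Ev0 r cs f : in_range cs -> cg (k%:Z - r) 0 ->
  low r (Ev cs f) = Ev cs (low r f).
Proof.
move=> + q0; elim: cs => //= c cs IHcs /andP[c_range /IHcs <-].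
have lowD u v : low r (u + v) = low r u + low r v.
  by rewrite -big_split /=; apply: eq_bigr => i _; rewrite vopD.
rewrite lowD low_xp //; move: q0; rewrite -(cl_eq0 odd_m) => /eqP ->.
by case: eqP c_range => [<- //|_ _]; rewrite subr0.
Qed.

Lemma pad_csum q f : pad k (c_ q f) = c_ q (pad k f) + dsum q f.
Proof.
rewrite /csum pad_sum -big_split /=; apply: eq_bigr => a _.
exact: pad_vop.
Qed.

(** Decreasing, like the numbers c_1 > .. > c_s of a sequence of Phi. *)
Definition classes := rev (iota 1 (mhalf m)).

Lemma classes_uniq : uniq classes.
Proof. by rewrite rev_uniq iota_uniq. Qed.

Lemma mem_classes (c : nat) : (c \in classes) = (0 < c <= mhalf m)%N.
Proof. by rewrite mem_rev mem_iota add1n ltnS. Qed.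

Lemma classes_range : in_range classes.
Proof. by apply/allP => c; rewrite mem_classes. Qed.

Lemma classes_split cs1 (c : nat) cs2 : classes = cs1 ++ c :: cs2 ->
  forall d : nat, (d \in cs2) = (d \in classes) && (d < c)%N.
Proof.
move=> E d; have : sorted gtn classes.
  by rewrite /classes rev_sorted; apply: iota_ltn_sorted.
rewrite E sorted_pairwise; last exact: gtn_trans.
rewrite pairwise_cat /= => /and4P[/allrelP H12 _ /allP H2 _].
rewrite mem_cat in_cons; apply/idP/idP => [d2|/andP[/or3P[d1|/eqP->|->//]]].
- by rewrite d2 !orbT; apply: H2.
- by have := H12 d c d1 (mem_head _ _) => /= lt_cd lt_dc; have := ltn_trans lt_cd lt_dc; rewrite ltnn.
- by rewrite ltnn.
Qed.

Local Notation vac0 := (c_ 0 (1 : X)).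

(** The vector left when one of the letters of the pair of residues [r], [- r]
    has been lowered by [k]: the two letters absorb the factors of their
    classes. *)
Definition pair_term r : X :=
  c_ (r - k%:Z) (c_ (- r)
    (Ev [seq c : nat <- classes | (c != cl (r - k%:Z)) && (c != cl r)] vac0)).

(** The vector left when the letter of residue [0] has been lowered by [k]. *)
Definition lone_term : X :=
  c_ (- k%:Z) (Ev [seq c : nat <- classes | c != cl k%:Z] 1).

(** The total contribution of the residue [r].  The sign depends on which of
    the residues [r] and [k - r] has its factor further to the left. *)
Definition pad_term r : X :=
  if cg r k%:Z then - lone_term
  else - ((if (cl (k%:Z - r) < cl r)%N then rsg (k%:Z - r) else rsg r) *: pair_term r).

Lemma low_vac0 r : low r vac0 = (if cg r k%:Z then 2 * altsum m k 0 else 0) *: 1.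
Proof.
rewrite low_csum // low_vac csum0 subr0 cg_sym.
have -> : cg (k%:Z - r) 0 = cg r k%:Z by rewrite /cg subr0 -opprB rpredN.
case: ifP => // rk; congr (2 * _ *: _); apply: altsum_cg.
by rewrite /cg subr0 -opprB rpredN.
Qed.

(** If the factor of [k - r] stands to the right of that of [r], the letters
    that become negative are contracted with it, and [altsum_neq0] gives the
    resulting sign.  For [r] congruent to [k] they are contracted with the
    letters of residue [0] instead, and [altsum_eq0] applies. *)
Lemma pad_term_step cs1 cs2 r : classes = cs1 ++ cl r :: cs2 -> ~~ cg r 0 ->
  Ev cs1 (- (rsg r *: (c_ (r - k%:Z) (c_ (- r) (Ev cs2 vac0))
                        + low r (c_ (- r) (Ev cs2 vac0))))) = pad_term r.
Proof.
move=> E r0; have := classes_uniq; have := classes_range.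
rewrite E /in_range all_cat /= => /and3P[r1 _ r2].
rewrite cat_uniq /= => /and4P[_ _ c_cs2 u2].
have Nr0 : ~~ cg (- r) 0 by rewrite -[0]oppr0 cgN.
rewrite low_csum //.
have -> : cg (- r) (k%:Z - r) = false.
  rewrite -(negPf k_neq0) /cg subr0.
  have -> : - r - (k%:Z - r) = - k%:Z by lia.
  by rewrite !dvdzE abszN.
have fid (P : pred nat) : all P cs2 -> [seq c : nat <- cs2 | P c] = cs2 by move/all_filterP.
rewrite scale0r sub0r /pad_term; case: ifP => rk.
  have k0r : cg (k%:Z - r) 0 by rewrite /cg subr0 -opprB rpredN.
  have r0k : cg (r - k%:Z) 0 by rewrite /cg subr0.
  rewrite (csum_cg _ _ r0k) (csum_anti odd_m); last by rewrite cg_refl (negPf Nr0).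
  rewrite csum0_Ev // csum0_sq //.
  have lowE : low r (Ev cs2 vac0) = (2 * altsum m k 0) *: Ev cs2 1.
    by rewrite low_Ev0 // low_vac0 rk EvZ.
  rewrite lowE csumZ -opprD -[X in X + _]scale1r -scalerDl scalerN opprK.
  rewrite scalerA (rsg_cg odd_m rk) altsum_eq0 // scaleN1r EvN; congr (- _).
  rewrite /lone_term Ev_csum // (clN odd_m) (cl_cg rk).
  rewrite (csum_cg _ _ (q := - r) (q' := - k%:Z)) ?cgN //; congr (c_ _ _).
  rewrite E (cl_cg rk) filter_cat /= eqxx Ev_cat; congr (Ev _ (Ev _ _)).
  by rewrite fid //; apply/allP => d d2; rewrite -(cl_cg rk); apply: contraNneq c_cs2 => <-.
have q0 : ~~ cg (k%:Z - r) 0.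
  by apply: contraFN rk; rewrite /cg subr0 -opprB rpredN.
have rk0 : ~~ cg (r - k%:Z) 0 by rewrite -[0]oppr0 -opprB cgN.
have kq : ~~ cg k%:Z (k%:Z - r).
  by apply: contra r0; rewrite /cg subr0 opprB addrCA subrr addr0.
have anti u : c_ (r - k%:Z) (c_ (- r) u) = - c_ (- r) (c_ (r - k%:Z) u).
  by rewrite csum_anti // (negPf rk0).
set F := [seq c : nat <- cs2 | c != cl (r - k%:Z)].
have vac0_0 : low r vac0 = 0 by rewrite low_vac0 rk scale0r.
have qcl : (cl (k%:Z - r) \in cs2) = (cl (k%:Z - r) < cl r)%N.
  rewrite (classes_split E) mem_classes (cl_pos odd_m) // (cl_le odd_m) //.
have main : c_ (r - k%:Z) (c_ (- r) (Ev cs2 vac0)) - c_ (- r) (low r (Ev cs2 vac0)) =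
    (if (cl (k%:Z - r) < cl r)%N then rsg (k%:Z - r) * rsg r else 1) *:
      c_ (r - k%:Z) (c_ (- r) (Ev F vac0)).
  rewrite low_Ev // qcl [cl (k%:Z - r) in X in filter X]clB.
  rewrite {1}anti csum_Ev // -/F -anti; case: ifP => _; last first.
    by rewrite csum0 subr0 scale1r.
  rewrite csumN opprK csumZ.
  have -> : c_ (- r) (c_ (r - k%:Z) (Ev F vac0)) = - c_ (r - k%:Z) (c_ (- r) (Ev F vac0)).
    by rewrite anti opprK.
  rewrite scalerN -{1}[c_ (r - _) _]scale1r -scalerBl altsum_neq0 //.
  by congr (_ * rsg _ *: _); rewrite opprB addrCA subrr addr0.
rewrite main EvN EvZ EvZ scalerA; congr (- (_ *: _)).
  by case: ifP => _; rewrite ?mulr1 // mulrCA rsgK mulr1.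
rewrite Ev_csum // Ev_csum //; last first.
  by apply/allP => d; rewrite mem_filter => /andP[_ /(allP r1)].
rewrite /pair_term; congr (c_ _ (c_ _ _)); rewrite -Ev_cat; congr (Ev _ _).
rewrite E filter_cat /= eqxx andbF (clN odd_m) -filter_predI; congr (_ ++ _).
  by apply: eq_filter => c /=; rewrite andbC.
apply: eq_in_filter => d d2; rewrite [d != cl r](_ : _ = true) ?andbT //.
by apply: contraNneq c_cs2 => <-.
Qed.

(** The operator [pad k] moves from the left to the right of one factor after
    the other.  The vectors of high degree come from the letters at the top of
    the window. *)
Lemma pad_vac cs1 cs2 : cs1 ++ cs2 = classes ->
  high (N.+1 - k)%N%:Z (Ev cs1 (pad k (Ev cs2 vac0)) -
    (lone_term + \sum_(c <- cs2) (pad_term (2 * c%:Z) + pad_term (- (2 * c%:Z))))).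
Proof.
have high_vac cs : high 0 (Ev cs vac0) by apply/high_Ev/high_csum/high1.
elim: cs2 cs1 => [|c cs2 IHcs2] cs1.
  rewrite cats0 => ->; rewrite big_nil addr0 /= pad_csum pad1 csum0 add0r dsumE //.
  rewrite low_vac // addr0 sub0r EvD EvN Ev_csum ?classes_range //; last first.
    by rewrite -[0]oppr0 cgN.
  rewrite (clN odd_m) addrAC -/lone_term subrr add0r.
  by apply/highN/high_Ev/high_top/high1.
move=> E; have := IHcs2 (rcons cs1 c); rewrite cat_rcons => /(_ E).
have : (0 < c <= mhalf m)%N.
  by apply: (allP classes_range); rewrite -E mem_cat mem_head orbT.
move=> c_range; have p0 := cg2_neq0 odd_m c_range; set p := 2 * c%:Z in p0 *.
have Np0 : ~~ cg (- p) 0 by rewrite -[0]oppr0 cgN.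
have clp : cl p = c by apply: cl2 => //; case/andP: c_range.
have r1 : rsg p = 1 by apply: rsg2.
have rN1 : rsg (- p) = - 1 by rewrite rsgN // r1.
rewrite big_cons -cats1 Ev_cat /= -/p; set g := Ev cs2 vac0.
have <- := @pad_term_step cs1 cs2 p _ p0; last by rewrite clp.
have <- := @pad_term_step cs1 cs2 (- p) _ Np0; last by rewrite (clN odd_m) clp.
rewrite -/g opprK r1 rN1 scale1r scaleN1r opprK.
set S := \sum_(_ <- _) _ => IH.
have padN u : pad k (- (u : X)) = - pad k u by rewrite -scaleN1r padZ scaleN1r.
have lowN : low (- p) (c_ p g) = - c_ p (low (- p) g).
  rewrite low_csum // opprK [cg p _]cg_sym -[p]add0r.
  have -> : cg (k%:Z + (0 + p)) (0 + p) = false.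
    by rewrite add0r -(negPf k_neq0) /cg addrK subr0.
  by rewrite scale0r sub0r.
have anti : c_ (- p - k%:Z) (c_ p g) = - c_ p (c_ (- p - k%:Z) g).
  by rewrite csum_anti // (negPf p0) andbF.
have -> : pad k (g + xp p g) = pad k g + xp p (pad k g)
    - (c_ (p - k%:Z) (c_ (- p) g) + low p (c_ (- p) g))
    + (c_ (- p - k%:Z) (c_ p g) + low (- p) (c_ p g))
    + (top (p - k%:Z) (c_ (- p) g) + c_ p (top (- p - k%:Z) g)).
  rewrite padD padN !pad_csum !csumD !dsumE // csumB csumD lowN anti !xpE.
  by ring.
rewrite EvD [Ev cs1 (_ + (_ + low (- p) _))]EvD [Ev cs1 (_ - _)]EvD EvN.
set A := Ev cs1 _ in IH *; set B := Ev cs1 _; set C := Ev cs1 (_ + _); set D := Ev cs1 _.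
have -> : A - B + C + D - (lone_term + (- B + C + S)) = A - (lone_term + S) + D by ring.
apply: highD => //; apply: high_Ev; apply: highD.
  by apply/high_top/high_csum/high_vac.
by apply/high_csum/high_top/high_vac.
Qed.

Lemma pair_term_sym r : ~~ cg r 0 -> ~~ cg r k%:Z -> pair_term (k%:Z - r) = - pair_term r.
Proof.
move=> r0 rk; rewrite /pair_term.
have -> : k%:Z - r - k%:Z = - r by rewrite addrAC subrr add0r.
rewrite opprB csum_anti //; last by rewrite -{1}[0]oppr0 cgN (negPf r0).
congr (- c_ _ (c_ _ (Ev _ _))); apply: eq_filter => c.
by rewrite (clN odd_m) clB andbC.
Qed.

(** The two terms carry the same sign, namely that of the residue whose factor
    stands further to the right.  Their vectors are opposite because the two
    letters anticommute, and zero if these have the same residue. *)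
Lemma pad_term_sym r : ~~ cg r 0 -> ~~ cg r k%:Z ->
  pad_term r + pad_term (k%:Z - r) = 0.
Proof.
move=> r0 rk; rewrite /pad_term (negPf rk).
have -> : cg (k%:Z - r) k%:Z = false.
  by rewrite /cg addrAC subrr add0r -(negPf r0) /cg subr0 rpredN.
rewrite subKr pair_term_sym // scalerN opprK.
case: (ltngtP (cl (k%:Z - r)) (cl r)) => [||E]; rewrite ?addNr //.
suff -> : pair_term r = 0 by rewrite !scaler0 oppr0 addr0.
have : cl (k%:Z - r) == cl r by rewrite E.
rewrite (cl_eq odd_m) => /orP[H|H].
  rewrite /pair_term (csum_cg _ _ (q := r - k%:Z) (q' := - r)) ?csum_sq //.
    by rewrite -[0]oppr0 cgN.
  by rewrite -cgN opprK opprB.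
case/negP: k_neq0; move: H; rewrite /cg subr0 opprK.
by rewrite subrK.
Qed.

Lemma pad_term_cg r r' : cg r r' -> pad_term r = pad_term r'.
Proof.
move=> rr; rewrite /pad_term (cg_eql _ rr).
have rrk : cg (k%:Z - r) (k%:Z - r') by rewrite cgB // cg_refl.
have rrk' : cg (r - k%:Z) (r' - k%:Z) by rewrite cgB // cg_refl.
have rrN : cg (- r) (- r') by rewrite cgN.
rewrite (cl_cg rr) (cl_cg rrk) (rsg_cg odd_m rr) (rsg_cg odd_m rrk) /pair_term.
by rewrite (csum_cg _ _ rrk') (csum_cg _ _ rrN) (cl_cg rr) (cl_cg rrk').
Qed.

Lemma sum_pad_term :
  \sum_(c <- classes) (pad_term (2 * c%:Z) + pad_term (- (2 * c%:Z))) = - lone_term.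
Proof.
have m_gt0 : (0 < m)%N by case: (m) odd_m.
rewrite (perm_big _ (_ : perm_eq classes (index_iota 1 (mhalf m).+1))) /=; last first.
  by rewrite /index_iota subn1 perm_rev.
rewrite (sum_residues_sym odd_m pad_term_cg).
(* Adding [lone_term] at the residue [k] makes the terms antisymmetric under
   the reflection exchanging [r] and [k - r], including at [0] and [k]. *)
pose L r : X := if cg r k%:Z then lone_term else 0.
have Lcg a b : cg a b -> L a = L b by move=> ab; rewrite /L (cg_eql _ ab).
have sumL : \sum_(0 <= i < m) L i%:Z = lone_term.
  rewrite -(sum_residues_refl odd_m Lcg k%:Z) big_ltn // subr0 /L cg_refl.
  rewrite big_nat_cond big1 ?addr0 // => i /andP[/andP[i_gt0 lt_im] _].
  case: ifP => //; rewrite /cg addrAC subrr add0r rpredN dvdzE /= => /dvdn_leq.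
  by move/(_ i_gt0); rewrite leqNgt lt_im.
pose G r := (if cg r 0 then 0 else pad_term r) + L r.
have Gcg a b : cg a b -> G a = G b.
  by move=> ab; rewrite /G (Lcg _ _ ab) (cg_eql _ ab) (pad_term_cg ab).
have G0 r : G r + G (k%:Z - r) = 0.
  have kr : cg (k%:Z - r) 0 = cg r k%:Z by rewrite /cg subr0 -opprB rpredN.
  have krk : cg (k%:Z - r) k%:Z = cg r 0.
    by rewrite /cg addrAC subrr add0r subr0 rpredN.
  rewrite /G /L kr krk; case: ifPn => r0.
    have -> : cg r k%:Z = false by rewrite (cg_eql _ r0) cg_sym (negPf k_neq0).
    by rewrite /pad_term krk r0 !add0r addNr.
  case: ifPn => rk; first by rewrite /pad_term rk addNr !add0r.
  by rewrite !addr0 pad_term_sym.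
(* The sum is its own opposite under the reflection of the residues. *)
have sumG : \sum_(0 <= i < m) G i%:Z = 0.
  have : \sum_(0 <= i < m) (G i%:Z + G (k%:Z - i%:Z)) = 0 by apply: big1.
  rewrite big_split /= (sum_residues_refl odd_m Gcg) -mulr2n -scaler_nat => /eqP.
  by rewrite scaler_eq0 => /eqP.
apply/eqP; rewrite -addr_eq0; apply/eqP; rewrite -[RHS]sumG big_split /= sumL.
congr (_ + _); rewrite [RHS]big_ltn // cg_refl add0r. apply: eq_big_nat => i /andP[i_gt0 lt_im].
rewrite ifN //; rewrite cg0 dvdzE /=; apply/negP => /dvdn_leq.
by move/(_ i_gt0); rewrite leqNgt lt_im.
Qed.

Lemma pad_Wop_vac :
  high (N.+1 - k)%N%:Z (pad k (Wop m (win N) classes (1 : X))).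
Proof.
rewrite Wop_vac ?classes_uniq ?classes_range //.
have := @pad_vac [::] classes erefl; rewrite sum_pad_term subrr subr0.
exact.
Qed.

End VacuumPad.

(** * Commutation with the adjoints of power sums *)

Section Commutation.
Variables (X : fock) (m : nat).
Hypothesis odd_m : odd m.
Implicit Types (f g h : X) (c : rat) (a b j p q r : int) (s t J : seq int)
  (mu : seq nat) (N k D : nat).

Notation cg := (cg m).
Notation W N := (Wop m (win N) (classes m)).
Notation A N := (anti m N (classes m)).

Lemma padN k f : pad k (- f) = - pad k f.
Proof. by rewrite -scaleN1r padZ scaleN1r. Qed.

Lemma pad_vops k s f : odd k ->
  pad k (vops s f) = vops s (pad k f) + \sum_(t <- lower k s) vops t f.
Proof.
move=> odd_k; elim: s => [|a s IHs] /=; first by rewrite big_nil addr0.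
rewrite big_cons big_map pad_vop // IHs vopD vop_sum -addrA; congr (_ + _).
by rewrite addrC.
Qed.

(** The lowered letters contribute words of smaller degree to the test words. *)
Lemma high_pad d k f : odd k -> high d f -> high (d - k%:Z) (pad k f).
Proof.
move=> odd_k hf mu s odd_mu lt_d.
have -> : vops s (pad k f) = pad k (vops s f) - \sum_(t <- lower k s) vops t f.
  by rewrite pad_vops // addrK.
rewrite padlD spDr -[padl mu (pad _ _)]/(foldr _ _ _) -foldr_rcons.
rewrite [X in X + _](_ : _ = 0) ?add0r; last first.
  apply: (hf (rcons mu k)); first by rewrite all_rcons odd_k.
  by rewrite -cats1 sumn_cat /= addn0 PoszD; move: lt_d; move: (\sum_(a <- s) a) => u; clear; lia.
rewrite -sumrN padl_sum sp_sumr big1_seq // => t /= ts.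
rewrite -scaleN1r padlZ spZr hf ?mulr0 // (sum_lower ts).
by move: lt_d; move: (\sum_(a <- s) a) => u; clear; lia.
Qed.

(** Both vanish in the limit of an infinite window.  Like [anti], the second
    one only depends on the residue of [j], up to a sign. *)
Definition defect N k f : X := pad k (W N f) - W N (pad k f).

Definition adefect N k j f : X :=
  pad k (A N j f) - A N j (pad k f) - A N (j - k%:Z) f.

Lemma defect_vop N k j f : odd k ->
  defect N k (vop j f) = adefect N k j f - vop j (defect N k f).
Proof.
move=> odd_k; rewrite /defect /adefect /anti !pad_vop // padD vopB !WopD pad_vop //.
by ring.
Qed.

Lemma adefect_shift N k j f : (`|j|%N + k + m <= N)%N ->
  adefect N k (j + m%:Z) f = - adefect N k j f.
Proof.
move=> le_N; rewrite /adefect.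
have -> : j + m%:Z - k%:Z = j - k%:Z + m%:Z by lia.
rewrite !anti_shift ?mem_win //; try by clear -le_N; lia.
by rewrite padN !opprD !opprK.
Qed.

Lemma adefect_shifts N k j M f : (`|j|%N + k + M * m + m <= N)%N ->
  adefect N k (j + M%:Z * m%:Z) f = (-1) ^+ M *: adefect N k j f.
Proof.
elim: M => [|M IHM] le_N; first by rewrite mul0r addr0 scale1r.
have -> : j + M.+1%:Z * m%:Z = j + M%:Z * m%:Z + m%:Z by lia.
rewrite adefect_shift; last by move: le_N; rewrite mulSn; clear; nia.
by rewrite IHM ?exprS ?mulN1r ?scaleNr //; move: le_N; rewrite mulSn; clear; lia.
Qed.

(** By [defect_vop] and [adefect_shifts] the defect on a word starting with [j]
    comes from the defect on the rest of the word, by means of the letter [j]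
    and of a congruent letter [j'] that annihilates the rest. *)
Lemma high_defect k J : odd k -> ~~ cg k%:Z 0 ->
  exists D, forall N, (D <= N)%N -> high (N%:Z - D%:Z) (defect N k (vword X J)).
Proof.
move=> odd_k k0; elim: J => [|j J [D IH]].
  exists k => N le_kN; rewrite /defect [vword X _]/(1 : X) pad1 Wop0 subr0.
  apply: high_le (pad_Wop_vac X odd_m odd_k k0 le_kN).
  by clear -le_kN; lia.
have m_gt0 : (0 < m)%N by case: (m) odd_m.
(* A letter congruent to [j] that annihilates the word. *)
pose M := (\sum_(a <- J) `|a|%N + `|j|%N).+1.
pose j' := j - M%:Z * m%:Z.
have M_j : (`|j|%N < M)%N by rewrite ltnS leq_addl.
have M_J a : a \in J -> (`|a|%N + `|j|%N < M)%N.
  by move=> aJ; rewrite ltnS leq_add2r (big_rem a) //= leq_addr.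
have j'_lt0 : j' < 0 by rewrite /j'; move: M_j m_gt0; clear; nia.
have kill : vop j' (vword X J) = 0.
  apply: vop_vword_neg => //; apply/negP => /M_J.
  by rewrite /j'; move: m_gt0; clear; nia.
exists (D + `|j|%N + `|j'|%N + k + M * m + m)%N => N le_N.
rewrite defect_vop //.
have -> : j = j' + M%:Z * m%:Z by rewrite /j' subrK.
rewrite adefect_shifts; last by move: le_N; clear; lia.
have -> : adefect N k j' (vword X J) = vop j' (defect N k (vword X J)).
  have := defect_vop N j' (vword X J) odd_k; rewrite kill [defect _ _ 0]/defect pad0 Wop0 pad0 subrr.
  by move/eqP; rewrite eq_sym subr_eq0 => /eqP.
have le_D : (D <= N)%N by move: le_N; clear; lia.
have -> : j' + M%:Z * m%:Z = j by rewrite /j' subrK.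
apply: highB; first apply: highZ.
  refine (high_le _ (high_vop (j := j') (IH N le_D))); clear; lia.
refine (high_le _ (high_vop (j := j) (IH N le_D))); clear; lia.
Qed.

Lemma high_padl mu J : all odd mu -> all (fun k : nat => ~~ cg k%:Z 0) mu ->
  exists D, forall N, (D <= N)%N ->
    high (N%:Z - D%:Z) (padl mu (W N (vword X J)) - W N (padl mu (vword X J))).
Proof.
elim: mu => [|k mu IHmu] /=.
  by move=> _ _; exists 0%N => N _; rewrite subrr; apply: high0.
case/andP=> odd_k odd_mu /andP[k0 mu0]; have [D HD] := IHmu odd_mu mu0.
have [D' HD'] : exists D', forall N, (D' <= N)%N ->
    high (N%:Z - D'%:Z) (\sum_(t <- lowers mu J) defect N k (vword X t)).
  elim: (lowers mu J) => [|t T [D1 IH]].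
    by exists 0%N => N _; rewrite big_nil; apply: high0.
  have [D2 H2] := high_defect t odd_k k0; exists (D1 + D2)%N => N le_N.
  rewrite big_cons; apply: highD.
    by apply: high_le (H2 N _); move: le_N; clear; lia.
  by apply: high_le (IH N _); move: le_N; clear; lia.
exists (D + D' + k)%N => N le_N.
have -> : pad k (padl mu (W N (vword X J))) - W N (pad k (padl mu (vword X J))) =
    pad k (padl mu (W N (vword X J)) - W N (padl mu (vword X J)))
    + \sum_(t <- lowers mu J) defect N k (vword X t).
  rewrite padB /defect sumrB -pad_sum -!Wop_sum -pad_sum -padl_vword //.
  by rewrite addrA subrK.
apply: highD.
  by apply: high_le (high_pad odd_k (HD N _)); move: le_N; clear; lia.
by apply: high_le (HD' N _); move: le_N; clear; lia.
Qed.

Lemma sp1_padl_Wop mu J : all odd mu -> all (fun k : nat => ~~ cg k%:Z 0) mu ->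
  exists D, forall N, (D <= N)%N ->
    sp 1 (padl mu (W N (vword X J))) = sp 1 (W N (padl mu (vword X J))).
Proof.
move=> odd_mu mu0; have [D HD] := high_padl J odd_mu mu0.
exists D.+1 => N le_N; apply/eqP; rewrite -subr_eq0 -spBr; apply/eqP.
have := HD N (ltnW le_N) [::] [::] isT; rewrite big_nil [sumn _]/= subrr => -> //.
by move: le_N; clear; lia.
Qed.

End Commutation.

(** * Normal ordering *)

Section NormalOrder.
Variable X : fock.
Implicit Types (f g h : X) (c : rat) (a b : int) (s t : seq int) (l : seq nat).

(** The predicates that contain the span of any set of their elements, used
    instead of spans. *)
Definition lin_closed (Pr : X -> Prop) :=
  Pr 0 /\ forall c f g, Pr f -> Pr g -> Pr (c *: f + g).

Lemma lin_closedZ (Pr : X -> Prop) c f : lin_closed Pr -> Pr f -> Pr (c *: f).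
Proof. by case=> P0 PD Pf; rewrite -[_ *: _]addr0; apply: PD. Qed.

Lemma lin_closedN (Pr : X -> Prop) f : lin_closed Pr -> Pr f -> Pr (- f).
Proof. by move=> linP Pf; rewrite -scaleN1r; apply: lin_closedZ. Qed.

Lemma lin_closed_vop (Pr : X -> Prop) a :
  lin_closed Pr -> lin_closed (fun f => Pr (vop a f)).
Proof.
by case=> P0 PD; split=> [|c f g Pf Pg]; rewrite ?vop0 // vopD vopZ; apply: PD.
Qed.

(** The bound [B] records that a letter moved past the leading one yields words
    to which the leading letter can be prefixed again. *)
Lemma vop_strict_span (Pr : X -> Prop) a l (B : nat) : lin_closed Pr ->
  is_strict l -> all (fun b : nat => b < B)%N l -> a < B%:Z ->
  (forall l', is_strict l' -> (sumn l')%:Z = a + (sumn l)%:Z ->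
     all (fun b : nat => b < B)%N l' -> Pr (vword X (map Posz l'))) ->
  Pr (vop a (vword X (map Posz l))).
Proof.
elim: l => [|b l IHl] in Pr B *.
  move=> linP _ _ lt_aB HP; case: (ltgtP a 0) => [a_lt0|a_gt0|a0].
  - by rewrite [vword _ _]/(1 : X) vop_vac_neg //; case: linP.
  - case: a a_gt0 lt_aB HP => // a a_gt0 lt_aB HP; apply: (HP [:: a]) => //=.
    + by rewrite /is_strict /= inE eq_sym -lt0n.
    + by rewrite andbT.
  - by rewrite a0 [vword _ _]/(1 : X) vop_vac0; apply: (HP [::]); rewrite // a0.
move=> linP; rewrite /is_strict => /andP[/strict_tl[bl sl]].
rewrite in_cons negb_or => /andP[b0 l0] /= /andP[lt_bB lB] lt_aB HP.
have b_gt0 : (0 < b)%N by rewrite lt0n eq_sym.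
case: (ltgtP a b%:Z) => [lt_ab|lt_ba|->].
- have [ab0|ab0] := eqVneq (a + b%:Z) 0.
    have -> : vop a (vop b%:Z (vword X (map Posz l))) = (2 * isg a) *: vword X (map Posz l).
      have := vop_anticomm a b%:Z (vword X (map Posz l)); rewrite ab0 eqxx mulr1 => <-.
      rewrite (_ : vop a (vword _ _) = 0) ?vop0 ?addr0 // vop_vword_neg //; first by move: ab0 b_gt0; clear; lia.
      have -> : - a = b%:Z by move: ab0; clear; lia.
      by apply/negP => /mapP[d /(allP bl) lt_db [bd]]; rewrite bd ltnn in lt_db.
    apply: lin_closedZ => //; apply: HP => //; first by rewrite /is_strict sl l0.
    by rewrite /= PoszD addrA ab0 add0r.
  rewrite vop_swap //; apply: lin_closedN => //.
  apply: (IHl (fun f => Pr (vop b%:Z f)) b) => //; first exact: lin_closed_vop.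
    by rewrite /is_strict sl l0.
  move=> l' /andP[sl' l'0] sum_l' l'b; apply: (HP (b :: l')).
  - rewrite /is_strict in_cons negb_or b0 l'0 /= path_sortedE ?l'b ?sl' //.
    exact: gtn_trans.
  - by rewrite /= !PoszD sum_l' addrCA.
  - by rewrite /= lt_bB; apply: sub_all l'b => d lt_db; apply: ltn_trans lt_bB.
- case: a lt_ba lt_aB HP {IHl} => // a lt_ba lt_aB HP; apply: (HP [:: a, b & l]) => //=.
    rewrite /is_strict !in_cons !negb_or b0 l0 /= path_sortedE ?bl ?sl ?andbT; last first.
      exact: gtn_trans.
    by move: lt_ba; rewrite ltz_nat; clear; case: a => //= a ->.
  by rewrite -ltz_nat lt_aB lt_bB lB.
- by rewrite vop_square; [case: linP|move: b_gt0; clear; lia].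
Qed.

(** By the Clifford relations, words are linear combinations of strict words
    of the same degree. *)
Lemma vword_strict_span (Pr : X -> Prop) t : lin_closed Pr ->
  (forall l, is_strict l -> (sumn l)%:Z = \sum_(a <- t) a -> Pr (vword X (map Posz l))) ->
  Pr (vword X t).
Proof.
elim: t => [|a t IHt] in Pr * => linP HP; first by apply: (HP [::]); rewrite // big_nil.
rewrite vword_cons; apply: (IHt (fun f => Pr (vop a f))); first exact: lin_closed_vop.
move=> l strict_l sum_l; pose B := (\max_(b <- l) b + `|a|%N).+1.
apply: (vop_strict_span (B := B)) => //.
- apply/allP => b bl; rewrite ltnS (@leq_trans (\max_(b <- l) b)) ?leq_addr //.
  exact: leq_bigmax_seq bl isT.
- by rewrite /B; move: (\max_(_ <- _) _)%N; clear; lia.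
- by move=> l' strict_l' sum_l' _; apply: HP; rewrite // sum_l' big_cons sum_l.
Qed.

End NormalOrder.

(** * Evaluation in degree m *)

Section Charge.
Variables (X : fock) (m : nat).
Implicit Types (f g h : X) (c : rat) (a b j p q e : int) (s t : seq int)
  (cs : seq nat).

Notation cg := (cg m).

Variable ch : int -> int.
Hypothesis chN : forall a, ch (- a) = - ch a.
Hypothesis ch_cg : forall a b, cg a b -> ch a = ch b.

(** A functional form of the statement that all the components of [f] have
    charge [e], for the grading in which [vop a] has charge [ch a]. *)
Definition charged e f := forall s, \sum_(a <- s) ch a + e != 0 -> sp 1 (vops s f) = 0.

Lemma charged_vword t : charged (\sum_(a <- t) ch a) (vword X t).
Proof.
move=> s neq; rewrite /vword -vops_cat; apply: (sp1_vword_charge X chN).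
by rewrite big_cat.
Qed.

Lemma charged0 e : charged e 0.
Proof. by move=> s _; rewrite vops0 sp0r. Qed.
Lemma chargedD e f g : charged e f -> charged e g -> charged e (f + g).
Proof. by move=> hf hg s neq; rewrite vopsD spDr hf ?hg ?addr0. Qed.
Lemma chargedZ e c f : charged e f -> charged e (c *: f).
Proof. by move=> hf s neq; rewrite vopsZ spZr hf ?mulr0. Qed.
Lemma chargedN e f : charged e f -> charged e (- f).
Proof. by rewrite -scaleN1r; apply: chargedZ. Qed.
Lemma charged_sum e (I : Type) (r : seq I) (P : pred I) (F : I -> X) :
  (forall i, P i -> charged e (F i)) -> charged e (\sum_(i <- r | P i) F i).
Proof. by apply: big_ind; [exact: charged0|exact: chargedD]. Qed.

Lemma charged_vop a e f : charged e f -> charged (ch a + e) (vop a f).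
Proof.
move=> hf s neq; rewrite -[vop a f]/(vops [:: a] f) -vops_cat; apply: hf.
by rewrite big_cat big_seq1 -addrA.
Qed.

Lemma charged_Wop s cs e f : charged e f -> charged e (Wop m s cs f).
Proof.
have ch0 : ch 0 = 0 by have := chN 0; rewrite oppr0; move: (ch 0) => x; clear; lia.
move=> hf; have : charged e (csum m s 0 f).
  apply: charged_sum => a a0; have := charged_vop (a := a) hf.
  by rewrite (ch_cg a0) ch0 add0r.
rewrite /Wop; elim: cs => //= d cs IHcs /IHcs hU; apply: chargedD => //.
apply: charged_sum => a ap; apply: charged_sum => b bp.
have ab : ch a + ch b = 0 by rewrite (ch_cg ap) (ch_cg bp) chN subrr.
case: ifP => _.
  by have := chargedN (charged_vop (a := a) (charged_vop (a := b) hU)); rewrite addrA ab add0r.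
have := charged_vop (a := b) (charged_vop (a := a) hU).
by rewrite addrA [ch b + _]addrC ab add0r.
Qed.

End Charge.

Section Evaluation.
Variables (X : fock) (m : nat).
Hypothesis odd_m : odd m.
Variable N : nat.
Hypothesis le_mN : (m <= N)%N.
Implicit Types (f g h : X) (c : rat) (a b j p q : int) (s t : seq int)
  (cs : seq nat).

Notation cg := (cg m).
Notation cl := (cl m).
Notation rsg := (rsg m).
Notation W := (Wop m (win N) (classes m)).
Notation U := (Uop m (win N)).
Notation C := (csum m (win N)).

(** A positive letter on the left kills the constant term, which leaves the
    letter [0] of [csum]. *)
Lemma sp1_Wop_vac cs : uniq cs -> in_range m cs -> sp 1 (Wop m (win N) cs (1 : X)) = 1.
Proof.
move=> ucs rcs; rewrite Wop_vac //; elim: cs rcs {ucs} => [|c cs IHcs] /=.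
  move=> _; rewrite /csum big_mkcond pos.unlock /= big_cons cg_refl spDr vop_vac0 sp11.
  rewrite -big_mkcond sp_sumr big_seq_cond big1 ?addr0 // => a /andP[/mapP[u]].
  by rewrite mem_iota => /andP[i_gt0 _] -> _; rewrite sp1_vop_pos.
case/andP=> c_range rcs; rewrite spDr IHcs // [X in _ + X](_ : _ = 0) ?addr0 //.
rewrite /xp -scaleN1r spZr {1}/csum sp_sumr big_seq_cond big1 ?mulr0 // => a.
rewrite mem_pos => /andP[/andP[a_ge0 _] ap]; apply: sp1_vop_pos.
rewrite lt_neqAle a_ge0 andbT eq_sym; apply: contraNneq (cg2_neq0 odd_m c_range).
by move=> a0; rewrite a0 cg_sym in ap.
Qed.

(** The anticommutators of the operator with [m] and with [0] are opposite, and
    the one with [0] acts on the vacuum as multiplication by [2] as far as the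
    constant term is concerned. *)
Lemma sp1_W_row : sp 1 (W (vword X [:: m%:Z])) = - 2.
Proof.
have m_gt0 : (0 < m)%N by case: (m) odd_m.
have := anti_shift odd_m (N := N) (classes m) (j := 0) (1 : X).
rewrite !mem_win add0r => /(_ _ _)/(congr1 (sp 1)).
rewrite -[- anti _ _ _ _ _]scaleN1r spZr !spDr sp1_vop_pos ?ltz_nat // addr0.
rewrite vop_vac0 sp1_vop0 sp1_Wop_vac ?classes_uniq ?classes_range //.
by move=> -> //; move: le_mN; clear; lia.
Qed.

Lemma Uop_vop_cl cs j f : ~~ cg j 0 -> in_range m cs -> cl j \notin cs ->
  U cs (vop j f) = vop j (U cs f).
Proof.
move=> j0 rcs jcs; apply: Uop_vop; first exact: win_uniq.
apply/allP => c ccs; have /andP[_ le_c] := allP rcs _ ccs.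
have ne p : cl p = c -> cg (- j) p = false.
  by move=> clp; apply: contraNF jcs => /cl_cg; rewrite (clN odd_m) clp => ->.
by rewrite /contr !ne ?andbF ?eqxx ?(clN odd_m) ?cl2.
Qed.

Lemma rsg_small (a : nat) : (0 < a < m)%N -> rsg a%:Z = isg a%:Z.
Proof.
case/andP=> a_gt0 lt_am; rewrite (rsg_mod odd_m) ?modz_small //.
by rewrite cg0 dvdzE /=; apply/negP => /(dvdn_leq a_gt0); rewrite leqNgt lt_am.
Qed.

(** The positive letters [a] and [b], moved to the left, do not contribute.
    There remains the contraction of [a] with the factor of its class, which
    leaves a letter of the residue of [a], contracted in turn with [b]. *)
Lemma sp1_W_pair (a b : nat) : (0 < b)%N -> (b < a)%N -> (a + b)%N = m ->
  sp 1 (W (vword X [:: a%:Z; b%:Z])) = - 4 * isg b%:Z.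
Proof.
move=> b_gt0 lt_ba abm; have a_gt0 := ltn_trans b_gt0 lt_ba.
have ba : cg (- b%:Z) a%:Z by rewrite /cg -opprD rpredN -PoszD addnC abm dvdzz.
have ab : cg (- a%:Z) b%:Z by rewrite -cgN opprK cg_sym.
have a0 : ~~ cg a%:Z 0.
  by rewrite cg0 dvdzE /=; apply/negP => /(dvdn_leq a_gt0); move: abm b_gt0; clear; lia.
have b0 : ~~ cg b%:Z 0.
  by rewrite cg0 dvdzE /=; apply/negP => /(dvdn_leq b_gt0); move: abm a_gt0; clear; lia.
have clab : cl a%:Z = cl b%:Z by rewrite -(cl_cg ba) (clN odd_m).
have a_win : - a%:Z \in win N by rewrite winN mem_win; move: le_mN abm; clear; lia.
have b_win : - b%:Z \in win N by rewrite winN mem_win; move: le_mN abm; clear; lia.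
have sa : rsg a%:Z * isg a%:Z = 1.
  by rewrite rsg_small ?isgK //; move: a_gt0 b_gt0 abm; clear; lia.
have [cs1 [cs2 E]] : exists cs1 cs2, classes m = cs1 ++ cl a%:Z :: cs2.
  have : cl a%:Z \in classes m by rewrite mem_classes (cl_pos odd_m) ?(cl_le odd_m).
  by case/splitPr => cs1 cs2; exists cs1, cs2.
have /and3P[r1 c_range r2] : [&& in_range m cs1, (0 < cl a%:Z <= mhalf m)%N & in_range m cs2].
  by have := classes_range m; rewrite E /in_range all_cat.
have /and4P[u1 /norP[c_cs1 cs12] c_cs2 u2] : [&& uniq cs1, ~~ has [in cs1] (cl a%:Z :: cs2),
    cl a%:Z \notin cs2 & uniq cs2].
  by have := classes_uniq m; rewrite E cat_uniq.
set p := 2 * (cl a%:Z)%:Z.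
have us := win_uniq N.
have anti0 j (f : X) : ~~ cg j 0 -> C 0 (vop j f) = - vop j (C 0 f).
  move=> j0; rewrite csum_vop // /contr; case: ifP => [/andP[_]|_].
    by rewrite -[X in cg _ X]oppr0 cgN (negPf j0).
  by rewrite scale0r sub0r.
set Y := Wop m (win N) cs2 (1 : X); set V := Wop m (win N) cs2 (vop b%:Z (1 : X)).
have VE : V = - vop b%:Z Y.
  by rewrite /V /Wop anti0 // UopN Uop_vop_cl // -clab.
have K : contr m (win N) p a%:Z *: C (- p) V - contr m (win N) (- p) a%:Z *: C p V =
    - (2 *: C a%:Z V).
  have ra : rsg a%:Z = isg a%:Z by rewrite rsg_small //; move: a_gt0 b_gt0 abm; clear; lia.
  have p0 : ~~ cg p 0 by apply: cg2_neq0.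
  have rp : rsg p = 1 by apply: rsg2.
  have pNp : cg p (- p) = false by rewrite (cg_opp odd_m) (negPf p0).
  rewrite /contr a_win /= cgN -[cg (- _) p]cgN opprK.
  case/orP: (clP odd_m a%:Z); rewrite -/p => ap.
    rewrite !(cg_eql _ ap) cg_refl pNp scale0r sub0r -ra (rsg_cg odd_m ap) rp mulr1.
    by rewrite (csum_cg _ _ ap).
  rewrite !(cg_eql _ ap) cg_refl -[cg (- p) p]cgN opprK pNp scale0r subr0 -ra.
  rewrite (rsg_cg odd_m ap) (rsgN odd_m) // rp mulrN1 scaleNr.
  by rewrite (csum_cg _ _ ap).
have CV : C a%:Z V = - ((2 * isg b%:Z) *: Y) + vop b%:Z (C a%:Z Y).
  rewrite VE csumN csum_vop // /contr b_win ba.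
  by rewrite opprB addrC.
rewrite !vword_cons [vword _ _]/(1 : X) /Wop E Uop_cat /= anti0 // UopN.
rewrite Uop_vop_cl // -/(Wop _ _ _ _) -/V -/p xopN xop_vop // K.
rewrite -opprD UopN addrA -vopD UopB (Uop_vop_cl _ a0) //.
rewrite UopZ CV [U cs1 (- _ + _)]UopD UopN UopZ (Uop_vop_cl _ b0) -?clab //.
rewrite -scaleN1r spZr spBr sp1_vop_pos ?ltz_nat // spZr spDr.
rewrite (sp1_vop_pos _ (a := b%:Z)) ?ltz_nat // -scaleN1r !spZr.
have -> : sp 1 (U cs1 Y) = 1.
  rewrite /Y /Wop -Uop_cat; apply: sp1_Wop_vac.
    rewrite cat_uniq u1 u2 andbT; apply/hasPn => x x2.
    by apply: contraL cs12 => x1; rewrite negbK; apply/hasP; exists x.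
  by rewrite /in_range all_cat; apply/andP; split.
by ring.
Qed.

(** No other letter is congruent to [a] or to [- a], so the charge that counts
    these letters is nonzero. *)
Lemma sp1_W_long (a b c : nat) (l : seq nat) : is_strict [:: a, b, c & l] ->
  sumn [:: a, b, c & l] = m -> sp 1 (W (vword X (map Posz [:: a, b, c & l]))) = 0.
Proof.
set r := [:: b, c & l] => /andP[/strict_tl[ra _]].
rewrite in_cons negb_or => /andP[a_neq0 r0] sum_m.
have a_gt0 : (0 < a)%N by rewrite lt0n eq_sym.
have [b_gt0 c_gt0] : (0 < b)%N /\ (0 < c)%N.
  by move: r0; rewrite !in_cons !negb_or !lt0n ![0%N == _]eq_sym => /and3P[-> ->].
pose ch (x : int) : int := (cg x a%:Z)%:Z - (cg x (- a%:Z))%:Z.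
have chN x : ch (- x) = - ch x.
  by rewrite /ch cgN -[cg (- x) a%:Z]cgN opprK opprB.
have ch_cg x y : cg x y -> ch x = ch y by move=> xy; rewrite /ch !(cg_eql _ xy).
have ch_a : ch a%:Z = 1.
  rewrite /ch cg_refl (cg_opp odd_m) cg0 dvdzE /=.
  case: dvdnP => // -[[|q] aE]; first by rewrite aE in a_gt0.
  by move: sum_m aE c_gt0 b_gt0; rewrite /= mulSn; clear; nia.
have ch_r : \sum_(x <- map Posz r) ch x = 0.
  rewrite big_map big1_seq // => d /= dr; have lt_da := allP ra _ dr.
  have d_gt0 : (0 < d)%N by rewrite lt0n; apply: contraNneq r0 => <-.
  have sum_r : (a + d < m)%N.
    rewrite -sum_m /= ltn_add2l; move: dr; rewrite !in_cons => /or3P[/eqP->|/eqP->|dl].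
    - by move: c_gt0; clear; lia.
    - by move: b_gt0; clear; lia.
    have : (d <= sumn l)%N by rewrite sumnE (big_rem d) //= leq_addr.
    by move: c_gt0; clear; lia.
  rewrite /ch.
  have -> : cg d%:Z a%:Z = false.
    by apply/negP => /cg_small H; move: lt_da; rewrite -(eqP (_ : a == d)) ?ltnn // -eqz_nat -H //; move: sum_r; clear; lia.
  have -> : cg d%:Z (- a%:Z) = false.
    by rewrite /cg opprK dvdzE /=; apply/negP => /dvdn_leq; move: sum_r d_gt0; clear; lia.
  by [].
have := charged_Wop chN ch_cg (win N) (classes m) (@charged_vword X ch chN (map Posz (a :: r))).
by move=> /(_ [::]); rewrite big_nil add0r [map _ _]/= big_cons ch_r addr0 ch_a; apply.
Qed.

Lemma sp1_W t : \sum_(a <- t) a = m%:Z ->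
  sp 1 (W (vword X t)) = - 2 * sp 1 (pad m (vword X t)).
Proof.
move=> sum_t; pose Pr f := sp 1 (W f) = - 2 * sp 1 (pad m f).
have linP : lin_closed Pr.
  split=> [|c f g Pf Pg]; first by rewrite /Pr Wop0 pad0 sp0r mulr0.
  by rewrite /Pr WopD WopZ padD padZ !spDr !spZr Pf Pg mulrDr mulrCA.
apply: (vword_strict_span linP) => l strict_l; rewrite sum_t => -[sum_l] {t sum_t}.
have m_gt0 : (0 < m)%N by case: (m) odd_m.
case: l => [|a [|b [|c l]]] in strict_l sum_l *.
- by rewrite -sum_l in m_gt0.
- rewrite /= addn0 in sum_l; rewrite sum_l /Pr sp1_W_row vword_cons pad_vop // pad1.
  by rewrite vop0 add0r subrr vop_vac0 sp11 mulr1.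
- case/andP: strict_l => /= /andP[lt_ba _]; rewrite !in_cons !negb_or => /and3P[_ b0 _].
  have b_gt0 : (0 < b)%N by rewrite lt0n eq_sym.
  rewrite /= addn0 in sum_l; rewrite /Pr sp1_W_pair //.
  rewrite !pad_vop // pad1 vop0 add0r.
  have -> : a%:Z - m%:Z = - b%:Z by rewrite -sum_l PoszD; clear; lia.
  have -> : b%:Z - m%:Z = - a%:Z by rewrite -sum_l PoszD; clear; lia.
  rewrite [vop (- a%:Z) 1]vop_vac_neg; last by move: lt_ba; clear; lia.
  have /eqP := vop_anticomm (- b%:Z) b%:Z (1 : X).
  rewrite addNr eqxx mulr1 isgN [vop (- b%:Z) 1]vop_vac_neg ?vop0 ?addr0 ?add0r; last first.
    by move: b_gt0; clear; lia.
  by move=> /eqP ->; rewrite spZr sp11; ring.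
rewrite /Pr sp1_W_long // vword_cons pad_vop //.
case/andP: strict_l => /strict_tl[_ _]; rewrite !in_cons !negb_or => /and4P[a0 b0 c0 _].
rewrite spDr sp1_vop_pos; last by rewrite ltz_nat lt0n eq_sym.
rewrite vop_vword_neg ?sp0r ?addr0 ?mulr0 //.
  by rewrite -sum_l /= !PoszD; move: b0; clear; lia.
have -> : - (a%:Z - m%:Z) = (sumn [:: b, c & l])%:Z.
  by rewrite -sum_l /= !PoszD; clear; lia.
rewrite -[X in _ \notin X]/(map Posz [:: b, c & l]); apply/negP => /mapP[d + [dE]]; rewrite !in_cons => /or3P[/eqP dd|/eqP dd|dl].
- by move: dE b0 c0; rewrite dd /=; clear; lia.
- by move: dE b0 c0; rewrite dd /=; clear; lia.
have : (d <= sumn l)%N by rewrite sumnE (big_rem d) //= leq_addr.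
by move: dE b0 c0; rewrite /=; clear; lia.
Qed.

End Evaluation.

Theorem sp1_padl_W (X : fock) (m : nat) (odd_m : odd m) (mu : seq nat) (J : seq int) :
  all odd mu -> all (fun r => ~~ (m %| r)%N) mu ->
  \sum_(a <- J) a = (sumn mu + m)%N%:Z ->
  exists D, forall N, (D <= N)%N ->
    sp 1 (padl mu (Wop m (win N) (classes m) (vword X J))) =
    - 2 * sp 1 (padl (m :: mu) (vword X J)).
Proof.
move=> odd_mu mu0 sum_J.
have mu0' : all (fun k : nat => ~~ cg m k%:Z 0) mu.
  by apply: sub_all mu0 => k; rewrite cg0 dvdzE.
have [D HD] := sp1_padl_Wop X odd_m J odd_mu mu0'.
exists (D + m)%N => N le_N; rewrite HD; last by move: le_N; clear; lia.
rewrite /= padl_vword // Wop_sum pad_sum !sp_sumr mulr_sumr.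
apply: eq_big_seq => t tJ; apply: sp1_W => //; first by move: le_N; clear; lia.
by rewrite (sum_lowers tJ) sum_J PoszD addrC addrA addNr add0r.
Qed.

(** * The ring generated by the q_n *)

Section Gamma.
Variable X : fock.
Implicit Types (f g h : X) (c : rat).

(** The rational span of the ring generated by the [qn]. *)
Inductive Gam : X -> Prop :=
| Gam_qn n : Gam (qn X n)
| GamD f g : Gam f -> Gam g -> Gam (f + g)
| GamM f g : Gam f -> Gam g -> Gam (f * g)
| GamZ c f : Gam f -> Gam (c *: f).

Lemma Gam0 : Gam 0.
Proof. by rewrite -(scale0r (qn X 0)); apply/GamZ/Gam_qn. Qed.

Lemma GamB f g : Gam f -> Gam g -> Gam (f - g).
Proof. by move=> hf hg; rewrite -scaleN1r; apply: GamD => //; apply: GamZ. Qed.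

Lemma Gam_sum (I : Type) (r : seq I) (Pr : pred I) (F : I -> X) :
  (forall i, Pr i -> Gam (F i)) -> Gam (\sum_(i <- r | Pr i) F i).
Proof. by apply: big_ind; [exact: Gam0|exact: GamD]. Qed.

Lemma Gam_qz z : Gam (qz X z).
Proof. by case: z => n; [exact: Gam_qn|exact: Gam0]. Qed.

Lemma Gam_pw j : odd j.+1 -> Gam (pw X j.+1).
Proof.
have [n] := ubnP j; elim: n j => [//|n IHn] j lt_j /= odd_j.
have := qn_rec X j; rewrite big_mkcond big_ord_recr /= subnn qn0 mulr1 odd_j.
move=> /eqP; rewrite addrC -subr_eq => /eqP E.
have -> : pw X j.+1 = 2^-1 *: (2 *: pw X j.+1) by rewrite scalerA mulVf ?scale1r.
rewrite -E; apply: GamZ; apply: GamB; first by apply/GamZ/Gam_qn.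
apply: Gam_sum => i _.
case: ifP => odd_i; last exact: Gam0.
apply/GamZ/GamM; last exact: Gam_qn.
by apply: IHn => //; have := ltn_ord i; lia.
Qed.

Lemma Gam_pad k f : (0 < k)%N -> Gam f -> Gam (pad k f).
Proof.
move=> k_gt0; elim=> {f} [n|f g _ hf _ hg|f g Gf hf Gg hg|c f _ hf].
- rewrite -[qn X n]/(qz X n%:Z) pad_qz //.
  by case: ifP => _; [exact: Gam_qz|exact: Gam0].
- by rewrite padD; apply: GamD.
- by rewrite padM //; apply: GamD; apply: GamM.
- by rewrite padZ; apply: GamZ.
Qed.

Lemma Gam_qad n f : Gam f -> Gam (qad n f).
Proof.
move=> Gf; elim: Gf n => {f} [m|f g _ hf _ hg|f g Gf hf Gg hg|c f _ hf] n.
- by rewrite -[qn X m]/(qz X m%:Z) qad_qz; apply/GamZ/Gam_qz.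
- by rewrite qadD; apply: GamD.
- by rewrite qadM; apply: Gam_sum => i _; apply: GamM.
- by rewrite qadZ; apply: GamZ.
Qed.

End Gamma.

(** * Schur Q-functions *)

Definition vspart (X : fock) (l : spart) : X := vword X (map Posz l).

Lemma spartP (l : spart) : sorted gtn l /\ 0%N \notin (l : seq nat).
Proof. by case: l => l /= /andP[]. Qed.

Lemma sp_vspart (X : fock) (l l' : spart) :
  sp (vspart X l) (vspart X l') = (l == l')%:R * 2 ^+ size l.
Proof.
have [sl l0] := spartP l; have [sl' l0'] := spartP l'.
by rewrite /vspart sp_vword_strict.
Qed.

Section SchurQ.
Variable X : fock.
Implicit Types (f g h : X) (c : rat) (l : spart).
Variables (Q : spart -> X) (ip : X -> X -> rat) (perp : X -> X -> X).
Variable hom : nat -> X -> Prop.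

Definition span (c : {malg rat[spart]}) : X := \sum_(l <- msupp c) c@_l *: Q l.

Hypothesis hom_sp : forall d e f g, d != e -> hom d f -> hom e g -> sp f g = 0.
Hypothesis hom_qnM : forall n d f, hom d f -> hom (n + d) (qn X n * f).
Hypothesis Q_hom : forall l, hom (sumn l) (Q l).
Hypothesis Q_Gam : forall l, Gam (Q l).
Hypothesis Q_span : forall f, Gam f -> exists e : {malg rat[spart]}, f = span e.
Hypothesis ipC : forall f g, Gam f -> Gam g -> ip f g = ip g f.
Hypothesis ip_lin : forall c f g h, Gam f -> Gam g -> Gam h ->
  ip (c *: f + g) h = c * ip f h + ip g h.
Hypothesis ip_Q : forall l l', ip (Q l) (Q l') = (l == l')%:R * 2 ^+ size l.
Hypothesis perp_Gam : forall f g, Gam f -> Gam g -> Gam (perp f g).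
Hypothesis perp_adj : forall f g h, Gam f -> Gam g -> Gam h ->
  ip (perp f g) h = ip g (f * h).
Hypothesis Q0 : forall l, spart_seq l = [::] -> Q l = 1.
Hypothesis Q_rec : forall l (l' : spart) a, spart_seq l = a :: l' ->
  (forall i, perp (qn X i) (Q l') = qad i (Q l')) -> Q l = vop a%:Z (Q l').

Lemma ip_span (c : {malg rat[spart]}) l : ip (span c) (Q l) = c@_l * 2 ^+ size l.
Proof.
have ip0 : ip 0 (Q l) = 0.
  have := ip_lin (- 1) (Gam0 X) (Gam0 X) (Q_Gam l).
  by rewrite scaler0 addr0 mulN1r addNr.
rewrite /span; have -> : forall r : seq spart,
    ip (\sum_(l0 <- r) c@_l0 *: Q l0) (Q l) = \sum_(l0 <- r) c@_l0 * ip (Q l0) (Q l).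
  elim=> [|l0 r IHr]; first by rewrite !big_nil.
  rewrite !big_cons ip_lin ?IHr //.
  by apply: Gam_sum => l1 _; apply: GamZ.
have [lc|lc] := boolP (l \in msupp c); last first.
  rewrite (mcoeff_outdom lc) mul0r big1_seq // => l0 /= l0c.
  rewrite ip_Q; case: eqP => [l0l|_]; last by rewrite mul0r mulr0.
  by rewrite -l0l l0c in lc.
rewrite (big_fsetD1 l) //= ip_Q eqxx mul1r big1_seq ?addr0 //.
move=> l0; rewrite in_fsetD1 => /andP[_ /andP[/negPf l0l _]].
by rewrite ip_Q l0l mul0r mulr0.
Qed.

Lemma sp_span (c : {malg rat[spart]}) l :
  (forall l0, l0 \in msupp c -> sp (Q l0) (Q l) = (l0 == l)%:R * 2 ^+ size l) ->
  sp (span c) (Q l) = c@_l * 2 ^+ size l.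
Proof.
move=> H; rewrite /span sp_suml; have [lc|lc] := boolP (l \in msupp c); last first.
  rewrite (mcoeff_outdom lc) mul0r big1_seq // => l0 /= l0c.
  rewrite spZl H //; case: eqP => [l0l|_]; last by rewrite mul0r mulr0.
  by rewrite -l0l l0c in lc.
rewrite (big_fsetD1 l) //= spZl H // eqxx mul1r big1_seq ?addr0 //.
move=> l0; rewrite in_fsetD1 => /andP[_ /andP[/negPf l0l l0c]].
by rewrite spZl H // l0l mul0r mulr0.
Qed.

Lemma sp_ext_Gam f g : Gam f -> Gam g ->
  (forall l, sp (Q l) f = sp (Q l) g) -> f = g.
Proof.
move=> Gf Gg H; apply/eqP; rewrite -subr_eq0; apply/eqP/sp_def.
have [c E] := Q_span (GamB Gf Gg).
rewrite {1}E /span sp_suml big1 // => l _.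
by rewrite spZl spBr H subrr mulr0.
Qed.

(** Both sides have the same pairing with every [Q r].  If the size of [r] is at
    most [d], the two forms agree on [Q r]; if it is larger, both pairings
    vanish for reasons of degree. *)
Lemma perp_qn d : (forall l, (sumn l <= d)%N -> Q l = vspart X l) ->
  forall l i, (sumn l <= d)%N -> perp (qn X i) (Q l) = qad i (Q l).
Proof.
move=> std l i le_ld.
have spQ l1 l2 : (sumn l1 <= d)%N -> sp (Q l2) (Q l1) = (l2 == l1)%:R * 2 ^+ size l1.
  move=> le_l1; have [e12|n12] := eqVneq (sumn l2) (sumn l1).
    rewrite !std ?e12 // sp_vspart; case: eqP => [->|]; rewrite ?mul0r //.
  rewrite (hom_sp n12) //; case: eqP => [l21|_]; last by rewrite mul0r.
  by rewrite l21 eqxx in n12.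
have [e E] := Q_span (perp_Gam (Gam_qn X i) (Q_Gam l)).
have eE r : e@_r * 2 ^+ size r = sp (Q r) (qad i (Q l)).
  rewrite -ip_span -E perp_adj ?Q_Gam //; last exact: Gam_qn.
  rewrite ipC ?Q_Gam //; last by apply: GamM; [exact: Gam_qn|exact: Q_Gam].
  rewrite spC sp_qadl spC.
  have [c ->] := Q_span (GamM (Gam_qn X i) (Q_Gam r)).
  by rewrite ip_span sp_span // => l0 _; apply: spQ.
have e0 (r : spart) : (d < sumn r)%N -> e@_r = 0.
  move=> lt_dr; have := eE r; rewrite spC sp_qadl spC (hom_sp (d := i + sumn r) (e := sumn l)).
  - move=> /eqP; rewrite mulf_eq0 => /orP[/eqP //|].
    by rewrite expf_eq0 andbC.
  - by have := leq_trans le_ld (ltnW lt_dr); lia.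
  - exact: hom_qnM.
  - exact: Q_hom.
apply: sp_ext_Gam => [||r]; first exact: perp_Gam (Gam_qn X i) (Q_Gam l).
  exact/Gam_qad/Q_Gam.
case: (leqP (sumn r) d) => [le_rd|lt_dr].
  by rewrite E spC sp_span => [|l0 _]; [exact: eE|exact: spQ].
rewrite -eE e0 // mul0r E /span sp_sumr big1 // => l0 _; rewrite spZr.
case: (leqP (sumn l0) d) => [le_l0|lt_l0]; last by rewrite e0 ?mul0r.
rewrite (hom_sp (d := sumn r) (e := sumn l0)) ?mulr0 //.
by rewrite gtn_eqF // (leq_ltn_trans le_l0).
Qed.

(** Induction on the size: the recursion for [Q l] only involves [perp] on the
    smaller partition, where [perp_qn] applies. *)
Theorem schurQE l : Q l = vspart X l.
Proof.
suff H d : forall l, (sumn l <= d)%N -> Q l = vspart X l by exact: (H (sumn l)).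
elim: d => {l} [|d IHd] l le_ld.
  have l0 : spart_seq l = [::].
    by case: l le_ld => -[//|[|a] l] //=; rewrite /is_strict in_cons eqxx andbF.
  by rewrite Q0 // /vspart l0.
case lE: (spart_seq l) => [|a l'].
  by rewrite Q0 // /vspart lE.
have := spartP l; rewrite lE => -[/strict_tl[_ sl']].
rewrite in_cons negb_or => /andP[a0 l'0].
have sl : is_strict l' by rewrite /is_strict sl' l'0.
have le_l'd : (sumn (SPart sl) <= d)%N.
  by move: le_ld; rewrite lE /=; lia.
rewrite (Q_rec (l' := SPart sl) lE); last by move=> i; apply: perp_qn IHd _ _ _.
by rewrite (IHd (SPart sl)) // /vspart lE.
Qed.

(** Both forms have the same values on the basis of the [Q l]. *)
Lemma ip_sp f g : Gam f -> Gam g -> ip f g = sp f g.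
Proof.
move=> Gf Gg.
have [c fE] := Q_span Gf.
have H l : ip f (Q l) = sp f (Q l).
  rewrite fE ip_span sp_span // => l0 _.
  by rewrite !schurQE sp_vspart; case: eqP => [->|_]; rewrite ?mul0r.
rewrite ipC //; have [e ->] := Q_span Gg.
rewrite [RHS]spC /span; elim: (msupp e : seq spart) => [|l r IHr].
  rewrite !big_nil sp0l; have := ip_lin (- 1) (Gam0 X) (Gam0 X) Gf.
  by rewrite scaler0 addr0 mulN1r addNr.
rewrite !big_cons ip_lin // ?IHr ?spDl ?spZl //; last first.
  by apply: Gam_sum => l1 _; apply: GamZ.
by rewrite ipC // H spC.
Qed.

Theorem perp_pw k f : odd k -> Gam f -> perp (pw X k) f = pad k f.
Proof.
case: k => // k odd_k Gf; have Gp := Gam_pw X odd_k.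
apply: sp_ext_Gam => [||l]; first exact: perp_Gam.
  exact: Gam_pad.
rewrite spC -ip_sp // ?perp_adj //; last exact: perp_Gam.
by rewrite ip_sp //; [rewrite spC sp_pwM | exact: GamM].
Qed.

Theorem perp_pwl (mu : seq nat) l : all odd mu ->
  foldr (fun r f => perp (pw X r) f) (Q l) mu = padl mu (vspart X l) /\
  Gam (padl mu (vspart X l)).
Proof.
elim: mu => [_|k mu IHmu /= /andP[odd_k /IHmu[-> G]]].
  by rewrite -schurQE; split; last exact: Q_Gam.
rewrite perp_pw //; split => //.
by apply: Gam_pad; case: (k) odd_k.
Qed.

End SchurQ.

Local Open Scope fset_scope.
Local Open Scope ring_scope.

(** * Linear extension *)

Section LinearExtension.
Variables (K : choiceType) (R : comNzRingType) (V : lmodType R).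

Definition linext (phi : K -> V) (f : {malg R[K]}) : V :=
  \sum_(x <- msupp f) f@_x *: phi x.

Lemma linextEw (phi : K -> V) (d : {fset K}) f :
  msupp f `<=` d -> linext phi f = \sum_(x <- d) f@_x *: phi x.
Proof.
move=> sfd; rewrite /linext; apply: big_fset_incl => // x _ xf.
by rewrite mcoeff_outdom // scale0r.
Qed.

Fact linext_is_linear phi : linear (linext phi).
Proof.
move=> c f g; set d := msupp f `|` msupp g.
have sf : msupp f `<=` d by apply: fsubsetUl.
have sg : msupp g `<=` d by apply: fsubsetUr.
rewrite (linextEw _ (d := d)); last first.
  apply: fsubset_trans (msuppD_le _ _) _; apply: fsetUSS => //.
  exact: msuppZ_le.
rewrite (linextEw _ sf) (linextEw _ sg) scaler_sumr -big_split /=.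
by apply: eq_bigr => x _; rewrite mcoeffD mcoeffZ scalerDl scalerA.
Qed.

HB.instance Definition _ phi :=
  GRing.isLinear.Build R {malg R[K]} V _ (linext phi) (linext_is_linear phi).

Lemma linextU phi c x : linext phi << c *g x >> = c *: phi x.
Proof.
rewrite (linextEw _ (d := [fset x])) ?msuppU_le // big_seq_fset1.
by rewrite mcoeffUU.
Qed.

End LinearExtension.

(** * Generation by power sums *)

Lemma big_cmonom (S : Type) (idx : S) (op : Monoid.com_law idx)
    (F : nat -> nat -> S) (x : {cmonom nat}) (d : {fset nat}) :
  (forall i, F i 0%N = idx) -> finsupp x `<=` d ->
  \big[op/idx]_(i <- finsupp x) F i (x i) = \big[op/idx]_(i <- d) F i (x i).
Proof.
move=> F0 sxd; apply: big_fset_incl => // i _.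
by rewrite -cmE_eq0 => /eqP ->.
Qed.

Lemma malgU_Z (K : choiceType) (R : ringType) (c : R) (x : K) :
  << c *g x >> = c *: (<< x >> : {malg R[K]}).
Proof. by apply/malgP => y; rewrite mcoeffZ !mcoeffU mulrnAr mulr1. Qed.

HB.lock Definition mono (x : {cmonom nat}) : Lam := << x >>.

Lemma psumE j : psum j.+1 = mono (ucm j).
Proof. by rewrite mono.unlock. Qed.

Lemma mono1 : mono mone = 1. Proof. by rewrite mono.unlock. Qed.

Lemma monoM (x y : {cmonom nat}) : mono x * mono y = mono (mmul x y).
Proof. by rewrite mono.unlock malgM_def fgmulUU mulr1. Qed.

Lemma mcoeff_mono x y : (mono x)@_y = (x == y)%:R.
Proof. by rewrite mono.unlock mcoeffU1. Qed.

Lemma monoE (f : Lam) : f = \sum_(x <- msupp f) f@_x *: mono x.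
Proof.
rewrite {1}(monalgE f); apply: eq_bigr => x _.
by rewrite mono.unlock -malgU_Z.
Qed.

Lemma linext_mono (V : lmodType rat) (phi : {cmonom nat} -> V) x :
  linext phi (mono x) = phi x.
Proof. by rewrite mono.unlock linextU scale1r. Qed.

(** Monomials are products of power sums. *)
Lemma Lam_ind (Pr : Lam -> Prop) :
    Pr 1 -> (forall f g : Lam, Pr f -> Pr g -> Pr (f + g)) ->
    (forall (c : rat) (f : Lam), Pr f -> Pr (c *: f)) ->
    (forall j (f : Lam), Pr f -> Pr (psum j.+1 * f)) ->
  forall f, Pr f.
Proof.
move=> P1 PD PZ Pp f; rewrite (monoE f).
have P0 : Pr 0 by rewrite -(scale0r 1); apply: PZ.
apply: (big_ind Pr P0 PD) => x _.
apply: PZ.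
have [n] := ubnP (mdeg x); elim: n x => [|n IHn] x lt_x_n; first by clear -lt_x_n.
have [-> | x1] := eqVneq x mone; first by rewrite mono1; exact: P1.
have /fset0Pn[j jx] : finsupp x != fset0.
  apply: contraNneq x1 => x0; rewrite -mdeg_eq0 mdegE x0.
  by rewrite big_seq_fset0.
pose y := divcm x (ucm j).
have xE : x = mmul (ucm j) y.
  apply/eqP/cmP => i; rewrite cmM divcmE ucmE subnKC //.
  by case: eqP => // <-; rewrite lt0n cmE_neq0.
move: lt_x_n; rewrite xE mdegM mdegU ltnS => ly; rewrite -monoM -psumE.
by apply: Pp; apply: IHn.
Qed.

Lemma mcoeff_sum (K : choiceType) (G : zmodType) (I : Type) (r : seq I)
    (Pr : pred I) (F : I -> {malg G[K]}) y :
  (\sum_(i <- r | Pr i) F i)@_y = \sum_(i <- r | Pr i) (F i)@_y.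
Proof. exact: (raddf_sum (mcoeff y)). Qed.

Definition padj_mon (k : nat) (x : {cmonom nat}) : Lam :=
  ((k%:R / 2) * (x k.-1)%:R) *: mono (divcm x (ucm k.-1)).

(** The operator (k / 2) d/dp_k. *)
HB.lock Definition padj (k : nat) (f : Lam) : Lam := linext (padj_mon k) f.

Fact padj_is_linear k : linear (padj k).
Proof. by move=> c f g; rewrite padj.unlock linearP. Qed.

HB.instance Definition _ k :=
  GRing.isLinear.Build rat Lam Lam _ (padj k) (padj_is_linear k).

Lemma padjD k (f g : Lam) : padj k (f + g) = padj k f + padj k g.
Proof. exact: linearD. Qed.

Lemma padjZ k (c : rat) (f : Lam) : padj k (c *: f) = c *: padj k f.
Proof. exact: linearZ. Qed.

Lemma padj0 k : padj k 0 = 0.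
Proof. exact: linear0. Qed.

Lemma padjU k x : padj k (mono x) = padj_mon k x.
Proof. by rewrite padj.unlock linext_mono. Qed.

Lemma divcmK (x : {cmonom nat}) j :
  x j != 0%N -> mmul (ucm j) (divcm x (ucm j)) = x.
Proof.
move=> xj; apply/eqP/cmP => i; rewrite cmM divcmE ucmE.
by case: eqP => [<-|_]; rewrite ?subn0 // subnKC // lt0n.
Qed.

Lemma mulcmUK (y : {cmonom nat}) j : divcm (mmul (ucm j) y) (ucm j) = y.
Proof. by apply/eqP/cmP => i; rewrite divcmE cmM addKn. Qed.

Lemma mcoeff_padj k (f : Lam) y :
  (padj k f)@_y =
    (k%:R / 2) * (y k.-1).+1%:R * f@_(mmul (ucm k.-1) y) :> rat.
Proof.
set ey := mmul _ y; rewrite padj.unlock.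
rewrite (linextEw _ (d := ey |` msupp f)); last exact: fsubsetUr.
rewrite (big_fsetD1 ey) ?fset1U1 //= mcoeffD [(_ *: _)@_y]mcoeffZ [X in _ + X = _]mcoeff_sum [X in _ + X]big1_seq ?addr0.
  rewrite /padj_mon mcoeffZ mcoeff_mono mulcmUK eqxx mulr1 /ey cmM ucmE eqxx add1n.
  by rewrite mulrC.
move=> x; rewrite in_fsetD1 => /andP[_ /andP[xney _]].
rewrite /padj_mon !mcoeffZ mcoeff_mono; case: eqP => [xE|_]; last by rewrite !mulr0.
have [x0|x0] := eqVneq (x k.-1) 0%N; first by rewrite x0 mulr0 mul0r mulr0.
by case/eqP: xney; rewrite /ey -xE divcmK.
Qed.

Lemma padj1 k : padj k 1 = 0.
Proof.
by apply/malgP => y; rewrite mcoeff_padj mcoeff1 mcoeff0 cmM_eq1 cm1_eq1 mulr0.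
Qed.

Lemma padjM k j (f : Lam) : (0 < k)%N ->
  padj k (psum j.+1 * f) =
    ((k == j.+1)%:R * (k%:R / 2)) *: f + psum j.+1 * padj k f.
Proof.
case: k => // k _; rewrite eqSS.
pose F g := padj k.+1 (psum j.+1 * g).
pose G g := ((k == j)%:R * (k.+1%:R / 2)) *: g + psum j.+1 * padj k.+1 g.
rewrite -/(F f) -/(G f) (monoE f).
have FD : {morph F : u v / u + v} by move=> u v; rewrite /F mulrDr padjD.
have GD : {morph G : u v / u + v}.
  by move=> u v; rewrite /G padjD mulrDr scalerDr addrACA.
have F0 : F 0 = 0 by rewrite /F mulr0 padj0.
have G0 : G 0 = 0 by rewrite /G scaler0 padj0 mulr0 addr0.
rewrite (big_morph F FD F0) (big_morph G GD G0); apply: eq_bigr => x _.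
have FZ c u : F (c *: u) = c *: F u by rewrite /F -scalerAr padjZ.
have GZ c u : G (c *: u) = c *: G u.
  by rewrite /G padjZ -scalerAr scalerDr !scalerA [c * _]mulrC.
rewrite FZ GZ /F /G psumE !monoM; congr (_ *: _).
rewrite !padjU.
rewrite /padj_mon /= cmM ucmE natrD mulrDr scalerDl.
apply: (congr2 +%R).
  rewrite [j == k]eq_sym; have [->|_] := eqVneq k j.
    by rewrite mulcmUK mul1r mulr1.
  by rewrite mul0r mulr0 !scale0r.
rewrite -scalerAr monoM; have [x0|x0] := eqVneq (x k) 0%N.
  by rewrite x0 mulr0 !scale0r.
apply: (congr2 *:%R) => //; apply: (congr1 mono); apply/eqP/cmP => i.
rewrite !(divcmE, cmM, ucmE).
by have [<-|_] := eqVneq k i; rewrite ?subn0 // addnBA // lt0n.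
Qed.

(** The operator q_n^perp is the coefficient of X^n in the exponential of the
    sum of X^k d/dp_k over the odd k, hence in the substitution of p_k + X^k
    for p_k. *)
Definition shift_gen (i : nat) : {poly Lam} :=
  (psum i.+1)%:P + (if odd i.+1 then 'X^(i.+1) else 0).

Definition shift_mon (x : {cmonom nat}) : {poly Lam} :=
  \prod_(i <- finsupp x) shift_gen i ^+ x i.

Fact shift_mon_mmorphism : mmorphism shift_mon.
Proof.
split=> [x y|]; last by rewrite /shift_mon mdom1 big_seq_fset0.
pose d := finsupp x `|` finsupp y.
have E (z : {cmonom nat}) : finsupp z `<=` d -> shift_mon z = \prod_(i <- d) shift_gen i ^+ z i.
  by apply: (big_cmonom _ (F := fun i e => shift_gen i ^+ e)) => i; rewrite expr0.
rewrite !E ?fsubsetUl ?fsubsetUr ?mdomD // -big_split /=.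
by apply: eq_bigr => i _; rewrite cmM exprD.
Qed.

HB.instance Definition _ :=
  isMultiplicative.Build {cmonom nat} {poly Lam} shift_mon shift_mon_mmorphism.

Definition shift_cst (c : rat) : {poly Lam} := (c%:MP : Lam)%:P.

HB.instance Definition _ := GRing.RMorphism.copy shift_cst
  ((@polyC Lam) \o (@mkmalgU {cmonom nat} rat mone)).

Definition shift : Lam -> {poly Lam} := mmap shift_cst shift_mon.

HB.instance Definition _ := GRing.RMorphism.copy shift (mmap shift_cst shift_mon).

Lemma shift_psum j : shift (psum j.+1) = shift_gen j.
Proof.
rewrite psumE mono.unlock /shift mmapU.
rewrite [X in X * _](_ : _ = 1) ?mul1r; last exact: (rmorph1 shift_cst).
by rewrite /shift_mon mdomU big_seq_fset1 cmUU expr1.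
Qed.

Lemma shiftZ (c : rat) (f : Lam) : shift (c *: f) = (c%:MP)%:P * shift f.
Proof. exact: mmapZ. Qed.

HB.lock Definition qadj (n : nat) (f : Lam) : Lam := (shift f)`_n.

Fact qadj_is_linear n : linear (qadj n).
Proof.
by move=> c f g; rewrite qadj.unlock rmorphD /= coefD shiftZ coefCM mul_malgC.
Qed.

Lemma qadj1 n : qadj n 1 = (n == 0%N)%:R.
Proof. by rewrite qadj.unlock rmorph1 coef1. Qed.

Lemma qadj_mul n (f g : Lam) :
  qadj n (f * g) = \sum_(i < n.+1) qadj i f * qadj (n - i) g.
Proof. by rewrite qadj.unlock rmorphM coefM. Qed.

Lemma qadj_psumM n j (f : Lam) : qadj n (psum j.+1 * f) =
  psum j.+1 * qadj n f +
  (if odd j.+1 && (j < n)%N then qadj (n - j.+1) f else 0).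
Proof.
rewrite qadj.unlock rmorphM /= shift_psum /shift_gen mulrDl coefD coefCM.
congr (_ + _); rewrite /=; case: (odd j) => /=; first by rewrite mul0r coef0.
by rewrite coefXnM ltnS /=; case: (leqP n j).
Qed.

(** * The inner product *)

Definition zee_factor (i e : nat) : rat := (i.+1%:R / 2) ^+ e * (e`!)%:R.

(** The squared norm of a monomial in the power sums, when
    the norm of p_k is such that [padj k] is adjoint to p_k. *)
HB.lock Definition zee (x : {cmonom nat}) : rat :=
  \prod_(i <- finsupp x) zee_factor i (x i).

Lemma zee_factorS i e :
  zee_factor i e.+1 = (i.+1%:R / 2) * e.+1%:R * zee_factor i e.
Proof. by rewrite /zee_factor exprS factS natrM mulrACA. Qed.

Lemma zee_gt0 x : 0 < zee x.
Proof.
rewrite zee.unlock; apply: prodr_gt0 => i _.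
by rewrite /zee_factor mulr_gt0 ?exprn_gt0 ?divr_gt0 ?ltr0n ?fact_gt0.
Qed.

Lemma zeeUM j x :
  zee (mmul (ucm j) x) = (j.+1%:R / 2) * (x j).+1%:R * zee x.
Proof.
rewrite zee.unlock; pose d : {fset nat} := j |` finsupp x.
have F0 i : zee_factor i 0%N = 1 by rewrite /zee_factor expr0 mul1r.
rewrite (big_cmonom _ (F := zee_factor) (d := d) F0); last first.
  by rewrite mdomD mdomU.
rewrite (big_cmonom _ (F := zee_factor) (d := d) F0); last exact: fsubsetU1.
rewrite (big_fsetD1 j) ?fset1U1 //= [in RHS](big_fsetD1 j) ?fset1U1 //=.
rewrite cmM ucmE eqxx add1n zee_factorS -[LHS]mulrA; congr (_ * (_ * _)).
apply: eq_big_seq => i; rewrite in_fsetD1 => /andP[ij _].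
by rewrite cmM ucmE eq_sym (negPf ij).
Qed.

HB.lock Definition sprod (f g : Lam) : rat :=
  \sum_(x <- msupp f) f@_x * g@_x * zee x.

Lemma sprodEw (d : {fset {cmonom nat}}) (f g : Lam) : msupp f `<=` d ->
  sprod f g = \sum_(x <- d) f@_x * g@_x * zee x.
Proof.
move=> sfd; rewrite sprod.unlock; apply: big_fset_incl => // x _ xf.
by rewrite mcoeff_outdom // !mul0r.
Qed.

Lemma sprodC (f g : Lam) : sprod f g = sprod g f.
Proof.
rewrite (sprodEw _ (fsubsetUl _ (msupp g))).
rewrite (sprodEw _ (fsubsetUr (msupp f) _)).
by apply: eq_bigr => x _; rewrite [f@_x * _]mulrC.
Qed.

Lemma sprodPr (c : rat) (f g h : Lam) :
  sprod h (c *: f + g) = c * sprod h f + sprod h g.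
Proof.
rewrite sprod.unlock mulr_sumr -big_split /=; apply: eq_bigr => x _.
by rewrite mcoeffD mcoeffZ mulrDr mulrDl mulrCA !mulrA.
Qed.

Lemma sprodP (c : rat) (f g h : Lam) :
  sprod (c *: f + g) h = c * sprod f h + sprod g h.
Proof. by rewrite sprodC sprodPr ![sprod h _]sprodC. Qed.

Lemma sprod_mono x (g : Lam) : sprod (mono x) g = g@_x * zee x.
Proof.
rewrite (sprodEw _ (d := [fset x])) => [|]; last first.
  by rewrite mono.unlock msuppU_le.
by rewrite big_seq_fset1 mcoeff_mono eqxx mul1r.
Qed.

Lemma sprod_psumM j (f g : Lam) :
  sprod (psum j.+1 * f) g = sprod f (padj j.+1 g).
Proof.
pose L u := sprod (psum j.+1 * u) g - sprod u (padj j.+1 g).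
apply/eqP; rewrite -subr_eq0 -/(L f) (monoE f); apply/eqP.
have LP c u v : L (c *: u + v) = c * L u + L v.
  by rewrite /L mulrDr -scalerAr !sprodP mulrDr mulrN opprD addrACA.
have L0 : L 0 = 0.
  by have := LP (- 1) 0 0; rewrite scaler0 addr0 mulN1r addNr.
elim/big_rec: _ => // x u _ IHu; rewrite LP IHu addr0 /L psumE monoM.
by rewrite !sprod_mono mcoeff_padj zeeUM /= mulrCA !mulrA subrr mulr0.
Qed.

Lemma sprod_eq0 (f : Lam) : sprod f f = 0 -> f = 0.
Proof.
rewrite sprod.unlock => /eqP.
have F_ge0 x : 0 <= f@_x * f@_x * zee x.
  by apply: mulr_ge0; [rewrite -expr2 sqr_ge0 | exact/ltW/zee_gt0].
rewrite psumr_eq0 => [|x _]; last exact: F_ge0.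
move=> /allP H; apply/malgP => x; rewrite mcoeff0.
have [xf|xf] := boolP (x \in msupp f); last by rewrite mcoeff_outdom.
have := H x xf; rewrite /= mulf_eq0 mulf_eq0 orbb.
by rewrite (gt_eqF (zee_gt0 x)) orbF => /eqP.
Qed.

(** * The grading *)

Definition weight (x : {cmonom nat}) := (\sum_(i <- finsupp x) x i * i.+1)%N.

Lemma weightM x y : weight (mmul x y) = (weight x + weight y)%N.
Proof.
pose d := finsupp x `|` finsupp y.
have E (z : {cmonom nat}) : finsupp z `<=` d ->
    weight z = (\sum_(i <- d) z i * i.+1)%N.
  by apply: (big_cmonom _ (F := fun i e => (e * i.+1)%N)).
rewrite !E ?fsubsetUl ?fsubsetUr ?mdomD // -big_split /=.
by apply: eq_bigr => i _; rewrite cmM mulnDl.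
Qed.

Lemma msupp_mono x : msupp (mono x) = [fset x].
Proof. by rewrite mono.unlock msuppU1. Qed.

Lemma homog1 : homogeneous 0 1.
Proof.
have E := msupp_mono mone; rewrite mono1 in E.
by move=> x; rewrite E => /fset1P ->; rewrite mdom1 big_seq_fset0.
Qed.

Lemma homogD d (f g : Lam) :
  homogeneous d f -> homogeneous d g -> homogeneous d (f + g).
Proof.
move=> hf hg x /(fsubsetP (msuppD_le _ _)); rewrite in_fsetU.
by case/orP => [/hf|/hg].
Qed.

Lemma homogZ d (c : rat) (f : Lam) : homogeneous d f -> homogeneous d (c *: f).
Proof. by move=> hf x /(fsubsetP (msuppZ_le _ _)) /hf. Qed.

Lemma homogM d e (f g : Lam) :
  homogeneous d f -> homogeneous e g -> homogeneous (d + e) (f * g).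
Proof.
move=> hf hg x /msuppM_le [k1 [k2 [/hf h1 /hg h2 ->]]].
by rewrite -h1 -h2; apply: weightM.
Qed.

Lemma homog_psum j : homogeneous j.+1 (psum j.+1).
Proof.
move=> x; rewrite psumE msupp_mono => /fset1P ->.
by rewrite mdomU big_seq_fset1 cmUU mul1n.
Qed.

Lemma homog_sprod d e (f g : Lam) : d != e ->
  homogeneous d f -> homogeneous e g -> sprod f g = 0.
Proof.
move=> de hf hg; rewrite sprod.unlock big1_seq // => x /andP[_ xf].
have [xg|xg] := boolP (x \in msupp g); last by rewrite (mcoeff_outdom xg) mulr0 mul0r.
by case/eqP: de; rewrite -(hf x xf) -(hg x xg).
Qed.

Section Newton.
Variable c : nat -> rat.

Lemma size_newton n : size (newton c n) = n.+1.
Proof. by case: n => // n; elim: n => [|n IHn] //=; rewrite size_rcons IHn. Qed.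

Lemma nth_newton n k : (k <= n)%N ->
  (newton c n)`_k = (newton c k)`_k :> Lam.
Proof.
elim: n => [|n IHn]; first by rewrite leqn0 => /eqP ->.
rewrite leq_eqVlt => /predU1P[->//|]; rewrite ltnS => le_kn.
by rewrite /= nth_rcons size_newton ltnS le_kn IHn.
Qed.

Lemma newton_rec n : n.+1%:R *: (newton c n.+1)`_n.+1 =
  \sum_(i < n.+1) c i *: (psum i.+1 * (newton c (n - i))`_(n - i)) :> Lam.
Proof.
rewrite [newton c n.+1]/= nth_rcons size_newton ltnn eqxx scalerA.
rewrite mulfV ?pnatr_eq0 // scale1r; apply: eq_bigr => i _.
by rewrite nth_newton // leq_subr.
Qed.

End Newton.

Lemma qsym0 : qsym 0 = 1.
Proof. by rewrite /qsym big_ord_recl big_ord0 addr0 /comp_sym /elem_sym mulr1. Qed.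

Lemma comp_sym_rec n : n.+1%:R *: comp_sym n.+1 =
  \sum_(i < n.+1) 1 *: (psum i.+1 * comp_sym (n - i)).
Proof. exact: newton_rec. Qed.

Lemma elem_sym_rec n : n.+1%:R *: elem_sym n.+1 =
  \sum_(i < n.+1) (-1) ^+ i *: (psum i.+1 * elem_sym (n - i)).
Proof. exact: newton_rec. Qed.

(** The logarithmic derivatives of the series of the complete and of the
    elementary symmetric functions add up; the terms with even power sums
    cancel. *)
Lemma qsym_rec n : n.+1%:R *: qsym n.+1 =
  \sum_(i < n.+1 | ~~ odd i) 2 *: (psum i.+1 * qsym (n - i)).
Proof.
have := newton_product (A := Lam) (p := psum) (h := comp_sym) (e := elem_sym)
  (c := fun=> 1) (d := fun i => (-1) ^+ i) comp_sym_rec elem_sym_rec n.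
move=> E.
have E1 : n.+1%:R *: qsym n.+1 = \sum_(i < n.+1) (1 + (-1) ^+ i) *: (psum i.+1 * qsym (n - i)) := E.
rewrite E1.
rewrite [RHS]big_mkcond /=; apply: eq_bigr => i _.
rewrite -signr_odd.
by case: (odd i); rewrite ?expr1 ?subrr ?scale0r.
Qed.

Lemma Lam_qadj_nil n (f : Lam) : (size (shift f) <= n)%N -> qadj n f = 0.
Proof. by move=> le_n; rewrite qadj.unlock nth_default. Qed.

Lemma sprod11 : sprod 1 1 = 1.
Proof.
rewrite -mono1 sprod_mono mcoeff_mono eqxx mul1r zee.unlock.
by rewrite mdom1 big_seq_fset0.
Qed.

Definition LamFock : fock.
Proof.
refine (@Fock (Lam : comAlgType rat) psum qsym padj qadj (fun f => size (shift f))
  sprod _ _ _ _ _ _ _ _ _ _ _ _ _ _ _ _).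
- exact: Lam_ind.
- exact: qsym0.
- exact: qsym_rec.
- exact: padj_is_linear.
- exact: padj1.
- exact: padjM.
- exact: qadj_is_linear.
- exact: qadj1.
- exact: qadj_psumM.
- exact: qadj_mul.
- exact: Lam_qadj_nil.
- exact: (fun h c f g => sprodPr c f g h).
- exact: sprodC.
- exact: sprod_eq0.
- exact: sprod11.
- exact: sprod_psumM.
Defined.

Lemma GamE (f : LamFock) : Gam f <-> inGamma f.
Proof.
split; elim=> {f} [n|f g _ Gf _ Gg|f g _ Gf _ Gg|c f _ Gf].
- exact: Gamma_q.
- exact: Gamma_add.
- exact: Gamma_mul.
- exact: Gamma_scale.
- exact: (Gam_qn LamFock).
- exact: (GamD Gf Gg).
- exact: (GamM Gf Gg).
- exact: (GamZ c Gf).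
Qed.

Lemma homog_qsym n : homogeneous n (qsym n).
Proof.
elim/ltn_ind: n => -[_|n IHn]; first by rewrite qsym0; apply: homog1.
have -> : qsym n.+1 = (n.+1%:R)^-1 *: (n.+1%:R *: qsym n.+1).
  by rewrite scalerA mulVf ?scale1r // pnatr_eq0.
rewrite qsym_rec; apply: homogZ; apply: big_ind.
- by move=> x; rewrite msupp0.
- exact: homogD.
move=> i _; apply: homogZ; have le_in : (i <= n)%N by rewrite -ltnS.
have := homogM (@homog_psum i) (IHn (n - i)%N (leq_subr _ _)).
by rewrite addSn subnKC.
Qed.

Lemma vertexBE (perp : Lam -> Lam -> Lam) (n : nat) (f : LamFock) :
    (forall i, perp (qsym i) f = qad i f) ->
  vertexB perp n f = vop n%:Z f.
Proof.
move=> H; rewrite /vertexB vop.unlock.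
pose K := qad_deg f.
pose F (i : nat) : LamFock := (-1) ^+ i *: (qz LamFock (n%:Z + i%:Z) * qad i f).
transitivity (\sum_(i \in [set: nat]%classic) F i).
  by apply: eq_fsbigr => i _; rewrite H.
rewrite -(fsbig_widen `I_K%classic) //; last first.
  move=> i [_ /= /negP]; rewrite -leqNgt => le_Ki.
  by rewrite /F qad_nil // mulr0 scaler0.
by rewrite -fsbig_ord.
Qed.

Section SchurQRecord.
Variable S : schurQ.

Let Q (l : spart) : LamFock := Qf S l.
Let prp (f g : LamFock) : LamFock := perp S f g.

(** The axioms of [schurQ] determine the functions [Qf] and the operators
    [perp] on the span of Gamma, where they are thus those of [LamFock]. *)
Theorem schurQ_pieri (mu : seq nat) (l : spart) : all odd mu ->
  foldr (fun r f => perp S (psum r) f) (Qf S l) mu = padl mu (vspart LamFock l)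
  /\ Gam (padl mu (vspart LamFock l)).
Proof.
move=> odd_mu; apply: (perp_pwl (X := LamFock) (Q := Q) (ip := ip S)
  (perp := prp) (hom := homogeneous)) => //.
- exact: homog_sprod.
- by move=> n d f hf; apply: homogM hf; apply: homog_qsym.
- exact: Q_homogeneous.
- by move=> l'; apply/GamE/Q_Gamma.
- by move=> f /GamE/(Q_basis S)[c [E _]]; exists c.
- by move=> f g /GamE Gf /GamE Gg; apply: ip_sym.
- by move=> c f g h /GamE Gf /GamE Gg /GamE Gh; apply: ip_linear.
- by move=> l1 l2; apply: ip_Q.
- by move=> f g /GamE Gf /GamE Gg; apply/GamE/perp_Gamma.
- by move=> f g h /GamE Gf /GamE Gg /GamE Gh; apply: perp_adjoint.
- by move=> l0 l00; rewrite /Q Q_vertex l00.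
- move=> l1 l2 a l12 H; rewrite /Q Q_vertex l12 /= -Q_vertex.
  exact: vertexBE.
Qed.

End SchurQRecord.

(** * Order-keeping permutations *)

(** Removing the value at [p] and putting it back in its place. *)
Lemma codom_lift (T : Type) n (F : 'I_n.+1 -> T) (p : 'I_n.+1) :
  [seq F i | i <- enum 'I_n.+1] =
  take p [seq F (lift p i) | i <- enum 'I_n] ++
  F p :: drop p [seq F (lift p i) | i <- enum 'I_n].
Proof.
set l := [seq F (lift p i) | i <- _].
have szl : size l = n by rewrite size_map size_enum_ord.
have le_pn : (p <= n)%N by rewrite -ltnS.
have szt : size (take p l) = p by rewrite size_takel ?szl.
apply: (@eq_from_nth _ (F p)).
  by rewrite size_cat /= size_drop szt szl size_map size_enum_ord; clear -le_pn; lia.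
move=> k; rewrite size_map size_enum_ord => lt_kn.
rewrite (nth_map ord0) ?size_enum_ord // nth_cat szt.
have -> : nth ord0 (enum 'I_n.+1) k = Ordinal lt_kn.
  by apply: val_inj; rewrite /= nth_enum_ord.
have Fl j (lt_jn : (j < n)%N) : nth (F p) l j = F (lift p (Ordinal lt_jn)).
  rewrite (nth_map (Ordinal lt_jn)) ?size_enum_ord //; congr (F (lift _ _)).
  by apply: val_inj; rewrite /= nth_enum_ord.
case: ltngtP => [lt_kp|lt_pk|kp].
- have lt_kn' : (k < n)%N by apply: leq_trans le_pn.
  rewrite nth_take // (Fl _ lt_kn'); congr F; apply: val_inj => /=.
  by rewrite /bump leqNgt lt_kp.
- case: k lt_kn lt_pk => // k lt_kn lt_pk.
  rewrite subSn // /= nth_drop subnKC // (Fl _ (lt_kn : (k < n)%N)).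
  by congr F; apply: val_inj; rewrite /= /bump -ltnS lt_pk.
- have -> : Ordinal lt_kn = p by apply: val_inj.
  by rewrite kp subnn.
Qed.

Lemma perm_lift n (s : 'S_n.+1) : exists s' : 'S_n, s = lift_perm ord0 (s ord0) s'.
Proof.
pose f (k : 'I_n) := odflt k (unlift (s ord0) (s (lift ord0 k))).
have fK k : lift (s ord0) (f k) = s (lift ord0 k).
  rewrite /f; have := neq_lift ord0 k.
  by rewrite -(can_eq (permK s)) => /unlift_some[] ? ? ->.
have f_inj : injective f.
  by move=> i j ij; apply/(lift_inj (h := ord0))/(perm_inj (s := s)); rewrite -!fK ij.
exists (perm f_inj); apply/permP => i.
by case: (unliftP ord0 i) => [j|] ->; rewrite ?lift_perm_id // lift_perm_lift permE fK.
Qed.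

Definition keeps n (F : 'I_n -> int) (s : 'S_n) :=
  forall i j : 'I_n, (i < j)%N -> `|F (s i)|%N = `|F (s j)|%N -> (s i < s j)%N.

Lemma lt_lift n (p : 'I_n.+1) (i j : 'I_n) : (lift p i < lift p j)%N = (i < j)%N.
Proof. by rewrite /= /bump; clear; lia. Qed.

Section SignedPermutation.
Variable X : fock.

Lemma vword_move (l1 l2 : seq int) (x : int) :
  all (fun y => `|y|%N != `|x|%N) l1 ->
  vword X (l1 ++ x :: l2) = (-1) ^+ size l1 *: vword X (x :: l1 ++ l2).
Proof.
elim: l1 => [|y l1 IHl] /=; first by rewrite scale1r.
case/andP=> yx /IHl E; rewrite -[vop y _]/(vop y (vword X _)) E vopZ !vword_cons.
rewrite vop_swap; last by apply: contraNneq yx; clear; lia.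
by rewrite exprS mulN1r scaleNr scalerN.
Qed.

(** The letters that pass each other have distinct absolute values, hence
    anticommute. *)
Lemma vword_keeps n (F : 'I_n -> int) (s : 'S_n) : keeps F s ->
  vword X [seq F i | i <- enum 'I_n] =
  (-1) ^+ s *: vword X [seq F (s i) | i <- enum 'I_n].
Proof.
elim: n F s => [|n IHn] F s Fs.
  have -> : s = 1%g by apply/permP => -[].
  by rewrite odd_perm1 scale1r; congr (vword X _); apply: eq_map => -[].
have [s' sE] := perm_lift s; set p := s ord0 in sE.
have s'E i : s (lift ord0 i) = lift p (s' i) by rewrite sE lift_perm_lift.
pose F' i := F (lift p i).
have F's' : keeps F' s'.
  move=> i j lt_ij Fij; rewrite -(lt_lift p) -!s'E; apply: Fs.
    by rewrite lt_lift.
  by rewrite !s'E.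
rewrite (codom_lift F p) vword_move; last first.
  apply/(all_nthP 0) => k; rewrite size_take size_map size_enum_ord => lt_k.
  have [lt_kp lt_kn] : (k < p)%N /\ (k < n)%N.
    move: lt_k; have := ltn_ord p; move: (nat_of_ord p) => q.
    by case: (ltnP q n); clear; lia.
  rewrite nth_take // (nth_map (Ordinal lt_kn)) ?size_enum_ord //.
  set q := nth _ _ _; have qk : q = k :> nat by rewrite /q nth_enum_ord.
  apply/eqP => Fq.
  pose i := s^-1%g (lift p q).
  have si : s i = lift p q by rewrite permKV.
  have i0 : i != ord0.
    by apply/eqP => i0; have := neq_lift p q; rewrite -si i0 eqxx.
  have : (s ord0 < s i)%N.
    apply: Fs; first by rewrite lt0n.
    by rewrite si Fq.
  rewrite -/p si /= qk /bump; move: lt_kp; move: (nat_of_ord p) => p'.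
  by clear; lia.
rewrite size_takel; last by rewrite size_map size_enum_ord -ltnS.
rewrite cat_take_drop vword_cons (IHn F' s') // vopZ scalerA.
have -> : (-1) ^+ p * (-1) ^+ s' = (-1) ^+ s :> rat.
  by rewrite [in RHS]sE odd_lift_perm /= signr_addb signr_odd.
rewrite enum_ordSl /= -map_comp; congr (_ *: _); rewrite /p; congr (vop _ (vword X _)).
by apply: eq_map => i /=; rewrite s'E.
Qed.

End SignedPermutation.

(** The first letter of the target is moved to the front from its first
    occurrence in the source, past letters of other absolute values. *)
Lemma keeps_exists n (F G : 'I_n -> int) :
  (forall k, [seq x <- [seq F i | i <- enum 'I_n] | `|x|%N == k] =
             [seq x <- [seq G i | i <- enum 'I_n] | `|x|%N == k]) ->
  exists2 s : 'S_n, keeps F s & forall i, G i = F (s i).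
Proof.
elim: n F G => [|n IHn] F G FG; first by exists 1%g => -[].
set x := G ord0.
have FGx := FG `|x|%N.
have : has (fun y : int => `|y|%N == `|x|%N) [seq F i | i <- enum 'I_n.+1].
  by rewrite has_filter FGx enum_ordSl /= eqxx.
set h := (fun y : int => _) => hF.
set k := find h [seq F i | i <- enum 'I_n.+1].
have lt_kn : (k < n.+1)%N by rewrite -[n.+1]card_ord cardE -(size_map F) -has_find.
pose p := Ordinal lt_kn.
pose F' i := F (lift p i); pose G' i := G (lift ord0 i).
set lF := [seq F' i | i <- enum 'I_n].
have FE := codom_lift F p; rewrite -/F' -/lF in FE.
have szlF : size lF = n by rewrite size_map size_enum_ord.
have GE : [seq G i | i <- enum 'I_n.+1] = x :: [seq G' i | i <- enum 'I_n].
  by rewrite enum_ordSl /= -map_comp.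
have no : ~~ has h (take p lF).
  have : ~~ has h (take k [seq F i | i <- enum 'I_n.+1]).
    apply/hasPn => y /(nthP 0)[u]; rewrite size_take_min leq_min => /andP[lt_ik _] <-.
    by rewrite nth_take // before_find.
  by rewrite FE take_size_cat // size_takel // szlF -ltnS.
have FpE : F p = x.
  have hFp : h (F p).
    have := nth_find 0 hF; rewrite -/k.
    by rewrite (nth_map ord0) ?size_enum_ord // (_ : nth _ _ _ = p) //; apply: val_inj; rewrite /= nth_enum_ord.
  move: FGx; rewrite FE GE filter_cat /= eqxx -/h.
  have /eqP -> : [seq y <- take p lF | h y] == [::] by rewrite -[_ == _]negbK -has_filter.
  by rewrite -/(h (F p)) hFp => -[].
have [s' F's' G'E] : exists2 s : 'S_n, keeps F' s & forall i, G' i = F' (s i).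
  apply: IHn => j; rewrite -/lF -[X in [seq x <- X | _] = _](cat_take_drop p lF).
  have := FG j; rewrite FE GE FpE !filter_cat /=.
  case: eqP => // xj; rewrite -xj -/h.
  have /eqP -> : [seq y <- take p lF | h y] == [::] by rewrite -[_ == _]negbK -has_filter.
  by case.
exists (lift_perm ord0 p s'); last first.
  move=> i; case: (unliftP ord0 i) => [j|] ->; last by rewrite lift_perm_id FpE.
  by rewrite lift_perm_lift; apply: G'E.
move=> i j.
case: (unliftP ord0 j) => [j'|] -> //.
case: (unliftP ord0 i) => [i'|] ->; rewrite lift_perm_lift ?lift_perm_id ?lift_perm_lift ?lt_lift.
  by move=> lt_ij; apply: F's'.
move=> _ /esym Fj; rewrite /= /bump.
have [le_p|lt_jp] := leqP k (s' j'); first by rewrite ltnS.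
case/hasP: no; exists (F' (s' j')); last by rewrite /h -FpE; apply/eqP.
apply/(nthP 0); exists (s' j'); first by rewrite size_takel // szlF -ltnS.
rewrite nth_take // (nth_map (s' j')) ?size_enum_ord //; congr F'.
by apply: val_inj; rewrite /= nth_enum_ord.
Qed.

(** * Integer sequences and words *)

Lemma enum_nth (a : seq int) : [seq a`_i | i : 'I_(size a) <- enum 'I_(size a)] = a.
Proof.
by rewrite -[RHS](mkseq_nth 0) /mkseq -val_enum_ord -map_comp.
Qed.

Section Vanishing.
Variable X : fock.
Implicit Types (a b s : seq int) (x y : int) (i : nat).

(** Nothing between the two occurrences of [x] prevents them from meeting, and
    the square of a nonzero letter is zero. *)
Lemma vop_vword_repeat x s t : x != 0 ->
  [seq y <- s | `|y|%N == `|x|%N] = x :: t -> vop x (vword X s) = 0.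
Proof.
move=> x0; elim: s => //= y s IHs; case: eqP => [_ [-> _]|xy /IHs E].
  exact: vop_square.
rewrite vop_swap -/(vword X s) ?E ?vop0 ?oppr0 //.
by apply/eqP => xy0; apply: xy; move: xy0; clear; lia.
Qed.

(** Two equal letters meet if the signs fail to alternate, and a negative letter
    reaches the vacuum if it is the last of its kind. *)
Lemma vword_vanishing a : vanishing a -> vword X a = 0.
Proof.
case/hasP => x _ /andP[x0]; set i := `|x|%N.
have i_gt0 : (0 < i)%N by rewrite /i absz_gt0.
rewrite /alternating negb_and => /orP[].
  elim: a => //= y a IHa; case: ifP => [/eqP yi|_] /=; last first.
    by move/IHa => E; rewrite -/(vword X a) E vop0.
  case E : [seq z <- a | `|z|%N == i] => [|z t] //=.
  rewrite negb_and => /orP[zy|nsorted]; last first.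
    by rewrite -/(vword X a) IHa ?vop0 // E.
  have : z \in [seq z <- a | `|z|%N == i] by rewrite E mem_head.
  rewrite mem_filter => /andP[/eqP zi _].
  have yz : y = z by move: zy zi yi; clear; lia.
  apply: (vop_vword_repeat (t := t)); first by rewrite yz -absz_gt0 zi.
  by rewrite yi E yz.
elim: a => [|y a IHa] /=; first by rewrite eqxx.
case: ifP => [/eqP yi|_] last_i; last by rewrite -/(vword X a) IHa ?vop0.
have [E|ne] := eqVneq [seq z <- a | `|z|%N == i] [::]; last first.
  rewrite -/(vword X a) IHa ?vop0 //.
  by move: last_i ne; case: [seq z <- a | _].
rewrite E /= in last_i.
apply: vop_vword_neg; first by move: last_i yi i_gt0; clear; lia.
apply/negP => ya; have : - y \in [seq z <- a | `|z|%N == i].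
  by rewrite mem_filter abszN yi eqxx.
by rewrite E.
Qed.

(** ** Normal forms *)

Lemma vword_pairs (ps : seq nat) (z : nat) : all (fun k => 0 < k)%N ps ->
  vword X (flatten [seq [:: - (k%:Z); k%:Z] | k : nat <- ps] ++ nseq z 0) =
  ((-1) ^+ sumn ps * 2 ^+ size ps) *: 1.
Proof.
elim: ps => [|a ps IHps] /=.
  by move=> _; rewrite mul1r scale1r; elim: z => //= z ->; rewrite vop_vac0.
case/andP=> a_gt0 /IHps E; rewrite -/(vword X _) E !vopZ.
have := vop_anticomm (- a%:Z) a%:Z (1 : X).
rewrite [vop (- a%:Z) 1]vop_vac_neg ?vop0 ?addr0; last by move: a_gt0; clear; lia.
move=> ->; rewrite addNr eqxx mulr1 isgN isg_nat scalerA; congr (_ *: _).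
by rewrite exprD exprS; ring.
Qed.

Lemma vword_nf b : is_nf b ->
  vword X b = ((-1) ^+ sumn (nf_pairs b) * 2 ^+ size (nf_pairs b)) *:
    vword X (map Posz (nf_part b)).
Proof.
case/andP=> _ /eqP E; rewrite {1}E vword_cat vword_pairs ?vopsZ //.
apply/allP => a /mapP[x]; rewrite mem_filter => /andP[x_gt0 _] ->.
by move: x_gt0; clear; lia.
Qed.

End Vanishing.

Definition nf_seq (l ps : seq nat) (z : nat) : seq int :=
  [seq a%:Z | a <- l] ++ flatten [seq [:: - (a%:Z); a%:Z] | a <- ps] ++ nseq z 0.

Lemma is_nf_seq l ps z : is_strict l -> all (fun a => 0 < a)%N ps ->
  is_nf (nf_seq l ps z).
Proof.
move=> strict_l ps_gt0; have [_ l0] := andP strict_l.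
set b := nf_seq l ps z.
have lenE : nf_len b = size [seq a%:Z | a <- l].
  rewrite /nf_len /b /nf_seq find_cat ifN; last first.
    apply/hasPn => x /mapP[a al ->]; rewrite -ltNge ltz_nat lt0n.
    by apply: contraNneq l0 => <-.
  rewrite -[RHS]addn0; congr addn; clear; case: ps => [|a ps] /=.
    by case: z.
  by rewrite oppr_le0.
have partE : nf_part b = l.
  rewrite /nf_part lenE /b /nf_seq take_size_cat // -map_comp -[RHS]map_id.
  exact: eq_map.
have pairsE : nf_pairs b = ps.
  rewrite /nf_pairs lenE /b /nf_seq drop_size_cat // filter_cat map_cat.
  rewrite [X in _ ++ X](_ : _ = [::]) ?cats0; last by elim: (z).
  elim: (ps) ps_gt0 => //= a ps' IHps /andP[a_gt0 /IHps E].
  have -> : (0 < - a%:Z) = false by rewrite oppr_gt0.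
  by rewrite ltz_nat a_gt0 /= E.
rewrite /is_nf partE pairsE strict_l /=; apply/eqP; rewrite {1}/b /nf_seq.
congr (_ ++ _ ++ nseq _ _); rewrite /b /nf_seq !count_cat.
rewrite [X in (X + _)%N](_ : _ = 0%N); last first.
  by apply/count_memPn/negP => /mapP[a al [a0]]; rewrite -a0 in al; rewrite al in l0.
rewrite [X in (_ + (X + _))%N](_ : _ = 0%N) ?count_nseq ?mul1n //.
elim: (ps) ps_gt0 => //= a ps' IHps /andP[a_gt0 /IHps ->].
by rewrite oppr_eq0 eqz_nat -leqn0 leqNgt a_gt0.
Qed.

Lemma filter_nf_seq l ps z k : uniq l -> (0 < k)%N ->
  [seq x <- nf_seq l ps z | `|x|%N == k] =
  nseq (k \in l) k%:Z ++ flatten (nseq (count_mem k ps) [:: - (k%:Z); k%:Z]).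
Proof.
move=> ul k_gt0; rewrite /nf_seq !filter_cat; congr (_ ++ _).
  rewrite filter_map (eq_filter (a2 := pred1 k)) //.
  have [kl|kl] := boolP (k \in l); first by rewrite filter_pred1_uniq.
  by rewrite (eq_in_filter (a2 := pred0)) ?filter_pred0 // => x xl; apply: contraNF kl => /eqP <-.
rewrite [X in _ ++ X](_ : _ = [::]) ?cats0; last by elim: (z) => //= n ->; case: (k) k_gt0.
elim: ps => //= a ps ->; rewrite abszN absz_nat.
by case: eqP => [->|].
Qed.

Lemma filter0_nf_seq l ps z : is_strict l -> all (fun a => 0 < a)%N ps ->
  [seq x <- nf_seq l ps z | `|x|%N == 0%N] = nseq z 0.
Proof.
move=> /andP[_ l0] ps_gt0; rewrite /nf_seq !filter_cat.
rewrite [X in X ++ _](_ : _ = [::]); last first.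
  rewrite (eq_in_filter (a2 := pred0)) ?filter_pred0 // => x /mapP[a al ->].
  by apply: contraNF l0 => /eqP <-.
rewrite cat0s [X in X ++ _](_ : _ = [::]); last first.
  elim: (ps) ps_gt0 => //= a ps' IHps /andP[a_gt0 /IHps ->].
  by rewrite abszN absz_nat -leqn0 leqNgt a_gt0.
by elim: (z) => //= n ->.
Qed.

(** An alternating sequence is determined by its last term and its length. *)
Lemma alternating_shape (v : seq int) k : all (fun x : int => `|x|%N == k) v ->
  sorted (fun x y : int => y == - x) v -> last (k%:Z) v == k%:Z ->
  v = nseq (odd (size v)) k%:Z ++ flatten (nseq (size v)./2 [:: - (k%:Z); k%:Z]).
Proof.
elim: v => //= x v IHv /andP[xk vk] p.
have [->|v0] := eqVneq v [::]; first by move=> /= /eqP ->.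
have -> : last x v = last k%:Z v by case: (v) v0.
move/(IHv vk (path_sorted p)) => E; rewrite {1}E.
rewrite uphalf_half; case: odd E => /= E.
  by rewrite {1}E in p; move: p => /= /andP[/eqP -> _]; rewrite opprK.
move: p v0; rewrite {1 2}E; case: (_./2) => //= n /andP[/eqP xE _] _.
by rewrite (_ : x = k%:Z) //; move: xE; clear; lia.
Qed.

Lemma eq_filter_abs_perm (a b : seq int) :
  (forall k, [seq x <- a | `|x|%N == k] = [seq x <- b | `|x|%N == k]) -> perm_eq a b.
Proof.
move=> E; apply/allP => x _ /=.
have cnt s : count_mem x s = count_mem x [seq y <- s | `|y|%N == `|x|%N].
  rewrite count_filter; apply: eq_count => y /=.
  by case: eqP => //= ->; rewrite eqxx.
by rewrite cnt E -cnt.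
Qed.

(** For each absolute value [k] the number of letters decides how many pairs
    [- k], [k] there are and whether a single [k] is left over. *)
Lemma nf_exists (a : seq int) : ~~ vanishing a ->
  exists s : {perm 'I_(size a)}, is_nf (permuted s) && keeps_order s.
Proof.
move=> van; pose cnt i := count (fun x : int => `|x|%N == i) a.
pose M := (\max_(x <- a) `|x|%N).+1.
have cntM i : (M <= i)%N -> cnt i = 0%N.
  move=> le_Mi; apply/eqP; rewrite -leqn0 leqNgt -has_count; apply/hasP => -[x xa /eqP xi].
  by move: le_Mi; rewrite -xi ltnNge (leq_bigmax_seq _ xa).
pose l := [seq i <- rev (iota 1 M) | odd (cnt i)].
pose ps := flatten [seq nseq (cnt i)./2 i | i <- iota 1 M].
have strict_l : is_strict l.
  rewrite /is_strict mem_filter mem_rev mem_iota andbF andbT.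
  apply: (sorted_filter gtn_trans); rewrite rev_sorted; exact: iota_ltn_sorted.
have ps_gt0 : all (fun i => 0 < i)%N ps.
  apply/allP => i /flattenP[_ /mapP[j + ->]]; rewrite mem_iota => /andP[j_gt0 _].
  by rewrite mem_nseq => /andP[_ /eqP ->].
have ul : uniq l by rewrite filter_uniq // rev_uniq iota_uniq.
have lE k : (0 < k)%N -> (k \in l) = odd (cnt k).
  move=> k_gt0; rewrite mem_filter mem_rev mem_iota k_gt0 /= add1n ltnS.
  by case: leqP; rewrite ?andbT // => /ltnW/cntM ->.
have psE k : (0 < k)%N -> count_mem k ps = (cnt k)./2.
  move=> k_gt0; rewrite /ps count_flatten -map_comp.
  rewrite (eq_map (g := fun i => (i == k) * (cnt i)./2)%N); last first.
    by move=> i /=; rewrite count_nseq.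
  rewrite sumnE big_map.
  have [kM|kM] := boolP (k \in iota 1 M).
    rewrite (bigD1_seq k) ?iota_uniq //= eqxx mul1n big1 ?addn0 // => i /negPf ->.
    by [].
  rewrite cntM; last by move: kM; rewrite mem_iota k_gt0 add1n ltnS -ltnNge => /ltnW.
  rewrite big1_seq // => i /= iM; case: eqP => // ik.
  by rewrite -ik iM in kM.
pose b := nf_seq l ps (cnt 0%N).
have ab k : [seq x <- a | `|x|%N == k] = [seq x <- b | `|x|%N == k].
  case: k => [|k].
    rewrite filter0_nf_seq //.
    have : all (pred1 0) [seq x <- a | `|x|%N == 0%N].
      by apply/allP => x; rewrite mem_filter absz_eq0 => /andP[].
    by move/all_pred1P => ->; rewrite size_filter.
  rewrite filter_nf_seq // lE // psE // /cnt -size_filter.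
  have [E|] := eqVneq [seq x <- a | `|x|%N == k.+1] [::]; first by rewrite E.
  rewrite -has_filter => /hasP[x xa /eqP xk].
  have : alternating a k.+1.
    have := hasPn van x xa; rewrite xk negb_and !negbK => /orP[/eqP x0|//].
    by rewrite x0 in xk.
  by case/andP=> s_v last_v; apply: alternating_shape => //; apply: filter_all.
have szb : size b = size a by rewrite (perm_size (eq_filter_abs_perm ab)).
have bE : [seq b`_i | i : 'I_(size a) <- enum 'I_(size a)] = b.
  by rewrite -[RHS]enum_nth szb.
have [s keep sE] := @keeps_exists (size a) (fun i : 'I_(size a) => a`_i) (fun i : 'I_(size a) => b`_i)
  (fun k => etrans (congr1 _ (enum_nth a)) (etrans (ab k) (congr1 _ (esym bE)))).
exists s; have -> : permuted s = b.
  by rewrite -bE; apply: eq_map => i; rewrite sE.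
rewrite is_nf_seq //=; apply/forallP => i; apply/forallP => j; apply/implyP.
by case/andP=> lt_ij /eqP; apply: keep.
Qed.

(** The relations of the space F are those of the words in the vertex
    operators. *)
Lemma word_vword (R : realType) (X : fock) (a : seq int) :
  exists c : rat, exists l : spart,
    word R a = << ratr c *g l >> /\ vword X a = c *: vspart X l.
Proof.
rewrite /word; have [van|nvan] := boolP (vanishing a).
  exists 0, spart0; rewrite rmorph0 monalgU0 scale0r; split=> //.
  exact: vword_vanishing.
case: pickP => [s /andP[nf keep]|none]; last first.
  by have [s] := nf_exists nvan; rewrite none.
set b := permuted s.
exists ((-1) ^+ sumn (nf_pairs b) * 2 ^+ size (nf_pairs b) * (-1) ^+ s).
exists (to_spart (nf_part b)); split.
  congr << _ *g _ >>; rewrite !rmorphM /= !rmorphXn /=.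
  by rewrite !rmorphN1 rmorph_nat.
have strict_b : is_strict (nf_part b) by case/andP: nf.
have -> : vspart X (to_spart (nf_part b)) = vword X (map Posz (nf_part b)).
  by rewrite /vspart /to_spart insubdK.
rewrite -[in LHS](enum_nth a) (@vword_keeps X _ (fun i : 'I_(size a) => a`_i) s); last first.
  move=> i j lt_ij Eij; have /forallP/(_ i)/forallP/(_ j) := keep.
  by rewrite lt_ij Eij eqxx.
by rewrite -/(permuted s) -/b (vword_nf X nf) scalerA mulrC.
Qed.

(** * The sequences indexing the terms of the operator *)

Section Admissible.
Variable m : nat.
Hypothesis odd_m : odd m.
Implicit Types (a s t : seq int) (x y z : int) (c d : nat) (cs : seq nat).

Notation cg := (cg m).
Notation cl := (cl m).
Notation pair_cong := (pair_cong m).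

Lemma pair_congE x y c : pair_cong x y c =
  (cg x (2 * c%:Z) && cg y (- (2 * c%:Z))) || (cg x (- (2 * c%:Z)) && cg y (2 * c%:Z)).
Proof. by rewrite /Defs.pair_cong !eqz_mod_dvd. Qed.

Lemma pair_cong_cl x y c : (c <= mhalf m)%N -> pair_cong x y c -> cl x = c /\ cl y = c.
Proof.
move=> le_c; rewrite pair_congE => /orP[] /andP[xc yc].
  by split; apply: (cl_unique odd_m) => //; rewrite ?xc ?yc ?orbT.
by split; apply: (cl_unique odd_m) => //; rewrite ?xc ?yc ?orbT.
Qed.

(** The conditions on the letters in [admissible], read pair by pair. *)
Fixpoint adm cs a : bool :=
  match cs, a with
  | [::], [:: z] => cg z 0
  | c :: cs', x :: y :: t => [&& y < x, pair_cong x y c & adm cs' t]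
  | _, _ => false
  end.

Lemma admissibleE a cs : admissible m a cs =
  [&& sorted gtn cs, in_range m cs, adm cs a & \sum_(x <- a) x == - m%:Z].
Proof.
rewrite /admissible -/(mhalf m) -/(in_range m cs).
case: (sorted gtn cs); last by rewrite andbF.
case: (in_range m cs); last by rewrite !andbF.
rewrite !andTb !andbA; congr (_ && _).
elim: cs a => [|c cs IHcs] [|x [|y a]] //=; last first.
  rewrite !doubleS !eqSS -{}IHcs (iotaDl 1 0) all_map -!andbA.
  by case: (size a == _); case: (y < x); case: (pair_cong x y c).
by rewrite cg0.
Qed.

(** The contribution of one pair to [n_alpha]. *)
Definition psign x y : nat :=
  has (fun c => pair_cong x y c && (y == - (2 * c%:Z) %[mod m])%Z) (iota 1 m.-1./2).

Lemma n_alpha_cons x y t : n_alpha m (x :: y :: t) = (psign x y + n_alpha m t)%N.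
Proof.
by rewrite /n_alpha /= -/(psign x y) (iotaDl 1 0 (size t)./2) count_map.
Qed.

Lemma psignE x y c : (0 < c <= mhalf m)%N -> pair_cong x y c ->
  psign x y = cg y (- (2 * c%:Z)) :> nat.
Proof.
move=> /andP[c_gt0 le_c] xy; rewrite /psign; congr nat_of_bool.
apply/hasP/idP => [[d]|yc].
  rewrite mem_iota add1n ltnS => /andP[_ le_d] /andP[xyd].
  have [<- _] := pair_cong_cl le_c xy; have [-> _] := pair_cong_cl le_d xyd.
  by rewrite eqz_mod_dvd.
exists c; first by rewrite mem_iota add1n ltnS c_gt0.
by rewrite xy eqz_mod_dvd.
Qed.

Definition pairs s c : seq (int * int) :=
  [seq p <- [seq (x, y) | x <- s, y <- s] | (p.2 < p.1) && pair_cong p.1 p.2 c].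

(** The sequences of Phi with letters in [s] and classes among [cs], whatever
    their sum. *)
Fixpoint alphas s cs : seq (seq int) :=
  if cs is c :: cs' then
    alphas s cs' ++ [seq p.1 :: p.2 :: t | p <- pairs s c, t <- alphas s cs']
  else [seq [:: z] | z <- s & cg z 0].

Lemma pairsP s c x y : ((x, y) \in pairs s c) =
  [&& x \in s, y \in s, y < x & pair_cong x y c].
Proof.
rewrite mem_filter andbC /=; apply/idP/idP.
  by case/and3P=> /allpairsP[[x' y'] [/= xs ys [-> ->]]] -> ->; rewrite xs ys.
by case/and4P=> xs ys -> ->; rewrite allpairs_f.
Qed.

Lemma uniq_pairs s c : uniq s -> uniq (pairs s c).
Proof. by move=> us; apply/filter_uniq/allpairs_uniq => // -[x y] [x' y']. Qed.

Lemma adm_cl cs a x : in_range m cs -> adm cs a -> x \in a -> cl x \in 0%N :: cs.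
Proof.
elim: cs a => [|c cs IHcs] [|y [|z a]] //=; last first.
  case/andP=> /andP[_ le_c] rcs /and3P[_ yz adm_a].
  have [cly clz] := pair_cong_cl le_c yz.
  rewrite !in_cons => /or3P[/eqP->|/eqP->|xa]; rewrite ?cly ?clz ?eqxx ?orbT //.
  by have := IHcs a rcs adm_a xa; rewrite in_cons => /orP[->|->]; rewrite ?orbT.
by move=> _ y0; rewrite inE => /eqP ->; rewrite inE (cl_eq0 odd_m).
Qed.

Lemma mem_alphas s cs a : sorted gtn cs -> in_range m cs ->
  reflect (exists cs', [/\ sorted gtn cs', {subset cs' <= cs}, adm cs' a & all [in s] a])
    (a \in alphas s cs).
Proof.
elim: cs a => [|c cs IHcs] a /=.
  move=> _ _; apply: (iffP mapP) => [[z]|[[|c cs] [_ sub]]].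
  - rewrite mem_filter => /andP[z0 zs] ->; exists [::]; split=> //=.
    by rewrite zs.
  - case: a => [|z [|]] //= z0; rewrite andbT => zs; exists z => //.
    by rewrite mem_filter z0.
  - by have := sub c (mem_head _ _).
move=> p /andP[c_range rcs]; have scs := path_sorted p.
have [lt_c _] := strict_tl (p : sorted gtn (c :: cs)).
rewrite mem_cat; apply: (iffP orP) => [[/(IHcs _ scs rcs)|/allpairsP]|].
- case=> cs' [scs' sub adm_a a_s]; exists cs'; split=> // d /sub dcs.
  by rewrite in_cons dcs orbT.
- case=> -[[x y] t] /= [xy /(IHcs _ scs rcs)[cs' [scs' sub adm_t ts]] ->].
  move: xy; rewrite pairsP => /and4P[xs ys yx xyc].
  exists (c :: cs'); split=> /=.
  + rewrite path_sortedE ?scs' ?andbT; last exact: gtn_trans.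
    by apply/allP => d /sub/(allP lt_c).
  + by move=> d; rewrite !in_cons => /orP[->//|/sub ->]; rewrite orbT.
  + by rewrite yx xyc.
  + by rewrite xs ys.
case=> cs' [scs' sub adm_a a_s].
have [c_cs'|c_cs'] := boolP (c \in cs'); last first.
  left; apply/(IHcs _ scs rcs); exists cs'; split=> // d dcs'.
  have := sub d dcs'; rewrite in_cons => /orP[/eqP dc|//].
  by rewrite -dc dcs' in c_cs'.
right; case: cs' => [//|d cs'] in scs' sub adm_a c_cs' *.
have [lt_d scs''] := strict_tl scs'.
have dc : d = c.
  have := sub d (mem_head _ _); rewrite in_cons => /orP[/eqP //|/(allP lt_c) lt_dc].
  move: c_cs'; rewrite in_cons => /orP[/eqP //|/(allP lt_d) lt_cd].
  by have := ltn_trans lt_cd lt_dc; rewrite ltnn.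
rewrite {}dc in scs' sub adm_a lt_d {c_cs'}.
case: a => [|x [|y t]] // in adm_a a_s *.
move: adm_a a_s => /= /and3P[yx xyc adm_t] /and3P[xs ys ts].
apply/allpairsP; exists ((x, y), t); split=> //=; first by rewrite pairsP xs ys yx.
apply/(IHcs _ scs rcs); exists cs'; split=> // e ecs'.
have := sub e; rewrite !in_cons ecs' orbT => /(_ isT)/orP[/eqP ec|//].
by have := allP lt_d e ecs'; rewrite ec ltnn.
Qed.

Lemma uniq_alphas s cs : uniq s -> uniq cs -> in_range m cs -> sorted gtn cs ->
  uniq (alphas s cs).
Proof.
move=> us; elim: cs => [|c cs IHcs] /=.
  by move=> _ _ _; rewrite map_inj_uniq ?filter_uniq // => x y [].
case/andP=> c_cs ucs /andP[/andP[c_gt0 le_c] rcs] p; have scs := path_sorted p.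
rewrite cat_uniq IHcs // allpairs_uniq ?uniq_pairs ?IHcs //; last first.
  by move=> [[x y] t] [[x' y'] t'] _ _ /= [-> -> ->].
rewrite andbT; apply/hasPn => a /allpairsP[[[x y] t] /= [xy _ ->]].
move: xy; rewrite pairsP => /and4P[_ _ _ /(pair_cong_cl le_c)[clx _]].
apply/negP => /(mem_alphas _ _ scs rcs)[cs' [_ sub adm_a _]].
have rcs' : in_range m cs' by apply/allP => d /sub/(allP rcs).
have := adm_cl rcs' adm_a (mem_head _ _); rewrite clx in_cons => /orP[/eqP c0|/sub].
  by rewrite c0 in c_gt0.
by rewrite (negPf c_cs).
Qed.

(** ** Expansion of the operator *)

Variable X : fock.
Implicit Types f g : X.

Lemma xop_pairs s c f : (0 < c <= mhalf m)%N ->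
  xop m s (2 * c%:Z) f =
  \sum_(p <- pairs s c) (-1) ^+ psign p.1 p.2 *: vop p.1 (vop p.2 f).
Proof.
move=> c_range; set p := 2 * c%:Z; have p0 : ~~ cg p 0 by apply: cg2_neq0.
have pNp x : cg x p -> cg x (- p) = false.
  by move=> xp; rewrite (cg_eql _ xp) (cg_opp odd_m) (negPf p0).
have pNp' x : cg x (- p) -> cg x p = false.
  by move=> xp; apply: contraTF xp => /pNp ->.
pose A x y := if [&& y < x, cg x p & cg y (- p)] then - vop x (vop y f) else 0.
pose B x y := if [&& y < x, cg x (- p) & cg y p] then vop x (vop y f) else 0.
transitivity (\sum_(x <- s) \sum_(y <- s) (A x y + B x y)).
  rewrite /xop big_mkcond /=.
  transitivity (\sum_(x <- s) \sum_(y <- s) A x y + \sum_(x <- s) \sum_(y <- s) B x y).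
    rewrite [X in _ = _ + X]exchange_big -big_split /=; apply: eq_bigr => x _.
    rewrite -big_split /=; case: ifPn => xp; last first.
      by rewrite big1 // => y _; rewrite /A /B (negPf xp) !andbF addr0.
    rewrite big_mkcond /=; apply: eq_bigr => y _; rewrite /A /B xp andbT /=.
    case: ifPn => yp; last by rewrite !andbF addr0.
    rewrite !andbT; case: ltgtP => [_|_|xy]; rewrite ?addr0 ?add0r //.
    by move: yp; rewrite xy (pNp x xp).
  by rewrite -big_split /=; apply: eq_bigr => x _; rewrite big_split.
rewrite /pairs big_filter [RHS]big_mkcond big_allpairs_dep /=; apply: eq_bigr => x _.
apply: eq_bigr => y _; rewrite /A /B /=; case: ltP => //= _; last by rewrite addr0.
case: ifPn => [/andP[xp yp]|H1].
  have xyc : pair_cong x y c by rewrite pair_congE -/p xp yp.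
  by rewrite xyc (psignE c_range xyc) -/p yp (pNp x xp) expr1 scaleN1r addr0.
case: ifPn => [/andP[xp yp]|H2]; last by rewrite pair_congE -/p (negPf H1) (negPf H2) addr0.
have xyc : pair_cong x y c by rewrite pair_congE -/p xp yp orbT.
by rewrite xyc (psignE c_range xyc) -/p (pNp y yp) expr0 scale1r add0r.
Qed.

Lemma Wop_alphas s cs f : in_range m cs ->
  Wop m s cs f = \sum_(a <- alphas s cs) (-1) ^+ n_alpha m a *: vops a f.
Proof.
rewrite /Wop; elim: cs => [|c cs IHcs] /=.
  by move=> _; rewrite big_map big_filter; apply: eq_bigr => z _; rewrite scale1r.
case/andP=> c_range /IHcs E; rewrite big_cat /= -E; congr (_ + _).
rewrite xop_pairs // big_allpairs_dep; apply: eq_bigr => p _.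
rewrite E !vop_sum scaler_sumr; apply: eq_bigr => t _.
by rewrite !vopZ scalerA n_alpha_cons exprD.
Qed.

(** ** Finiteness *)

(** A letter and its opposite have the same class, and two letters of [a] with
    the same class form a pair, the larger one coming first.  So a negative
    letter of [a] cannot be followed by its opposite. *)
Lemma adm_neg cs a (l : seq int) (i : nat) : sorted gtn cs -> in_range m cs -> adm cs a ->
  (0 < i)%N -> all (fun x => `|x|%N != i) l -> - i%:Z \in a -> ~~ alternating (a ++ l) i.
Proof.
move=> + + + i_gt0 li; rewrite /alternating.
have l0 : [seq x <- l | `|x|%N == i] = [::].
  by apply/eqP; rewrite -[_ == _]negbK -has_filter; apply/hasPn => x /(allP li).
have iNi : (- i%:Z == i%:Z) = false by apply/eqP; move: i_gt0; clear; lia.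
elim: cs a => [|c cs IHcs] [|x [|y a]] //=.
  by move=> _ _ _; rewrite inE => /eqP <-; rewrite abszN absz_nat eqxx l0 /= iNi.
move=> p /andP[/andP[c_gt0 le_c] rcs] /and3P[yx xyc adm_a].
have scs := path_sorted p; have [lt_c _] := strict_tl (p : sorted gtn (c :: cs)).
have [clx cly] := pair_cong_cl le_c xyc.
have [clic|clic] := eqVneq (cl i%:Z) c.
  have a_i : - i%:Z \notin a.
    apply/negP => /(adm_cl rcs adm_a); rewrite (clN odd_m) clic in_cons.
    by case/orP=> [/eqP c0|/(allP lt_c)]; [rewrite c0 in c_gt0|rewrite ltnn].
  have a0 : [seq x <- a | `|x|%N == i] = [::].
    apply/eqP; rewrite -[_ == _]negbK -has_filter; apply/hasPn => z za.
    have := adm_cl rcs adm_a za; apply: contraL => /eqP zi.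
    have -> : cl z = c.
      have : (z == i%:Z) || (z == - i%:Z) by move: zi; clear; lia.
      by case/orP=> /eqP ->; rewrite ?(clN odd_m).
    rewrite in_cons negb_or -lt0n c_gt0; apply/negP => /(allP lt_c).
    by rewrite ltnn.
  rewrite !in_cons (negPf a_i) orbF filter_cat a0 l0 => /orP[]/eqP H.
    rewrite -H abszN absz_nat eqxx ifN /= ?iNi //.
    by apply/eqP; move: yx i_gt0; rewrite -H; clear; lia.
  rewrite -H abszN absz_nat eqxx; case: ifP => _ /=; rewrite ?iNi ?andbF //.
have xi : `|x|%N != i by apply: contraNneq clic; rewrite -clx => <-; case: (x) => n //=; rewrite ?NegzE ?(clN odd_m).
have yi : `|y|%N != i by apply: contraNneq clic; rewrite -cly => <-; case: (y) => n //=; rewrite ?NegzE ?(clN odd_m).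
rewrite (negPf xi) (negPf yi) !in_cons => /or3P[/eqP H|/eqP H|/(IHcs _ scs rcs adm_a)//].
  by rewrite -H abszN absz_nat eqxx in xi.
by rewrite -H abszN absz_nat eqxx in yi.
Qed.

Lemma adm_size cs a : adm cs a -> size a = (size cs).*2.+1.
Proof. by elim: cs a => [|c cs IHcs] [|x [|y a]] //= /and3P[_ _ /IHcs ->]. Qed.

(** By [adm_neg] a negative letter is the opposite of a part of [l], and the sum
    of [a] being fixed this also bounds the positive letters. *)
Lemma adm_bound cs a (l : seq nat) : sorted gtn cs -> in_range m cs -> adm cs a ->
  \sum_(x <- a) x = - m%:Z -> ~~ vanishing (a ++ map Posz l) ->
  all [in win (m * sumn l)] a.
Proof.
move=> scs rcs adm_a sum_a van; set B := sumn l.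
have ge x : x \in a -> - B%:Z <= x.
  move=> xa; rewrite leNgt; apply/negP => lt_x.
  have x0 : x != 0 by apply/eqP => x0; move: lt_x; rewrite x0; clear; lia.
  have := hasPn van x; rewrite mem_cat xa => /(_ isT); rewrite x0 negbK /=.
  apply/negP; apply: adm_neg scs rcs adm_a _ _ _; first by rewrite absz_gt0.
    apply/allP => _ /mapP[d dl ->].
    have : (d <= B)%N by rewrite /B sumnE (big_rem d) //= leq_addr.
    by move: lt_x; clear; lia.
  by have -> : - `|x|%N%:Z = x by move: lt_x; clear; lia.
have le_size : (size a <= m)%N.
  rewrite (adm_size adm_a) (mhalfE odd_m) ltnS leq_double.
  have : uniq cs by apply: sorted_uniq scs; [exact: gtn_trans|move=> x; rewrite /= ltnn].
  move=> ucs; rewrite -(size_iota 1 (mhalf m)); apply: uniq_leq_size => // c /(allP rcs).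
  by rewrite mem_iota add1n ltnS.
have sum_ge t : {subset t <= a} -> - ((size t)%:Z * B%:Z) <= \sum_(y <- t) y.
  elim: t => [|y t IHt] sub; first by rewrite big_nil mul0r.
  rewrite big_cons /=; have /IHt : {subset t <= a} by move=> z zt; apply: sub; rewrite in_cons zt orbT.
  have := ge y (sub y (mem_head _ _)); move: (\sum_(_ <- _) _) => u; clear; lia.
have m_gt0 : (0 < m)%N by case: (m) odd_m.
apply/allP => x xa; rewrite /= mem_win.
have := sum_ge (rem x a) (mem_subseq (rem_subseq x a)).
move: sum_a (ge x xa); rewrite (big_rem x) //= size_rem //.
move: (\sum_(_ <- _) _) le_size m_gt0; case: (size a) => [|k] u; clear; nia.
Qed.

End Admissible.

(** * Character values *)

Lemma padl_perm (X : fock) (s t : seq nat) (f : X) : all odd s -> perm_eq s t ->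
  padl s f = padl t f.
Proof.
elim: s t => [|k s IHs] t; first by move=> _ /perm_size; case: t.
case/andP=> odd_k odd_s kst; have kt : k \in t by rewrite -(perm_mem kst) mem_head.
have odd_t : all odd t by rewrite -(perm_all _ kst) /= odd_k.
case/splitPr: kt kst odd_t => t1 t2; rewrite perm_sym (perm_catCA t1 [:: k]) perm_cons perm_sym.
move=> /(IHs _ odd_s) /= ->; rewrite all_cat => /andP[odd_t1 _].
elim: t1 odd_t1 {IHs} => //= j t1 IHt /andP[odd_j /IHt <-].
by rewrite padC //; [case: (k) odd_k | case: (j) odd_j].
Qed.

Lemma sumnE_int (l : seq nat) : (sumn l)%:Z = \sum_(a <- l) a%:Z.
Proof. by elim: l => [|a l IHl]; rewrite ?big_nil // big_cons /= PoszD IHl. Qed.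

Section Characters.
Variables (R : realType) (St : forall n : nat, tildeS n) (S : schurQ)
  (P : spin_characters R St S).

Let value (mu : seq nat) (f : LamFock) : rat := sp (1 : LamFock) (padl mu f).

Lemma tpsi_ofE (l : spart) mu : is_part mu -> all odd mu -> sumn l = sumn mu ->
  tpsi_of (psi P) (gelt P) l mu = ratr (value mu (vspart LamFock l)).
Proof.
move=> part_mu odd_mu sum_l; have [c E ->] := psi_label P part_mu odd_mu sum_l.
congr ratr; rewrite /value.
have [<- _] := schurQ_pieri S l odd_mu.
rewrite E.
have := spZr (1 : LamFock) c 1; rewrite sp11 mulr1.
by move=> ->.
Qed.

(** The summand of [tpsi] as a function of a basis vector. *)
Definition psi_ext mu (l : spart) : R[i]^o :=
  if sumn l == sumn mu then tpsi_of (psi P) (gelt P) l mu else 0.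

Lemma tpsi_linext v mu : tpsi P v mu = linext (psi_ext mu) v.
Proof.
rewrite /tpsi /linext big_mkcond; apply: eq_bigr => l _; rewrite /psi_ext.
by case: ifP => _; rewrite ?scaler0.
Qed.

(** If the sizes differ, both sides vanish, the right one for reasons of
    degree. *)
Lemma tpsi_word (a : seq int) mu : is_part mu -> all odd mu ->
  tpsi P (word R a) mu = ratr (value mu (vword LamFock a)).
Proof.
move=> part_mu odd_mu.
have [c [l [-> E]]] := word_vword R LamFock a.
rewrite tpsi_linext linextU /value E padlZ spZr; set q := sp _ _.
transitivity (ratr c * ratr q : R[i]); last by rewrite rmorphM.
congr (_ * _); rewrite /psi_ext.
case: eqP => [sum_l|/eqP sum_l]; first exact: tpsi_ofE.
have -> : q = 0; last by rewrite rmorph0.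
apply: sp1_padl_vword => //; rewrite big_map -sumnE_int.
by rewrite eqz_nat.
Qed.

End Characters.

(** The sequences with a letter outside the window are zero in the space F. *)
Lemma Phi_basisE (R : realType) (m : nat) (odd_m : odd m) (l : spart) (N : nat) :
  (m * sumn l <= N)%N ->
  Phi_basis R m l =
  \sum_(a <- [seq a <- alphas m (win N) (classes m) | \sum_(x <- a) x == - m%:Z])
    (-1) ^+ n_alpha m a *: word R (a ++ map Posz l).
Proof.
move=> le_N; rewrite /Phi_basis.
have scl : sorted gtn (classes m) by rewrite rev_sorted; apply: iota_ltn_sorted.
have rcl := classes_range m; have ucl := classes_uniq m.
rewrite [RHS]fsbig_seq ?filter_uniq ?uniq_alphas ?win_uniq //.
apply/esym; apply: fsbig_widen => [a|a [[cs]]] /=.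
  rewrite mem_filter => /andP[sum_a /(mem_alphas _ _ scl rcl)[cs [scs sub adm_a _]]].
  exists cs; rewrite admissibleE scs adm_a sum_a !andbT /=.
  by apply/allP => c /sub/(allP rcl).
rewrite admissibleE => /and4P[scs rcs adm_a /eqP sum_a] na.
rewrite /preimage /=; have [van|nvan] := boolP (vanishing (a ++ map Posz l)).
  by rewrite /word van scaler0.
case: na; rewrite mem_filter sum_a eqxx; apply/(mem_alphas _ _ scl rcl).
exists cs; split=> //.
  by move=> c /(allP rcs); rewrite mem_classes.
have := adm_bound odd_m scs rcs adm_a sum_a nvan; apply: sub_all => x.
by rewrite /= !mem_win => /leq_trans; apply.
Qed.

Theorem corollary4p1 (R : realType) (St : forall n : nat, tildeS n)
    (X : schurQ) (P : spin_characters R St X)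
    (m : nat) (hm : odd m) (lambda : spart) (mu : seq nat)
    (hmu : is_part mu) (hodd : all odd mu)
    (hndiv : all (fun r => ~~ (m %| r)%N) mu)
    (hsize : sumn lambda = (sumn mu + m)%N) :
  tpsi P << lambda >> (sort geq (m :: mu))
  = tpsi P (- (1 / 2%:R) *: Phi m << lambda >>) mu.
Proof.
have m_gt0 : (0 < m)%N by case: (m) hm.
have perm_nu : perm_eq (sort geq (m :: mu)) (m :: mu) by rewrite perm_sort.
set nu := sort _ _ in perm_nu *.
have odd_nu : all odd nu by rewrite (perm_all _ perm_nu) /= hm.
have part_nu : is_part nu.
  rewrite /is_part sort_sorted ?(perm_mem perm_nu) ?in_cons ?negb_or /=; last first.
    by move=> x y; apply: leq_total.
  by rewrite eq_sym -lt0n m_gt0; case/andP: hmu.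
have sum_nu : sumn lambda = sumn nu by rewrite (perm_sumn perm_nu) hsize addnC.
pose V : LamFock := vspart LamFock lambda.
have sum_V : \sum_(a <- map Posz lambda) a = (sumn mu + m)%N%:Z.
  by rewrite big_map -sumnE_int hsize.
have [D HD] := sp1_padl_W LamFock hm hodd hndiv sum_V.
pose N := (D + m * sumn lambda)%N.
have -> : tpsi P << lambda >> nu = ratr (sp (1 : LamFock) (padl (m :: mu) V)).
  rewrite tpsi_linext linextU scale1r /psi_ext sum_nu eqxx tpsi_ofE //.
  by rewrite (padl_perm V odd_nu perm_nu).
have := HD N (leq_addr _ _); rewrite -[vword _ _]/V.
set t := sp _ (padl (m :: mu) V) => tE.
have -> : Phi m (<< lambda >> : Fspace R) = Phi_basis R m lambda.
  exact: etrans (linextU _ 1 lambda) (scale1r _).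
rewrite (@Phi_basisE _ _ hm _ N) ?leq_addl //.
pose F (a : seq int) : rat := (-1) ^+ n_alpha m a * sp (1 : LamFock) (padl mu (vops a V)).
have term (a : seq int) : linext (psi_ext P mu)
    ((-1) ^+ n_alpha m a *: word R (a ++ map Posz lambda)) = ratr (F a).
  transitivity ((-1) ^+ n_alpha m a * tpsi P (word R (a ++ map Posz lambda)) mu).
    by rewrite tpsi_linext linearZ.
  rewrite tpsi_word // vword_cat /F; set u := sp _ _.
  by rewrite rmorphM rmorphXn rmorphN1.
rewrite tpsi_linext linearZ linear_sum (eq_bigr _ (fun a _ => term a)) big_filter.
have -> : \sum_(a <- alphas m (win N) (classes m) | \sum_(x <- a) x == - m%:Z) ratr (F a) =
    ratr (- 2 * t) :> R[i].
  rewrite -tE Wop_alphas ?classes_range // padl_sum sp_sumr rmorph_sum big_mkcond.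
  apply: eq_bigr => a _; rewrite padlZ spZr; case: eqP => // /eqP neq.
  rewrite -vword_cat sp1_padl_vword ?mulr0 ?rmorph0 // big_cat.
  apply: contraNneq neq; rewrite sum_V PoszD /= => H; apply/eqP.
  move: H; move: (\sum_(x <- a) x) => u; clear; lia.
rewrite -[RHS]/(- (1 / 2%:R) * ratr (- 2 * t)) rmorphM rmorphN rmorph_nat.
by rewrite mulrA mulrNN div1r mulVf ?mul1r // pnatr_eq0.
Qed.
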